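(* Let $A$ be a finite-dimensional complex semisimple algebra. There is a one-to-one correspondence between the maximal connected grading classes of $A$ and the (finite) formal sums $\sum a(m,\gamma)\gamma^{m}$ with non-negative integer coefficients $a(m,\gamma)$ such that $$\chi_A(z)=\sum a(m,\gamma)\,m^{-z}\,\zeta_{\gamma}(z),$$ and such that $a(m,\gamma)\le 1$ if $\gamma^m$ is trivial. Here $\gamma^m$ is a formal term assigned to each positive integer $m$ and each $\mathrm{Aut}(G)$-orbit $\gamma$ of cohomology classes in $H^2(G,\mathbb{C}^* )$, where $G$ runs over the finite groups (up to isomorphism), and a formal sum may contain orbits in the cohomologies of several groups $G$.
   Context: Gradings. A grading of a finite-dimensional $\mathbb{C}$-algebra $A$ by a group $\Gamma$ is a vector space decomposition $A=\bigoplus_{g\in \Gamma}A_g$ with $A_gA_h\subseteq A_{gh}$; its support is $\{g: A_g\neq 0\}$, and the grading is connected if its support generates $\Gamma$. A graded morphism from a $\Gamma$-graded algebra $A$ to a $\Delta$-graded algebra $B$ is a pair $(\psi,\phi)$ of an algebra homomorphism $\psi:A\to B$ and a group homomorphism $\phi:\Gamma\to \Delta$ with $\psi(A_g)\subseteq B_{\phi(g)}$ for all $g$. It is a graded-equivalence if $\psi$ and $\phi$ are both isomorphisms; it is a quotient morphism (and $B$ with its $\Delta$-grading is a quotient grading of $A$ with its $\Gamma$-grading) if $\psi$ is an isomorphism and $\phi$ is onto. A connected grading class of $A$ is a graded-equivalence class of connected gradings of $A$. The quotient relation is a partial order on the connected grading classes of $A$; maximal connected grading classes are those that are maximal for it,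 i.e. which are not proper quotients of other connected grading classes. Zeta functions. If $A\cong\bigoplus_n M_n(\mathbb{C})^{b(n)}$, put $\chi_A(z):=\sum_n b(n)n^{-z}$. For a finite group $G$ and $f\in Z^2(G,\mathbb{C}^* )$, the twisted group algebra $\mathbb{C}^fG$ has basis $\{u_g\}_{g\in G}$ and multiplication $u_gu_h=f(g,h)u_{gh}$; it is semisimple, $\mathbb{C}^fG\cong \bigoplus_{[W]\in\mathrm{Irr}(G,f)}\mathrm{End}_{\mathbb{C}}(W)$, where $\mathrm{Irr}(G,f)$ is the set of equivalence classes of irreducible complex $f$-projective representations of $G$. Put $\zeta_f(z):=\chi_{\mathbb{C}^fG}(z)=\sum_{[W]\in \mathrm{Irr}(G,f)}(\dim W)^{-z}$. The group $\mathrm{Aut}(G)$ acts on $H^2(G,\mathbb{C}^* )$ by $\phi([f])=[\phi(f)]$, $\phi(f)(g_1,g_2)=f(\phi^{-1}(g_1),\phi^{-1}(g_2))$. The function $\zeta_f$ depends only on the $\mathrm{Aut}(G)$-orbit $\gamma$ of $[f]$, and is written $\zeta_\gamma$. The term $\gamma^m$ is trivial if $G$ is the one-element group and $m=1$. *)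

(* Defs.v *)
From Stdlib Require List.
From HB Require Import structures.
From mathcomp Require Import all_boot all_order all_algebra all_fingroup.
From mathcomp Require Import finmap complex.
From mathcomp Require Import boolp classical_sets functions reals exp trigo.

Set Implicit Arguments.
Unset Strict Implicit.
Unset Printing Implicit Defensive.

Import GRing.Theory.

Local Open Scope ring_scope.

(* Equivalence classes as predicates: [{eq_quot _}] needs a [choiceType], and
   [finGroupType] and the type of all gradings are too large (in the universe
   sense) to carry such a structure. *)
Definition eqclass (T : Type) (e : T -> T -> Prop) :=
  {c : T -> Prop | exists x, c = e x}.

Definition eqclass_of (T : Type) (e : T -> T -> Prop) (x : T) : eqclass e :=
  exist _ (e x) (ex_intro _ x erefl).

Definition eqclass_repr (T : Type) (e : T -> T -> Prop) (c : eqclass e) : T :=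
  sval (cid (svalP c)).

(* Associative unital algebras of finite dimension, zero algebra included:
   [falgType] excludes the zero algebra, and Hierarchy-Builder accepts no
   structure joining [pzRingType] and [vectType]. *)
Record fdAlgebra (K : fieldType) := FdAlgebra {
  fda_vect : vectType K;
  fda_one : fda_vect;
  fda_mul : fda_vect -> fda_vect -> fda_vect;
  fda_mulA : associative fda_mul;
  fda_mul1l : left_id fda_one fda_mul;
  fda_mul1r : right_id fda_one fda_mul;
  fda_mulDl : left_distributive fda_mul +%R;
  fda_mulDr : right_distributive fda_mul +%R;
  fda_scaleAl : forall k x y, k *: fda_mul x y = fda_mul (k *: x) y;
  fda_scaleAr : forall k x y, k *: fda_mul x y = fda_mul x (k *: y)
}.

Definition fda_sort (K : fieldType) (A : fdAlgebra K) : Type := fda_vect A.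
Coercion fda_sort : fdAlgebra >-> Sortclass.

HB.instance Definition _ (K : fieldType) (A : fdAlgebra K) :=
  Vector.copy (fda_sort A) (fda_vect A).
HB.instance Definition _ (K : fieldType) (A : fdAlgebra K) :=
  GRing.Zmodule_isPzRing.Build (fda_sort A) (@fda_mulA K A) (@fda_mul1l K A)
    (@fda_mul1r K A) (@fda_mulDl K A) (@fda_mulDr K A).

Definition matrix_fda (K : fieldType) (n : nat) : fdAlgebra K :=
  @FdAlgebra K 'M[K]_n 1%:M mulmx (@mulmxA K n n n n) (@mul1mx K n n)
    (@mulmx1 K n n) (@mulmxDl K n n n) (@mulmxDr K n n n)
    (@scalemxAl K n n n) (@scalemxAr K n n n).

Definition alg_hom (K : fieldType) (A B : fdAlgebra K) (f : A -> B) :=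
  [/\ linear f, f 1 = 1 & {morph f : x y / x * y}].

Section Semisimple.
Variables (K : fieldType) (A : fdAlgebra K).

(* As [A] is unital, its left ideals are automatically subspaces. *)
Definition left_ideal (I : {vspace A}) :=
  forall a x : A, x \in I -> a * x \in I.

Definition semisimple_algebra :=
  forall I : {vspace A}, left_ideal I ->
  exists J : {vspace A},
    [/\ left_ideal J, (I + J = fullv)%VS & (I :&: J = 0)%VS].

(* [A] is isomorphic to the sum over n >= 1 of M_n(K)^{b(n)}; the isomorphism
   is given by its components [p n i], for [i < b n]. *)
Definition matrix_decomposition (b : {fsfun nat -> nat with 0%N}) :=
  b 0%N = 0%N /\
  exists p : forall n : nat, 'I_(b n) -> A -> matrix_fda K n,
    (forall n i, alg_hom (p n i)) /\
    bijective (fun a => (fun n i => p n i a)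
                 : forall n : nat, 'I_(b n) -> matrix_fda K n).

(* The default value [[fsfun]] (the zero function) is only used when [A] is
   not isomorphic to a sum of matrix algebras over [K]. *)
Definition block_mult : {fsfun nat -> nat with 0%N} :=
  xget [fsfun] [set b | matrix_decomposition b]%classic.

End Semisimple.

Section Gradings.
Variable K : fieldType.
Local Open Scope group_scope.

Record grading (A : fdAlgebra K) (Gamma : groupType) := Grading {
  gcomp :> Gamma -> {vspace A};
  gcomp_gen : forall a : A, exists (s : seq Gamma) (x : Gamma -> A),
    (forall g, x g \in gcomp g) /\ a = (\sum_(g <- s) x g)%R;
  gcomp_free : forall (s : seq Gamma) (x : Gamma -> A),
    uniq s -> (forall g, x g \in gcomp g) -> (\sum_(g <- s) x g = 0)%R ->
    forall g, g \in s -> x g = 0%R;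
  gcompM : forall (g h : Gamma) (x y : A),
    x \in gcomp g -> y \in gcomp h -> (x * y)%R \in gcomp (g * h)
}.

Definition gsupport (A : fdAlgebra K) (Gamma : groupType)
    (gA : grading A Gamma) : set Gamma := [set g | gA g <> 0%VS]%classic.

Definition is_connected (A : fdAlgebra K) (Gamma : groupType)
    (gA : grading A Gamma) :=
  forall H : {pred Gamma}, group_closed H ->
    (forall g, gsupport gA g -> g \in H) -> forall g, g \in H.

Definition graded_morphism (A B : fdAlgebra K) (Gamma Delta : groupType)
    (gA : grading A Gamma) (gB : grading B Delta)
    (psi : A -> B) (phi : Gamma -> Delta) :=
  [/\ alg_hom psi, {morph phi : g h / g * h}
    & forall g x, x \in gA g -> psi x \in gB (phi g)].

Definition graded_equivalence (A B : fdAlgebra K) (Gamma Delta : groupType)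
    (gA : grading A Gamma) (gB : grading B Delta)
    (psi : A -> B) (phi : Gamma -> Delta) :=
  [/\ graded_morphism gA gB psi phi, bijective psi & bijective phi].

Definition quotient_morphism (A B : fdAlgebra K) (Gamma Delta : groupType)
    (gA : grading A Gamma) (gB : grading B Delta)
    (psi : A -> B) (phi : Gamma -> Delta) :=
  [/\ graded_morphism gA gB psi phi, bijective psi
    & forall d, exists g, phi g = d].

Section Classes.
Variable A : fdAlgebra K.

Record conn_grading := ConnGrading {
  cg_group : groupType;
  cg_grading : grading A cg_group;
  cg_connected : is_connected cg_grading
}.

Definition graded_equiv (X Y : conn_grading) :=
  exists psi phi, graded_equivalence (cg_grading X) (cg_grading Y) psi phi.

Definition conn_grading_class := eqclass graded_equiv.

(* [d] is a quotient of [c]. *)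
Definition quotient_class (c d : conn_grading_class) :=
  exists X Y : conn_grading,
    [/\ eqclass_of graded_equiv X = c, eqclass_of graded_equiv Y = d
      & exists psi phi,
          quotient_morphism (cg_grading X) (cg_grading Y) psi phi].

Definition maximal_class (d : conn_grading_class) :=
  forall c, quotient_class c d -> c = d.

End Classes.
End Gradings.

Section Cohomology.
Variables (K : fieldType) (G : finGroupType).
Local Open Scope group_scope.

Record cocycle2 := Cocycle2 {
  cocycle_fun :> G -> G -> K;
  cocycle_neq0 : forall g h, cocycle_fun g h != 0%R;
  cocycleP : forall g h k,
    (cocycle_fun g h * cocycle_fun (g * h)%g k =
     cocycle_fun h k * cocycle_fun g (h * k)%g)%R
}.

Definition cohomologous (f f' : cocycle2) :=
  exists2 l : G -> K, forall g, l g != 0%R &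
    forall g h, f' g h = (f g h * (l g * l h / l (g * h)%g))%R.

Definition H2 := eqclass cohomologous.

Definition aut_fun (phi : {perm G}) (f : G -> G -> K) (g h : G) : K :=
  f (phi^-1 g) (phi^-1 h).

Lemma aut_fun_cocycle (phi : {perm G}) (f : cocycle2) :
  phi \in Aut [set: G] -> forall g h k : G,
    (aut_fun phi f g h * aut_fun phi f (g * h)%g k =
     aut_fun phi f h k * aut_fun phi f g (h * k)%g)%R.
Proof.
move=> Aphi g h k.
have phiM x y : phi^-1 (x * y) = phi^-1 x * phi^-1 y.
  by have /Aut_morphic/morphicP -> := groupVr Aphi; rewrite ?inE.
by rewrite /aut_fun !phiM cocycleP.
Qed.

Definition aut_cocycle (phi : {perm G}) (Aphi : phi \in Aut [set: G])
    (f : cocycle2) : cocycle2 :=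
  @Cocycle2 (aut_fun phi f) (fun g h => cocycle_neq0 f _ _)
    (aut_fun_cocycle f Aphi).

(* phi([f]) = [phi(f)] *)
Definition aut_related (c d : H2) :=
  exists (phi : {perm G}) (Aphi : phi \in Aut [set: G]) (f : cocycle2),
    c = eqclass_of cohomologous f /\
    d = eqclass_of cohomologous (aut_cocycle Aphi f).

Definition H2_orbit := eqclass aut_related.

End Cohomology.

Section TwistedGroupAlgebra.
Variables (K : fieldType) (G : finGroupType) (f : cocycle2 K G).

Local Notation V := {ffun G -> K^o}.

Definition tw_basis (g : G) : V := [ffun h => (h == g)%:R].

Definition tw_mul (a b : V) : V :=
  \sum_(g : G) \sum_(h : G) (a g * b h * f g h) *: tw_basis (g * h)%g.

(* The unit is f(1,1)^-1 u_1, as the cocycle need not be normalized. *)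
Definition tw_one : V := (f 1%g 1%g)^-1 *: tw_basis 1%g.

Lemma tw_mulE a b k :
  tw_mul a b k = \sum_(g : G) a g * b (g^-1 * k)%g * f g (g^-1 * k)%g.
Proof.
rewrite /tw_mul sum_ffunE; apply: eq_bigr => g _.
rewrite sum_ffunE (bigD1 (g^-1 * k)%g) //= big1 ?addr0 => [|h hk].
  by rewrite !ffunE mulKVg eqxx -[LHS]/(_ * _) mulr1.
rewrite !ffunE; case: eqP => [kE|_]; last exact: scaler0.
by rewrite kE mulKg eqxx in hk.
Qed.

Lemma tw_basisM g h :
  tw_mul (tw_basis g) (tw_basis h) = f g h *: tw_basis (g * h)%g.
Proof.
have b0 i j : i != j -> tw_basis j i = 0 by rewrite ffunE => /negPf ->.
have b1 i : tw_basis i i = 1 by rewrite ffunE eqxx.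
rewrite /tw_mul (bigD1 g) //= [X in _ + X]big1 => [|i ig]; last first.
  by rewrite big1 // => j _; rewrite b0 // !mul0r scale0r.
rewrite addr0 (bigD1 h) //= big1 => [|j jh]; last first.
  by rewrite b1 b0 // mulr0 mul0r scale0r.
by rewrite addr0 !b1 !mul1r.
Qed.

Lemma tw_mulA : associative tw_mul.
Proof.
move=> a b c; apply/ffunP => k; rewrite !tw_mulE.
transitivity (\sum_(h : G) \sum_(g : G)
    a h * b (h^-1 * g)%g * f h (h^-1 * g)%g * c (g^-1 * k)%g
      * f g (g^-1 * k)%g); last first.
  rewrite exchange_big /=; apply: eq_bigr => g _.
  by rewrite tw_mulE !mulr_suml.
apply: eq_bigr => h _; rewrite tw_mulE mulr_sumr mulr_suml.
rewrite [RHS](reindex_inj (mulgI h)) /=; apply: eq_bigr => g _.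
have := cocycleP f h g ((h * g)^-1 * k).
rewrite mulKg invMg !mulgA mulgV mul1g -!mulgA => fE.
by rewrite -[LHS]mulrA -[_ * f g _ * _]mulrA -fE; rewrite !mulrA;
  congr (_ * _); rewrite -!mulrA [c _ * _]mulrC.
Qed.

Lemma tw_oneE g : tw_one g = if g == 1%g then (f 1%g 1%g)^-1 else 0.
Proof.
rewrite !ffunE -[LHS]/(_ * _); case: (g == 1%g); last exact: mulr0.
exact: mulr1.
Qed.

Lemma tw_mul1l : left_id tw_one tw_mul.
Proof.
move=> a; apply/ffunP => k.
rewrite tw_mulE (bigD1 1%g) //= big1 ?addr0 => [|g g1]; last first.
  by rewrite tw_oneE (negPf g1) !mul0r.
rewrite tw_oneE eqxx invg1 mul1g.
have := cocycleP f 1 1 k; rewrite !mul1g => /(mulIf (cocycle_neq0 f _ _)) <-.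
by rewrite mulrAC mulVf ?cocycle_neq0 // mul1r.
Qed.

Lemma tw_mul1r : right_id tw_one tw_mul.
Proof.
move=> a; apply/ffunP => k.
rewrite tw_mulE (bigD1 k) //= big1 ?addr0 => [|g gk]; last first.
  by rewrite tw_oneE -eq_mulVg1 (negPf gk) mulr0 mul0r.
rewrite mulVg tw_oneE eqxx.
have := cocycleP f k 1 1; rewrite !mulg1 => /(mulIf (cocycle_neq0 f _ _)) ->.
by rewrite -mulrA mulVf ?cocycle_neq0 // mulr1.
Qed.

Lemma tw_mulDl : left_distributive tw_mul +%R.
Proof.
move=> a b c; apply/ffunP => k; rewrite ffunE !tw_mulE -big_split /=.
by apply: eq_bigr => g _; rewrite ffunE !mulrDl.
Qed.

Lemma tw_mulDr : right_distributive tw_mul +%R.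
Proof.
move=> a b c; apply/ffunP => k; rewrite ffunE !tw_mulE -big_split /=.
by apply: eq_bigr => g _; rewrite ffunE mulrDr mulrDl.
Qed.

Lemma tw_scaleAl k a b : k *: tw_mul a b = tw_mul (k *: a) b.
Proof.
apply/ffunP => x; rewrite ffunE !tw_mulE scaler_sumr.
by apply: eq_bigr => g _; rewrite ffunE -[LHS]/(k * _) -[_ *: _]/(k * _) !mulrA.
Qed.

Lemma tw_scaleAr k a b : k *: tw_mul a b = tw_mul a (k *: b).
Proof.
apply/ffunP => x; rewrite ffunE !tw_mulE scaler_sumr.
by apply: eq_bigr => g _; rewrite ffunE -[LHS]/(k * _) -[_ *: _]/(k * _) mulrA [in LHS]mulrCA.
Qed.

Definition twisted_group_algebra : fdAlgebra K :=
  @FdAlgebra K V tw_one tw_mul tw_mulA tw_mul1l tw_mul1r tw_mulDl tw_mulDr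
    tw_scaleAl tw_scaleAr.

End TwistedGroupAlgebra.

Section FormalTerms.
Variable K : fieldType.

Definition fingroup_class :=
  eqclass (fun G H : finGroupType => [set: G]%G \isog [set: H]%G).

Record term := Term {
  term_exp : nat;
  term_exp_gt0 : (0 < term_exp)%N;
  term_class : fingroup_class;
  term_orbit : H2_orbit K (eqclass_repr term_class)
}.

Definition term_group (t : term) : finGroupType := eqclass_repr (term_class t).

Definition trivial_term (t : term) :=
  term_exp t = 1%N /\ #|term_group t| = 1%N.

End FormalTerms.

Section Zeta.
Variable R : realType.
Local Open Scope complex_scope.

(* n^s = exp(s ln n), for n > 0 *)
Definition nat_cpow (n : nat) (s : R[i]) : R[i] :=
  let: x +i* y := s in
  (n%:R `^ x * cos (y * ln n%:R)) +i* (n%:R `^ x * sin (y * ln n%:R)).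

Definition chi (A : fdAlgebra R[i]) (z : R[i]) : R[i] :=
  \sum_(n <- finsupp (block_mult A)) (block_mult A n)%:R * nat_cpow n (- z).

Definition zeta_cocycle (G : finGroupType) (f : cocycle2 R[i] G) (z : R[i]) :=
  chi (twisted_group_algebra f) z.

(* [zeta_cocycle f] only depends on the orbit of the class of [f]. *)
Definition zeta (G : finGroupType) (gamma : H2_orbit R[i] G) (z : R[i]) :=
  zeta_cocycle (eqclass_repr (eqclass_repr gamma)) z.

(* A finite formal sum is the function [a] of its coefficients; the
   duplicate-free list [s] of the terms of nonzero coefficient witnesses that
   it is finite. *)
Definition chi_sum (A : fdAlgebra R[i]) (a : term R[i] -> nat) :=
  exists s : seq (term R[i]),
    [/\ List.NoDup s, forall t, List.In t s <-> a t <> 0%N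
      & forall z : R[i], chi A z =
          \sum_(t <- s)
            (a t)%:R * nat_cpow (term_exp t) (- z) * zeta (term_orbit t) z].

End Zeta.

(* Main.v *)
Require Import Defs.
From HB Require Import structures.
From mathcomp Require Import all_boot all_order all_algebra all_fingroup.
From mathcomp Require Import generic_quotient complex finmap ring.
From mathcomp Require Import boolp classical_sets reals exp trigo.

(** Why the theorem holds.

Call twisted units of a semisimple algebra [A] a basis [v c i j g], where [c]
ranges over a finite set of blocks, [i] and [j] over a finite index set and
[g] over a finite group [G] attached to [c], which multiplies like matrix
units tensored with the basis of the twisted group algebra of [G]. Twisted
units identify [A] with the sum over [c] of the matrix algebras over [C^f G],
so up to isomorphism of the blocks their type is a formal sum of terms.

- Every grading of [A] admits twisted units made of homogeneous elements
  ([homogeneous_units]): [1] is a sum of orthogonal graded primitive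
  idempotents [e] of degree 1, each [e A e] is a graded division algebra with
  one-dimensional components, hence a twisted group algebra, and a nonzero
  homogeneous element of [e A e'] is invertible between the two corners.

- Twisted units carry a universal grading, by the group generated by the
  basis with the relations [d(i,j,g) d(j,k,h) = d(i,k,gh)]. Each connected
  grading in which the units are homogeneous is a quotient of it
  ([universal_quotient]). Its component of degree 1 is spanned by the diagonal
  idempotents and the other components are lines ([udeg_sep]), which is why
  the type of the units can be read off the grading
  ([graded_equivalence_blocks]).

- Let a universal grading with at most one block isomorphic to [C] be a
  quotient of another one. The kernel contains no nontrivial degree of a unit:
  such a degree would put a whole block into the component of degree 1, which
  is reduced and commutative, and that block would be a sum of at least two
  ideals isomorphic to [C] ([support_kernel]). So the quotient is an
  equivalence ([phi_injective]) and the grading is maximal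
  ([maximal_units]). With two blocks isomorphic to [C] the grading is
  not maximal, since [C + C] is the group algebra of a group of order 2
  ([two_trivial_not_maximal]).

Thus maximal classes correspond to the types of twisted units of [A] with at
most one trivial block. The zeta identity is the numerical form of the
existence of units of a given type ([chi_units], [units_of_chi]): refining the
units of [A] by matrix units of the algebras [C^f G] gives matrix units of
[A]; the multiset of sizes of matrix units determines the algebra and is
determined by the function [chi], whose values at the integers are power sums
of these sizes. *)

Set Implicit Arguments.
Unset Strict Implicit.
Unset Printing Implicit Defensive.

Import Order.TTheory GRing.Theory Num.Theory.
Local Open Scope ring_scope.
Local Open Scope quotient_scope.

(** * Semiprime algebras *)

Section FdAlgebra.
Variables (K : fieldType) (A : fdAlgebra K).

Lemma fda_scalerAl (k : K) (x y : A) : k *: (x * y) = (k *: x) * y.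
Proof. exact: fda_scaleAl. Qed.

Lemma fda_scalerAr (k : K) (x y : A) : k *: (x * y) = x * (k *: y).
Proof. exact: fda_scaleAr. Qed.

Definition rmul (x a : A) : A := a * x.

Lemma rmul_linear x : linear (rmul x).
Proof. by move=> k a b; rewrite /rmul mulrDl fda_scalerAl. Qed.

HB.instance Definition _ x := GRing.isLinear.Build K A A _ (rmul x) (rmul_linear x).

(** All that the structure theory needs of semisimplicity. For twisted group
algebras it is also quicker to prove than semisimplicity. *)
Definition semiprime := forall x : A, (forall a, x * a * x = 0) -> x = 0.

Definition principal (x : A) : {vspace A} := limg (linfun (rmul x)).

Lemma principalP (x y : A) : reflect (exists a, y = a * x) (y \in principal x).
Proof.
apply: (iffP memv_imgP) => [[a _ ->]|[a ->]].
  by exists a; rewrite lfunE.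
by exists a; rewrite ?memvf // lfunE.
Qed.

Lemma mem_principal (x : A) : x \in principal x.
Proof. by apply/principalP; exists 1; rewrite mul1r. Qed.

Lemma principal_mull (x a y : A) : y \in principal x -> a * y \in principal x.
Proof. by case/principalP=> b ->; apply/principalP; exists (a * b); rewrite mulrA. Qed.

Lemma principal_sub (x y : A) : y \in principal x -> (principal y <= principal x)%VS.
Proof.
by move=> yx; apply/subvP=> _ /principalP[a ->]; apply: principal_mull.
Qed.

(** If [x A x = 0], a complement of the left ideal [A x] gives [e] in [A x] acting
on [A x] as a right unit; then [e = e e = 0], so [A x = 0]. *)
Lemma semisimple_semiprime : semisimple_algebra A -> semiprime.
Proof.
move=> ssA x xAx.
have [|J [Jl IJ1 IJ0]] := ssA (principal x); first by move=> a y; apply: principal_mull.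
have: 1 \in (principal x + J)%VS by rewrite IJ1 memvf.
case/memv_addP=> e eI [j jJ e1].
have e_id y : y \in principal x -> y = y * e.
  move=> yI; have: y - y * e \in (principal x :&: J)%VS.
    rewrite memv_cap rpredB ?principal_mull //=.
    suff -> : y - y * e = y * j by apply: Jl.
    by rewrite -{1}[y]mulr1 e1 mulrDr addrC addKr.
  by rewrite IJ0 memv0 subr_eq0 => /eqP.
have e0 : e = 0.
  case/principalP: (eI) => a eE.
  by rewrite (e_id e eI) eE -mulrA (mulrA x) xAx mulr0.
by rewrite (e_id x (mem_principal x)) e0 mulr0.
Qed.

End FdAlgebra.

(** * Homogeneous components *)

Section GradedComponents.
Variables (K : fieldType) (A : fdAlgebra K) (Gamma : groupType).
Variable gA : grading A Gamma.

(** Merges the repetitions that the list of degrees may contain, so that the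
components below are well defined. *)
Lemma gcomp_decomp (a : A) : exists (s : seq Gamma) (x : Gamma -> A),
  [/\ uniq s, forall g, x g \in gA g, forall g, g \notin s -> x g = 0
    & a = \sum_(g <- s) x g].
Proof.
have [s [x [xA ->]]] := gcomp_gen gA a.
exists (undup s), (fun g => x g *+ count_mem g s).
split=> [|g|g gs|]; rewrite ?undup_uniq ?rpredMn //.
  by move: gs; rewrite mem_undup => /count_memPn ->; rewrite mulr0n.
rewrite -[LHS]big_undup_iterop_count /=; apply: eq_bigr => g _.
by rewrite Monoid.iteropE; elim: (count_mem g s) => //= n ->; rewrite mulrS.
Qed.

Lemma gcomp_sum0 (s : seq Gamma) (x : Gamma -> A) :
    (forall g, x g \in gA g) -> (forall g, g \notin s -> x g = 0) ->
  uniq s -> \sum_(g <- s) x g = 0 -> forall g, x g = 0.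
Proof.
move=> xA x0 us sx g; case: (boolP (g \in s)) => [|/x0 //].
exact: gcomp_free us xA sx g.
Qed.

Lemma gcomp_inj (x : A) g h : x \in gA g -> x \in gA h -> x != 0 -> g = h.
Proof.
move=> xg xh x0; apply/eqP; apply: contraNT x0 => gh.
pose y k := if k == g then x else if k == h then - x else 0.
have yA k : y k \in gA k.
  rewrite /y; case: eqP => [->//|_]; case: eqP => [->|_]; rewrite ?rpredN //.
  exact: mem0v.
apply/eqP; have := @gcomp_free _ _ _ gA [:: g; h] y _ yA _ g.
rewrite /y eqxx inE eqxx; apply=> //=; first by rewrite inE gh.
by rewrite !big_cons big_nil /= eqxx eq_sym (negPf gh) eqxx addr0 subrr.
Qed.

Lemma gcomp_comp_eq (s : seq Gamma) (x : Gamma -> A) (z : A) g :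
    uniq s -> (forall h, x h \in gA h) -> (forall h, h \notin s -> x h = 0) ->
  z \in gA g -> \sum_(h <- s) x h = z -> x g = z.
Proof.
move=> us xA x0 zg sz.
pose y k := x k - (if k == g then z else 0).
have: y g = 0.
  apply: (@gcomp_sum0 (undup (g :: s)) y); rewrite ?undup_uniq //.
  - move=> k; rewrite rpredB //; case: eqP => [->//|_]; exact: mem0v.
  - move=> k; rewrite mem_undup inE negb_or => /andP[/negPf kg ks].
    by rewrite /y kg x0 ?subr0.
  rewrite sumrB [X in _ - X](bigD1_seq g) ?undup_uniq ?mem_undup ?inE ?eqxx //=.
  rewrite [X in z + X]big1 ?addr0 => [|k /negPf -> //].
  rewrite -sz; apply/eqP; rewrite subr_eq0; apply/eqP.
  case: (boolP (g \in s)) => gs; rewrite undup_id //.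
  by rewrite big_cons x0 // add0r.
by rewrite /y eqxx => /eqP; rewrite subr_eq0 => /eqP.
Qed.

Lemma gcomp_mul_eq (s : seq Gamma) (x : Gamma -> A) (y z : A) g h :
    uniq s -> (forall k, x k \in gA k) -> (forall k, k \notin s -> x k = 0) ->
    y \in gA g -> z \in gA h -> (\sum_(k <- s) x k) * y = z ->
  x (h * g^-1)%g * y = z.
Proof.
move=> us xA x0 yg zh e.
have := @gcomp_comp_eq [seq (k * g)%g | k <- s] (fun k => x (k * g^-1)%g * y) z h.
apply=> //.
- by rewrite map_inj_uniq //; apply: mulIg.
- by move=> k; rewrite -[k in gA k](mulgVK g); apply: gcompM.
- move=> k ks; rewrite x0 ?mul0r //; apply: contra ks => ks.
  by apply/mapP; exists (k * g^-1)%g; rewrite ?mulgVK.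
rewrite big_map /= -e mulr_suml; apply: eq_bigr => k _; by rewrite mulgK.
Qed.

(** If [y] and [z] are homogeneous, [a * y = z] involves a single component of
[a]. This is how graded ideals are handled without defining them. *)
Lemma homog_coef (a y z : A) g h : y \in gA g -> z \in gA h -> a * y = z ->
  exists2 b, b \in gA (h * g^-1)%g & b * y = z.
Proof.
move=> yg zh; have [s [x [us xA x0 ->]]] := gcomp_decomp a => e.
by exists (x (h * g^-1)%g) => //; apply: gcomp_mul_eq e.
Qed.

(** The component of degree 1 of the unit acts on homogeneous elements as the
unit does, hence is the unit. *)
Lemma gcomp1 : 1 \in gA 1%g.
Proof.
have [s [x [us xA x0 e]]] := gcomp_decomp 1.
suff x1 (a : A) : x 1%g * a = a by rewrite -(x1 1) mulr1.
have [t [y [_ yA _ ->]]] := gcomp_decomp a.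
rewrite mulr_sumr; apply: eq_bigr => g _; rewrite -[1%g](mulgV g).
by apply: (gcomp_mul_eq us xA x0 (yA g) (yA g)); rewrite -e mul1r.
Qed.

Definition homog (x : A) := exists g, x \in gA g.

Lemma homogM x y : homog x -> homog y -> homog (x * y).
Proof. by case=> g xg [h yh]; exists (g * h)%g; apply: gcompM. Qed.

Lemma homog_middle (x y : A) (a : A) : x * a * y != 0 ->
  exists2 b, homog b & x * b * y != 0.
Proof.
have [s [z [_ zA _ ->]]] := gcomp_decomp a => ne.
apply: contrapT => nex; move: ne; rewrite mulr_sumr mulr_suml big1 ?eqxx // => g _.
apply/eqP; apply: contrapT => /negP ne; apply: nex; exists (z g) => //.
by exists g.
Qed.

End GradedComponents.

(** * Graded primitive idempotents *)

Section GradedPrimitive.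
Variables (K : fieldType) (A : fdAlgebra K) (Gamma : groupType).
Variable gA : grading A Gamma.
Hypothesis spA : semiprime A.

(** An idempotent [e] of degree 1 such that [e A e] is a graded division algebra. *)
Record gprim (e : A) : Prop := {
  gprim_deg : e \in gA 1%g;
  gprim_idem : e * e = e;
  gprim_neq0 : e != 0;
  gprim_inv : forall d g, d \in gA g -> d != 0 -> e * d = d -> d * e = d ->
    exists d', [/\ d' \in gA (g^-1)%g, e * d' = d', d' * e = d', d * d' = e & d' * d = e]
}.

(** Minimality of [A e] among the left ideals generated by homogeneous elements
gives left inverses in [e A e], and left inverses of all elements are inverses. *)
Lemma gprim_of_minimal e : e \in gA 1%g -> e * e = e -> e != 0 ->
    (forall d, homog gA d -> d != 0 -> d * e = d -> principal d = principal e) ->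
  gprim e.
Proof.
move=> eA ee e0 emin.
have inv d g : d \in gA g -> d != 0 -> e * d = d -> d * e = d ->
    exists b, [/\ b \in gA (g^-1)%g, e * b = b, b * e = b & b * d = e].
  move=> dg d0 ed de.
  have: e \in principal d by rewrite emin ?mem_principal //; exists g.
  case/principalP=> b eE.
  have [c cg ce] := homog_coef dg eA (esym eE); rewrite mul1g in cg.
  exists (e * c * e); split.
  - by rewrite -[(g^-1)%g]mulg1 -[(g^-1)%g]mul1g; do 2!apply: gcompM => //.
  - by rewrite !mulrA ee.
  - by rewrite -!mulrA ee.
  by rewrite -mulrA ed -mulrA ce ee.
split=> // d g dg d0 ed de.
have [b [bg eb be bd]] := inv _ _ dg d0 ed de.
have b0 : b != 0 by apply: contraNneq e0 => b0; rewrite -bd b0 mul0r.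
have [c [_ ec ce cb]] := inv _ _ bg b0 eb be.
have cd : c = d by rewrite -ce -bd mulrA cb ed.
by rewrite cd in cb; exists b.
Qed.

(** Graded form of Brauer's lemma: for [x] homogeneous with [A x] minimal, [x] is
not nilpotent modulo a factor by semiprimeness, and the equation [e y = y] with
[y] in [A x] is solved by an idempotent [e] of [A x] of degree 1. *)
Lemma exists_gprim f : f \in gA 1%g -> f * f = f -> f != 0 ->
  exists e, [/\ gprim e, f * e = e & e * f = e].
Proof.
move=> fA ff f0.
pose P n := `[< exists x, [/\ homog gA x, x != 0, x * f = x & \dim (principal x) = n] >].
have exP : exists n, P n.
  by exists (\dim (principal f)); apply/asboolP; exists f; split=> //; exists 1%g.
case: (ex_minnP exP) => n /asboolP[x [hx x0 xf dx]] nmin.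
have xmin y : homog gA y -> y != 0 -> y \in principal x -> principal y = principal x.
  move=> hy y0 yx; apply/eqP; rewrite eqEdim principal_sub //= dx nmin //.
  apply/asboolP; exists y; split=> //.
  by case/principalP: yx => a ->; rewrite -mulrA xf.
have [b0 xbx] : exists b, x * b * x != 0.
  apply: contrapT => nex; case/negP: x0; apply/eqP; apply: spA => a.
  by apply/eqP; apply: contrapT => /negP ne; apply: nex; exists a.
have {b0 xbx} [b [k bk] xbx] := homog_middle gA xbx.
case: hx => g xg.
pose y := b * x; pose h := (k * g)%g; have yh : y \in gA h by apply: gcompM.
have xy0 : x * y != 0 by rewrite mulrA.
have yL : y \in principal x by apply/principal_mull/mem_principal.
have : y \in principal (x * y).
  rewrite xmin //; first by exists (g * h)%g; apply: gcompM.
  exact: principal_mull.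
case/principalP=> c yE.
have [c' c'g c'xy] := homog_coef (gcompM xg yh) yh (esym yE).
rewrite invgM mulgA mulgV mul1g in c'g.
pose e := c' * x.
have eA : e \in gA 1%g by rewrite -(mulVg g); apply: gcompM.
have eL : e \in principal x by apply/principal_mull/mem_principal.
have ey : e * y = y by rewrite /e -mulrA.
have ef : e * f = e by rewrite /e -mulrA xf.
have ee : e * e = e.
  apply/eqP; rewrite -subr_eq0; apply/eqP; apply: contrapT => /eqP z0.
  have zL : e * e - e \in principal x by apply: rpredB => //; apply: principal_mull.
  have zA : e * e - e \in gA 1%g by rewrite rpredB // -[1%g]mulg1; apply: gcompM.
  have: x \in principal (e * e - e) by rewrite xmin ?mem_principal //; exists 1%g.
  case/principalP=> a xE; case/negP: xy0.
  by rewrite xE -mulrA mulrBl -mulrA !ey subrr mulr0.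
have e0 : e != 0.
  by apply: contraNneq xy0 => e0; rewrite -ey e0 mul0r mulr0.
pose e' := f * e.
have e'0 : e' != 0.
  by apply: contraNneq e0 => z; rewrite -ee -{1}ef -mulrA -/e' z mulr0.
have e'A : e' \in gA 1%g by rewrite -[1%g]mulg1; apply: gcompM.
exists e'; split; last 2 first.
- by rewrite /e' mulrA ff.
- by rewrite /e' -mulrA ef.
apply: gprim_of_minimal => //.
  by rewrite /e' -mulrA (mulrA e) ef ee.
move=> d hd d0 de; rewrite !xmin //.
- by exists 1%g.
- exact: principal_mull.
by rewrite -de; do 2!apply: principal_mull.
Qed.

Definition orthogonal (a b : A) := (a * b == 0) && (b * a == 0).

(** Split off one idempotent at a time; the dimension of [A f] decreases. *)
Lemma gprim_decomp f : f \in gA 1%g -> f * f = f ->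
  exists es : seq A,
    [/\ forall e, e \in es -> [/\ gprim e, f * e = e & e * f = e],
        pairwise orthogonal es & \sum_(e <- es) e = f].
Proof.
have [n] := ubnP (\dim (principal f)); elim: n f => // n IHn f dn fA ff.
have [f0|f0] := eqVneq f 0; first by exists [::]; rewrite big_nil f0.
have [e [ge fe ef]] := exists_gprim fA ff f0.
have ee := gprim_idem ge; pose f' := f - e.
have f'A : f' \in gA 1%g by apply: rpredB => //; apply: gprim_deg.
have ef' : e * f' = 0 by rewrite mulrBr ef ee subrr.
have f'e : f' * e = 0 by rewrite mulrBl fe ee subrr.
have ff' : f * f' = f' by rewrite mulrBr ff fe.
have f'f : f' * f = f' by rewrite mulrBl ff ef.
have f'f' : f' * f' = f' by rewrite {1}/f' mulrBl ff' ef' subr0.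
have sub : (principal f' <= principal f)%VS.
  by apply: principal_sub; apply/principalP; exists f'.
have [|es [esP orth sume]] := IHn f' _ f'A f'f'.
  rewrite -ltnS; apply: leq_trans dn; rewrite ltnS ltn_neqAle dimvS // andbT.
  apply: contraNneq (gprim_neq0 ge) => dE.
  have: e \in principal f'.
    suff -> : principal f' = principal f by apply/principalP; exists e.
    by apply/eqP; rewrite eqEdim sub dE /=.
  by case/principalP=> a eE; rewrite -ee {1}eE -mulrA f'e mulr0.
exists (e :: es); split.
- move=> d; rewrite inE => /predU1P[->|/esP[gd f'd df']]; first by split.
  by split=> //; [rewrite -f'd mulrA ff' | rewrite -df' -mulrA f'f].
- rewrite /= orth andbT; apply/allP=> d /esP[_ f'd df'].
  by rewrite /orthogonal -{1}f'd -{2}df' mulrA ef' -mulrA f'e mul0r mulr0 eqxx.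
by rewrite big_cons sume addrC subrK.
Qed.

End GradedPrimitive.

(** * Corners of graded primitive idempotents *)

(** Stated on a bare field, so that the results apply to whichever field
structure the algebra is built on. *)
Definition alg_closed (K : fieldType) :=
  forall p : {poly K}, size p != 1%N -> exists x, root p x.

Section DegreeOne.
Variables (K : fieldType) (A : fdAlgebra K) (Gamma : groupType).
Variable gA : grading A Gamma.
Hypothesis closedK : alg_closed K.

(** Evaluation of polynomials in the corner [e A e], whose unit is [e]. *)
Section Eval.
Variables (e d : A).
Hypotheses (ed : e * d = d) (de : d * e = d) (ee : e * e = e).

Fixpoint cpow k := if k is k'.+1 then cpow k' * d else e.

Definition ceval (p : {poly K}) : A := \sum_(i < size p) p`_i *: cpow i.

Lemma cpowe k : cpow k * e = cpow k.
Proof. by case: k => //= k; rewrite -mulrA de. Qed.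

Lemma cevalE n (p : {poly K}) : (size p <= n)%N -> ceval p = \sum_(i < n) p`_i *: cpow i.
Proof.
move=> pn; rewrite /ceval (big_ord_widen _ (fun i => p`_i *: cpow i) pn).
rewrite big_mkcond /=; apply: eq_bigr => i _; case: ltnP => // pi.
by rewrite nth_default // scale0r.
Qed.

Lemma cevalM (q : {poly K}) l : ceval (q * ('X - l%:P)) = ceval q * (d - l *: e).
Proof.
rewrite (@cevalE (size q).+1); last first.
  by rewrite (leq_trans (size_polyMleq _ _)) // size_XsubC addn2.
rewrite [RHS]mulrBr -fda_scalerAr; under eq_bigr do rewrite mulrBr coefB coefMX coefMC scalerBl.
rewrite sumrB; congr (_ - _).
  rewrite big_ord_recl /= scale0r add0r mulr_suml; apply: eq_bigr => i _.
  by rewrite -fda_scalerAl.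
rewrite big_ord_recr /= nth_default // mul0r scale0r addr0 mulr_suml scaler_sumr.
by apply: eq_bigr => i _; rewrite -fda_scalerAl cpowe scalerA mulrC.
Qed.

Lemma exists_annihilator : exists2 p : {poly K}, p != 0 & ceval p = 0.
Proof.
pose n := \dim (@fullv K A); pose X := [tuple cpow i | i < n.+1].
have: ~~ free X.
  by rewrite /free neq_ltn size_tuple ltnS dimvS ?subvf.
move/freeP=> /existsNP[k /not_implyP[sk /existsNP[i ki]]].
exists (\poly_(j < n.+1) k (inord j)).
  apply/eqP=> /polyP/(_ i); rewrite coef_poly ltn_ord coef0 inord_val => k0.
  exact: ki.
rewrite (@cevalE n.+1) ?size_poly // -[RHS]sk; apply: eq_bigr => j _.
by rewrite coef_poly ltn_ord inord_val (nth_map j) ?size_enum_ord // nth_ord_enum.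
Qed.

End Eval.

(** A finite-dimensional division algebra over an algebraically closed field is
the field: an annihilating polynomial of [d] of least degree has a linear
factor [d - l e], which is zero as it would otherwise be invertible. *)
Lemma gprim_deg1 e d : gprim gA e -> d \in gA 1%g -> e * d = d -> d * e = d ->
  exists l, d = l *: e.
Proof.
move=> ge dA ed de; have ee := gprim_idem ge.
apply: contrapT => nex.
suff: forall n (p : {poly K}), (size p <= n)%N -> ceval e d p = 0 -> p = 0.
  by move=> H; have [p /eqP p0 /(H _ _ (leqnn _))] := exists_annihilator e d.
elim=> [|n IHn] p; first by rewrite leqn0 size_poly_eq0 => /eqP.
move=> pn p0; have [s1|s1] := eqVneq (size p) 1%N.
  move: p0; rewrite /ceval s1 big_ord1 /= => /eqP.
  rewrite scaler_eq0 (negPf (gprim_neq0 ge)) orbF => /eqP p00.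
  by rewrite [p]size1_polyC ?s1 // p00 polyC0.
have [l /factor_theorem[q pE]] := closedK s1.
have d10 : d - l *: e != 0.
  by rewrite subr_eq0; apply/eqP => dE; apply: nex; exists l.
have d1A : d - l *: e \in gA 1%g by rewrite rpredB ?rpredZ ?(gprim_deg ge).
have [||b [_ eb _ db _]] := gprim_inv ge d1A d10.
- by rewrite mulrBr ed -fda_scalerAr ee.
- by rewrite mulrBl de -fda_scalerAl ee.
have q0 : ceval e d q = 0.
  have: ceval e d q * e = ceval e d q.
    by rewrite /ceval mulr_suml; apply: eq_bigr => i _; rewrite -fda_scalerAl cpowe.
  by move=> <-; rewrite -{2}db mulrA -cevalM // -pE p0 mul0r.
suff q00 : q = 0 by rewrite pE q00 mul0r.
have [->//|qn0] := eqVneq q 0.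
apply: IHn q0; move: pn; rewrite pE size_Mmonic ?monicXsubC // size_XsubC addn2 /=.
by rewrite ltnS.
Qed.

(** The degrees that occur in the elements of a basis are all there are. *)
Lemma finite_support : exists s : seq Gamma, uniq s /\
  forall g x, x \in gA g -> x != 0 -> g \in s.
Proof.
have /choice[f fP] (i : 'I_(\dim (@fullv K A))) :
    exists sx : seq Gamma * (Gamma -> A),
      [/\ uniq sx.1, forall g, sx.2 g \in gA g, forall g, g \notin sx.1 -> sx.2 g = 0
        & (vbasis fullv)`_i = \sum_(g <- sx.1) sx.2 g].
  have [s [x H]] := gcomp_decomp gA (vbasis (@fullv K A))`_i.
  by exists (s, x).
pose s := undup (flatten [seq (f i).1 | i <- enum 'I_(\dim (@fullv K A))]).
exists s; split=> [|g x xg x0]; first exact: undup_uniq.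
apply: contraNT x0 => gs.
have ifs i h : h \in (f i).1 -> h \in s.
  move=> hi; rewrite mem_undup; apply/flattenP; exists (f i).1 => //.
  by apply/map_f; rewrite mem_enum.
pose y h := \sum_i coord (vbasis fullv) i x *: (f i).2 h.
have y0 h : h \notin s -> y h = 0.
  move=> hs; rewrite /y big1 // => i _; have [_ _ s0 _] := fP i.
  by rewrite s0 ?scaler0 //; apply: contra hs => /ifs.
rewrite -(y0 _ gs); apply/eqP/esym; apply: (@gcomp_comp_eq _ _ _ gA s y x g) => //.
- exact: undup_uniq.
- by move=> h; apply: rpred_sum => i _; rewrite rpredZ //; have [_ -> _ _] := fP i.
rewrite [RHS](coord_vbasis (memvf x)) exchange_big /=; apply: eq_bigr => i _.
rewrite -scaler_sumr; congr (_ *: _); have [us _ s0 ->] := fP i.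
rewrite [LHS](bigID (mem (f i).1)) /= [X in _ + X]big1 ?addr0 => [|h /s0 //].
rewrite -big_filter; apply: perm_big; apply: uniq_perm; rewrite ?filter_uniq ?undup_uniq //.
by move=> h; rewrite mem_filter /=; case: (boolP (h \in (f i).1)) => //= /ifs ->.
Qed.

End DegreeOne.

Section FiniteSubgroup.
Variables (Gamma : groupType) (S : seq Gamma).
Hypothesis S1 : 1%g \in S.
Hypothesis SM : forall g h, g \in S -> h \in S -> (g * h)%g \in S.
Hypothesis SV : forall g, g \in S -> (g^-1)%g \in S.

(** The closure properties are parameters of the type, so that the group
structure can be attached to it. *)
Definition finsub of 1%g \in S & (forall g h, g \in S -> h \in S -> (g * h)%g \in S)
  & (forall g, g \in S -> (g^-1)%g \in S) : predArgType := seq_sub S.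

Local Notation H := (finsub S1 SM SV).

HB.instance Definition _ := Finite.copy H (seq_sub S).

Definition finsub_val (x : H) : Gamma := ssval x.

Definition finsub_mul (x y : H) : H := SeqSub (SM (ssvalP x) (ssvalP y)).
Definition finsub_one : H := SeqSub S1.
Definition finsub_inv (x : H) : H := SeqSub (SV (ssvalP x)).

Lemma finsub_val_inj : injective finsub_val.
Proof. exact: val_inj. Qed.

Lemma finsub_mulA : associative finsub_mul.
Proof. by move=> x y z; apply: finsub_val_inj; rewrite /finsub_val /= mulgA. Qed.

Lemma finsub_mul1 : left_id finsub_one finsub_mul.
Proof. by move=> x; apply: finsub_val_inj; rewrite /finsub_val /= mul1g. Qed.

Lemma finsub_mulV : left_inverse finsub_one finsub_inv finsub_mul.
Proof. by move=> x; apply: finsub_val_inj; rewrite /finsub_val /= mulVg. Qed.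

HB.instance Definition _ := Finite_isGroup.Build H finsub_mulA finsub_mul1 finsub_mulV.

End FiniteSubgroup.

Section Corner.
Variables (K : fieldType) (A : fdAlgebra K) (Gamma : groupType).
Variable gA : grading A Gamma.
Hypothesis closedK : alg_closed K.

(** An identification of [e A e] with a twisted group algebra whose basis [cor_u]
is homogeneous with distinct degrees. *)
Record corner (e : A) := Corner {
  cor_G : finGroupType;
  cor_f : cocycle2 K cor_G;
  cor_deg : cor_G -> Gamma;
  cor_u : cor_G -> A;
  cor_deg_inj : injective cor_deg;
  cor_uA : forall g, cor_u g \in gA (cor_deg g);
  cor_u0 : forall g, cor_u g != 0;
  cor_eu : forall g, e * cor_u g = cor_u g;
  cor_ue : forall g, cor_u g * e = cor_u g;
  cor_uM : forall g h, cor_u g * cor_u h = cor_f g h *: cor_u (g * h)%g;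
  cor_span : forall d, e * d = d -> d * e = d ->
    exists k : cor_G -> K, d = \sum_g k g *: cor_u g
}.

(** Multiplying by an inverse of degree [g^-1] embeds the component of degree [g]
of [e A e] into that of degree 1, which is a line; so each nonzero component is
a line, and the degrees that occur form a finite group. *)
Lemma gprim_corner e : gprim gA e -> inhabited (corner e).
Proof.
move=> ge; have ee := gprim_idem ge; have eA := gprim_deg ge.
have e0 := gprim_neq0 ge.
have [s [us sP]] := finite_support gA.
pose supp g x := [/\ x \in gA g, x != 0, e * x = x & x * e = x].
pose S := [seq g <- s | `[< exists x, supp g x >]].
have SP g : g \in S <-> exists x, supp g x.
  rewrite mem_filter; split=> [/andP[/asboolP//]|H]; apply/andP; split; first exact/asboolP.
  by case: H => x [xg x0 _ _]; apply: sP xg x0.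
have sM g h x y : supp g x -> supp h y -> supp (g * h)%g (x * y).
  case=> xg x0 ex xe [yh y0 ey ye]; split; first exact: gcompM.
  - have [z [_ _ _ xz zx]] := gprim_inv ge xg x0 ex xe.
    by apply: contraNneq y0 => xy; rewrite -ey -zx -mulrA xy mulr0.
  - by rewrite mulrA ex.
  - by rewrite -mulrA ye.
have sV g x : supp g x -> exists2 y, supp (g^-1)%g y & x * y = e /\ y * x = e.
  case=> xg x0 ex xe; have [z [zg ez ze xz zx]] := gprim_inv ge xg x0 ex xe.
  exists z => //; split=> //; apply: contraNneq e0 => z0.
  by rewrite -xz z0 mulr0.
have S1 : 1%g \in S by apply/SP; exists e.
have SM g h : g \in S -> h \in S -> (g * h)%g \in S.
  by move=> /SP[x xg] /SP[y yh]; apply/SP; exists (x * y); apply: sM.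
have SV g : g \in S -> (g^-1)%g \in S.
  by move=> /SP[x /sV[y yg _]]; apply/SP; exists y.
pose G := finsub S1 SM SV.
have exu (g : G) : exists x, supp (@finsub_val _ _ S1 SM SV g) x.
  by apply/SP; apply: ssvalP.
have [u uP] := choice exu.
have lin g x : supp g x -> forall y, y \in gA g -> e * y = y -> y * e = y ->
    exists l, y = l *: x.
  move=> sx y yg ey ye; have [z [zg z0 ez ze] [xz zx]] := sV _ _ sx.
  have [|||l lE] := gprim_deg1 closedK (d := y * z) ge.
  - by rewrite -(mulgV g); apply: gcompM.
  - by rewrite mulrA ey.
  - by rewrite -mulrA ze.
  exists l; have [_ _ ex _] := sx.
  by rewrite -{1}ye -zx mulrA lE -fda_scalerAl ex.
have /choice[f fP] (gh : G * G) : exists l, u gh.1 * u gh.2 = l *: u (gh.1 * gh.2)%g.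
  have [xg x0 ex xe] := sM _ _ _ _ (uP gh.1) (uP gh.2).
  exact: (lin _ _ (uP (gh.1 * gh.2)%g)).
have f0 g h : f (g, h) != 0.
  have [_ x0 _ _] := sM _ _ _ _ (uP g) (uP h).
  by apply: contraNneq x0 => f0; rewrite (fP (g, h)) f0 scale0r.
have fC g h k : f (g, h) * f ((g * h)%g, k) = f (h, k) * f (g, (h * k)%g).
  have [_ w0 _ _] := uP (g * h * k)%g.
  have := mulrA (u g) (u h) (u k).
  rewrite (fP (g, h)) (fP (h, k)) /= -fda_scalerAl -fda_scalerAr.
  rewrite (fP ((g * h)%g, k)) (fP (g, (h * k)%g)) /= !scalerA (mulgA g h k).
  move/eqP; rewrite -subr_eq0 -scalerBl scaler_eq0 (negPf w0) orbF subr_eq0.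
  by move/eqP.
pose cf := @Cocycle2 K G (fun g h => f (g, h)) f0 fC.
exists; apply: (@Corner e G cf (@finsub_val _ _ S1 SM SV) u) => [|g|g|g|g|g h|d ed de].
- exact: finsub_val_inj.
- by have [] := uP g.
- by have [] := uP g.
- by have [] := uP g.
- by have [] := uP g.
- exact: (fP (g, h)).
have [t [y [ut yA y0 dE]]] := gcomp_decomp gA d.
have {dE} dE : d = \sum_(g <- t) e * y g * e.
  by rewrite -mulr_suml -mulr_sumr -dE ed de.
have P0 : exists k : G -> K, 0 = \sum_g k g *: u g.
  by exists (fun=> 0); rewrite big1 // => g _; rewrite scale0r.
rewrite dE; elim: t {ut y0 dE} => [|g t [k IH]]; first by rewrite big_nil.
rewrite big_cons IH.
set w := e * y g * e.
have wA : w \in gA g.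
  by rewrite -[g]mulg1 -[g]mul1g; do 2!apply: gcompM => //.
have ew : e * w = w by rewrite /w !mulrA ee.
have we : w * e = w by rewrite /w -!mulrA ee.
have [->|w0] := eqVneq w 0; first by exists k; rewrite add0r.
have gS : g \in S by apply/SP; exists w.
pose g' : G := SeqSub gS.
have [l lE] := lin _ _ (uP g') w wA ew we.
exists (fun h => (if h == g' then l else 0) + k h).
under [RHS]eq_bigr do rewrite scalerDl.
rewrite big_split /= [X in _ = X + _](bigD1 g') //= eqxx -lE.
rewrite [X in _ = _ + X + _]big1 ?addr0 //.
by move=> h /negPf ->; rewrite scale0r.
Qed.

End Corner.

(** * Bases, coordinates and gradings defined by a basis *)

Definition is_basis (K : fieldType) (V : lmodType K) (S : finType) (b : S -> V) :=
  (forall x, exists k : S -> K, x = \sum_s k s *: b s) /\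
  (forall k : S -> K, \sum_s k s *: b s = 0 -> forall s, k s = 0).

Section Coordinates.
Variables (K : fieldType) (V : lmodType K) (S : finType) (b : S -> V).
Hypothesis hb : is_basis b.

Definition bcoord (x : V) : S -> K := sval (cid (proj1 hb x)).

Lemma bcoordE x : x = \sum_s bcoord x s *: b s.
Proof. exact: svalP (cid (proj1 hb x)). Qed.

Lemma bcoord_uniq k x : x = \sum_s k s *: b s -> bcoord x =1 k.
Proof.
move=> xE s; apply/eqP; rewrite -subr_eq0.
apply/eqP; apply: (proj2 hb (fun s => bcoord x s - k s)).
by under eq_bigr do rewrite scalerBl; rewrite sumrB -bcoordE -xE subrr.
Qed.

Lemma bcoordP k x y s : bcoord (k *: x + y) s = k * bcoord x s + bcoord y s.
Proof.
apply: (@bcoord_uniq (fun s => k * bcoord x s + bcoord y s)).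
under eq_bigr do rewrite scalerDl -scalerA.
by rewrite big_split /= -scaler_sumr -!bcoordE.
Qed.

Lemma bcoord0 s : bcoord 0 s = 0.
Proof.
by apply: (@bcoord_uniq (fun=> 0)); rewrite big1 // => t _; rewrite scale0r.
Qed.

Lemma bcoordZ k x s : bcoord (k *: x) s = k * bcoord x s.
Proof. by rewrite -[k *: x]addr0 bcoordP bcoord0 addr0. Qed.

Lemma bcoordD x y s : bcoord (x + y) s = bcoord x s + bcoord y s.
Proof. by rewrite -{1}[x]scale1r bcoordP mul1r. Qed.

Lemma bcoord_sum I r (P : pred I) (F : I -> V) s :
  bcoord (\sum_(i <- r | P i) F i) s = \sum_(i <- r | P i) bcoord (F i) s.
Proof.
elim/big_rec2: _ => [|i y x _ <-]; first exact: bcoord0.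
exact: bcoordD.
Qed.

Lemma bcoord_basis s t : bcoord (b s) t = (s == t)%:R.
Proof.
apply: (@bcoord_uniq (fun t => (s == t)%:R)).
rewrite (bigD1 s) //= eqxx scale1r big1 ?addr0 // => i; rewrite eq_sym => /negPf ->.
by rewrite scale0r.
Qed.

Lemma basis_neq0 s : b s != 0.
Proof.
apply: contraNneq (oner_neq0 K) => bs.
by have := bcoord_basis s s; rewrite bs bcoord0 eqxx => /eqP; rewrite eq_sym.
Qed.

Lemma bcoord_inj x y : bcoord x =1 bcoord y -> x = y.
Proof. by move=> xy; rewrite (bcoordE x) (bcoordE y); apply: eq_bigr => s _; rewrite xy. Qed.

Lemma bcoord_neq0 x : x != 0 -> exists s, bcoord x s != 0.
Proof.
move=> x0; apply: contrapT => nex; case/negP: x0; apply/eqP/bcoord_inj => s.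
rewrite bcoord0; apply/eqP; apply: contrapT => /negP ne; apply: nex; by exists s.
Qed.

End Coordinates.

Definition in_span (K : fieldType) (V : lmodType K) (S : finType) (b : S -> V) (x : V) :=
  exists k : S -> K, x = \sum_s k s *: b s.

Section Span.
Variables (K : fieldType) (V : lmodType K) (S : finType) (b : S -> V).

Lemma in_span0 : in_span b 0.
Proof. by exists (fun=> 0); rewrite big1 // => s _; rewrite scale0r. Qed.

Lemma in_spanD x y : in_span b x -> in_span b y -> in_span b (x + y).
Proof.
move=> [k ->] [l ->]; exists (fun s => k s + l s).
by under [RHS]eq_bigr do rewrite scalerDl; rewrite big_split.
Qed.

Lemma in_spanZ a x : in_span b x -> in_span b (a *: x).
Proof.
move=> [k ->]; exists (fun s => a * k s).
by rewrite scaler_sumr; apply: eq_bigr => s _; rewrite scalerA.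
Qed.

Lemma in_span_basis s : in_span b (b s).
Proof.
exists (fun t => (t == s)%:R); rewrite (bigD1 s) //= eqxx scale1r.
by rewrite big1 ?addr0 // => i /negPf ->; rewrite scale0r.
Qed.

Lemma in_span_sum I r (P : pred I) (F : I -> V) :
  (forall i, P i -> in_span b (F i)) -> in_span b (\sum_(i <- r | P i) F i).
Proof.
by move=> bF; elim/big_rec: _ => [|i y Pi yb]; [apply: in_span0|apply: in_spanD; auto].
Qed.

End Span.

Section BasisGrading.
Variables (K : fieldType) (A : fdAlgebra K) (S : finType) (b : S -> A).
Hypothesis hb : is_basis b.
Variable Gamma : groupType.

(** The components of a grading are spanned by any homogeneous basis: group the
terms of the expansion of [x] by degree and compare components. *)
Lemma gcomp_basisP (gA : grading A Gamma) (d : S -> Gamma) :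
    (forall s, b s \in gA (d s)) -> forall g x,
  x \in gA g <-> forall s, bcoord hb x s != 0 -> d s = g.
Proof.
move=> bd g x; split=> [xg s xs|xs]; last first.
  rewrite (bcoordE hb x); apply: rpred_sum => s _.
  have [->|/xs <-] := eqVneq (bcoord hb x s) 0; last exact/rpredZ/bd.
  by rewrite scale0r mem0v.
pose t := undup [seq d s | s : S].
pose y h := \sum_(s | d s == h) bcoord hb x s *: b s.
have tP s' : d s' \in t by rewrite mem_undup; apply/map_f; rewrite mem_enum.
have yx : y g = x.
  apply: (@gcomp_comp_eq _ _ _ gA t) => //; first exact: undup_uniq.
  - by move=> h; apply: rpred_sum => u /eqP <-; rewrite rpredZ.
  - move=> h ht; rewrite /y big_pred0 // => u; apply: contraNF ht => /eqP <-; exact: tP.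
  rewrite /y (exchange_big_dep xpredT) //= [RHS](bcoordE hb x); apply: eq_bigr => u _.
  rewrite big_mkcond (bigD1_seq (d u)) ?undup_uniq //= eqxx big1 ?addr0 // => h.
  by rewrite eq_sym => /negPf ->.
apply/eqP; apply: contraNT xs => /negPf sg.
rewrite -yx (@bcoord_uniq _ _ _ _ hb (fun u => if d u == g then bcoord hb x u else 0)) ?sg //.
rewrite /y big_mkcond; apply: eq_bigr => u _; case: ifP => // _; exact/esym/scale0r.
Qed.

Variable d : S -> Gamma.
Hypothesis db : forall s t u, bcoord hb (b s * b t) u != 0 -> d u = (d s * d t)%g.

Definition basis_comp (g : Gamma) : {vspace A} := (\sum_(s | d s == g) <[b s]>)%VS.

Lemma basis_compP g x :
  x \in basis_comp g <-> forall s, bcoord hb x s != 0 -> d s = g.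
Proof.
split=> [/memv_sumP[y yb ->] s|xs]; last first.
  rewrite (bcoordE hb x) (bigID (fun s => d s == g)) /= [X in _ + X]big1 ?addr0.
    by apply: memv_sumr => s _; apply/memvZ/memv_line.
  move=> s; have [->|/xs ->] := eqVneq (bcoord hb x s) 0; first by rewrite scale0r.
  by rewrite eqxx.
rewrite bcoord_sum => sy; apply/eqP; apply: contraNT sy => sg.
apply/eqP; apply: big1 => u ug; have /vlineP[k ->] := yb u ug.
rewrite bcoordZ bcoord_basis; have [us|_] := eqVneq u s; last exact: mulr0.
by rewrite us (negPf sg) in ug.
Qed.

Lemma basis_comp_elt s : b s \in basis_comp (d s).
Proof.
apply/basis_compP => t; rewrite bcoord_basis; have [->//|_] := eqVneq s t.
by rewrite eqxx.
Qed.

Lemma basis_comp_gen a : exists (s : seq Gamma) (x : Gamma -> A),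
  (forall g, x g \in basis_comp g) /\ a = \sum_(g <- s) x g.
Proof.
pose x g := \sum_(s | d s == g) bcoord hb a s *: b s.
exists (undup [seq d s | s : S]), x; split=> [g|].
  by apply: rpred_sum => s /eqP <-; apply/rpredZ/basis_comp_elt.
rewrite [LHS](bcoordE hb a) /x (exchange_big_dep xpredT) //=; apply: eq_bigr => u _.
rewrite big_mkcond (bigD1_seq (d u)) ?undup_uniq ?mem_undup //=; last first.
  by apply/map_f; rewrite mem_enum.
by rewrite eqxx big1 ?addr0 // => h; rewrite eq_sym => /negPf ->.
Qed.

Lemma basis_comp_free (s : seq Gamma) (x : Gamma -> A) :
  uniq s -> (forall g, x g \in basis_comp g) -> \sum_(g <- s) x g = 0 ->
  forall g, g \in s -> x g = 0.
Proof.
move=> us xA sx g gs; apply: (bcoord_inj (hb := hb)) => u; rewrite bcoord0.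
have [ug|/eqP ug] := eqVneq (d u) g; last first.
  by apply/eqP; apply: contraT => /(iffLR (basis_compP g (x g)) (xA g)).
have := bcoord_sum hb s xpredT x u; rewrite sx bcoord0 (bigD1_seq g) //= big1 ?addr0 // => h hg.
apply/eqP; apply: contraNT hg => /(iffLR (basis_compP h (x h)) (xA h)) <-.
by rewrite ug.
Qed.

Lemma basis_compM g h x y :
  x \in basis_comp g -> y \in basis_comp h -> x * y \in basis_comp (g * h)%g.
Proof.
move=> /basis_compP xg /basis_compP yh.
rewrite (bcoordE hb x) (bcoordE hb y) mulr_suml; apply: rpred_sum => s _.
have [->|/xg <-] := eqVneq (bcoord hb x s) 0; first by rewrite scale0r mul0r mem0v.
rewrite mulr_sumr; apply: rpred_sum => t _.
have [->|/yh <-] := eqVneq (bcoord hb y t) 0; first by rewrite scale0r mulr0 mem0v.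
rewrite -fda_scalerAl -fda_scalerAr; apply/rpredZ/rpredZ/basis_compP => u; exact: db.
Qed.

Definition basis_grading : grading A Gamma :=
  Grading basis_comp_gen basis_comp_free basis_compM.

End BasisGrading.

(** * Homogeneous twisted units *)

(** The data of the algebra of matrices over the twisted group algebra of [bG];
the point [bi0] makes the index set nonempty. *)
Record block (K : fieldType) := Block {
  bI : finType;
  bi0 : bI;
  bG : finGroupType;
  bf : cocycle2 K bG
}.

Notation unit_family A T :=
  (forall c, bI (T c) -> bI (T c) -> bG (T c) -> A) (only parsing).

Section TwistedUnits.
Variables (K : fieldType) (C : finType) (T : C -> block K).

Definition tidx := {c : C & (bI (T c) * bI (T c) * bG (T c))%type}.

Definition mkidx c (i j : bI (T c)) (g : bG (T c)) : tidx :=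
  Tagged (fun c => (bI (T c) * bI (T c) * bG (T c))%type) (i, j, g).

(** Row and column indices of all blocks live in one type, in which they can be
compared across blocks. *)
Definition rowidx c (i : bI (T c)) : {c : C & bI (T c)} := Tagged (fun c => bI (T c)) i.

Lemma tidxP (s : tidx) : exists c i j g, s = @mkidx c i j g.
Proof. by case: s => c [[i j] g]; exists c, i, j, g. Qed.

Lemma rowidx_eq c (i j : bI (T c)) : (rowidx i == rowidx j) = (i == j).
Proof. exact: eq_Tagged. Qed.

Lemma rowidx_inj c (i j : bI (T c)) : rowidx i = rowidx j -> i = j.
Proof. by move/eqP; rewrite rowidx_eq => /eqP. Qed.

Lemma mkidx_eq c (i j i' j' : bI (T c)) (g g' : bG (T c)) :
  (mkidx i j g == mkidx i' j' g') = [&& i == i', j == j' & g == g'].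
Proof. by rewrite eq_Tagged /= -!pair_eqE /= -!pair_eqE /= andbA. Qed.

Lemma mkidx_eqP c c' (i j : bI (T c)) (i' j' : bI (T c')) g g' :
  mkidx i j g = mkidx i' j' g' -> rowidx i = rowidx i' /\ rowidx j = rowidx j'.
Proof.
move=> e; have cc : c = c' := congr1 (@tag _ _) e.
by case: _ / cc in i' j' g' e *; have/eqP := e; rewrite mkidx_eq => /and3P[/eqP-> /eqP->].
Qed.

(** The form in which sums over all units are reduced to one position. *)
Lemma big_tidx (R : nmodType) c i j (F : tidx -> R) :
    (forall c' i' j' h, (rowidx i' == rowidx i :> {c : C & bI (T c)})
        && (rowidx j' == rowidx j) = false -> F (@mkidx c' i' j' h) = 0) ->
  \sum_s F s = \sum_h F (@mkidx c i j h).
Proof.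
move=> F0; rewrite [LHS](bigID (fun s => s \in [seq mkidx i j h | h <- enum (bG (T c))])) /=.
rewrite [X in _ + X]big1 ?addr0 => [|s sN].
  rewrite -big_uniq; last by rewrite map_inj_uniq ?enum_uniq // => x y /eqP; rewrite mkidx_eq !eqxx => /eqP.
  by rewrite big_map big_enum.
case: s sN => c' [[i' j'] h'] sN; apply: F0; apply: contraNF sN => /andP[/eqP ii /eqP jj].
have cc : c' = c := congr1 (@tag _ _) ii.
case: _ / (esym cc) in i' j' h' ii jj *.
rewrite (rowidx_inj ii) (rowidx_inj jj).
by apply: (map_f (mkidx i j)); rewrite mem_enum.
Qed.

Variable A : fdAlgebra K.
Variable v : unit_family A T.

Definition tu_elt (s : tidx) : A := v (tagged s).1.1 (tagged s).1.2 (tagged s).2.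

Record twisted_units : Prop := {
  tu_basis : is_basis tu_elt;
  tuM : forall c (i j k : bI (T c)) g h,
    v i j g * v j k h = bf (T c) g h *: v i k (g * h)%g;
  tuM0 : forall c c' (i j : bI (T c)) g (k l : bI (T c')) h,
    rowidx j != rowidx k -> v i j g * v k l h = 0
}.

End TwistedUnits.

Section Homogeneous.
Variables (K : fieldType) (A : fdAlgebra K) (Gamma : groupType).
Variable gA : grading A Gamma.
Hypothesis closedK : alg_closed K.
Hypothesis spA : semiprime A.

Section Peirce.
Variables (n : nat) (e : 'I_n -> A).
Hypothesis ge : forall i, gprim gA (e i).
Hypothesis oe : forall i j, i != j -> e i * e j = 0.
Hypothesis se : \sum_i e i = 1.

(** By semiprimeness [x a x <> 0] for some homogeneous [a]; then [x a] is
invertible in [e_i A e_i], which yields [y] with [x y = e_i], and [y x] is a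
nonzero idempotent of the graded division algebra [e_j A e_j]. *)
Lemma peirce_inv i j x g : x \in gA g -> x != 0 -> e i * x = x -> x * e j = x ->
  exists y, [/\ y \in gA (g^-1)%g, e j * y = y, y * e i = y, x * y = e i & y * x = e j].
Proof.
move=> xg x0 ex xe.
have [a0 xax] : exists a, x * a * x != 0.
  apply: contrapT => nex; case/negP: x0; apply/eqP; apply: spA => a.
  by apply/eqP; apply: contrapT => /negP ne; apply: nex; exists a.
have {a0 xax} [a [k ak] xax] := homog_middle gA xax.
have ei k' := gprim_idem (ge k'); have eA k' := gprim_deg (ge k').
pose a' := e j * a * e i.
have a'k : a' \in gA k by rewrite -[k]mulg1 -[k]mul1g; do 2!apply: gcompM => //.
have ea' : e j * a' = a' by rewrite /a' !mulrA ei.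
have a'e : a' * e i = a' by rewrite /a' -!mulrA ei.
have xa'x : x * a' * x = x * a * x by rewrite /a' -!mulrA ex !mulrA xe.
have xa'0 : x * a' != 0 by apply: contraNneq xax => z; rewrite -xa'x z mul0r.
have [||z [zg ez ze xz zx]] := gprim_inv (ge i) (gcompM xg a'k) xa'0.
- by rewrite mulrA ex.
- by rewrite -mulrA a'e.
pose y := a' * z.
have yg : y \in gA (g^-1)%g.
  have := gcompM a'k zg; by rewrite invgM mulgA mulgV mul1g.
have xy : x * y = e i by rewrite mulrA.
have ey : e j * y = y by rewrite /y mulrA ea'.
have ye : y * e i = y by rewrite /y -mulrA ze.
exists y; split=> //.
have yx0 : y * x != 0.
  by apply: contraNneq x0 => z0; rewrite -ex -xy -mulrA z0 mulr0.
have yxA : y * x \in gA 1%g by rewrite -(mulVg g); apply: gcompM.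
have eyx : e j * (y * x) = y * x by rewrite mulrA ey.
have yxe : y * x * e j = y * x by rewrite -mulrA xe.
have [w [_ _ _ yxw _]] := gprim_inv (ge j) yxA yx0 eyx yxe.
by rewrite -yxe -yxw mulrA -(mulrA y) (mulrA x) xy ex yxw.
Qed.

Let linked i j := `[< exists x, [/\ homog gA x, x != 0, e i * x = x & x * e j = x] >].

Lemma linked_refl i : linked i i.
Proof.
apply/asboolP; exists (e i); rewrite (gprim_idem (ge i)) (gprim_neq0 (ge i)); split=> //.
by exists 1%g; apply: gprim_deg (ge i).
Qed.

Lemma linked_sym i j : linked i j = linked j i.
Proof.
suff H k l : linked k l -> linked l k by apply/idP/idP; apply: H.
move=> /asboolP[x [[g xg] x0 ex xe]]; have [y [yg ey ye xy yx]] := peirce_inv xg x0 ex xe.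
apply/asboolP; exists y; split=> //; first by exists (g^-1)%g.
apply: contraNneq (gprim_neq0 (ge k)) => y0; by rewrite -xy y0 mulr0.
Qed.

Lemma linked_trans i j k : linked i j -> linked j k -> linked i k.
Proof.
move=> /asboolP[x [hx x0 ex xe]] /asboolP[y [[h yh] y0 ey ye]].
have [z [_ _ _ yz _]] := peirce_inv yh y0 ey ye.
apply/asboolP; exists (x * y); split.
- by apply: homogM => //; exists h.
- by apply: contraNneq x0 => xy0; rewrite -xe -yz mulrA xy0 mul0r.
- by rewrite mulrA ex.
- by rewrite -mulrA ye.
Qed.

Let r i := odflt i [pick j | linked i j].

Lemma linked_r i : linked i (r i).
Proof.
rewrite /r; case: pickP => [j //|/(_ i)]; by rewrite linked_refl.
Qed.

Lemma r_eq i j : linked i j -> r i = r j.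
Proof.
move=> ij; rewrite /r (@eq_pick _ (linked i) (linked j)).
  by case: pickP => [//|/(_ j)]; rewrite linked_refl.
move=> k; apply/idP/idP => H; last exact: linked_trans H.
by apply: linked_trans H; rewrite linked_sym.
Qed.

(** Linked idempotents form the blocks. In each block a representative [r] is
chosen, [s i] and [t i] are mutually inverse homogeneous elements of
[e_i A e_r] and [e_r A e_i], and the units are [s i * u g * t j] with [u] the
basis of the twisted group algebra [e_r A e_r]. *)
Lemma units_of_peirce : exists (C : finType) (T : C -> block K)
    (v : unit_family A T),
  [/\ twisted_units v, forall c i j g, homog gA (@v c i j g)
    & exists iota : forall c, bG (T c) -> Gamma, forall c, injective (iota c)].
Proof.
have ei k' := gprim_idem (ge k'); have eA k' := gprim_deg (ge k').
have e0 k' := gprim_neq0 (ge k').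
have corE i : exists x : corner gA (e i), True.
  by have [x] := gprim_corner closedK (ge i); exists x.
pose cor i := sval (cid (corE i)).
have linkE i : exists st : A * A, [/\ homog gA st.1 /\ homog gA st.2,
    e i * st.1 = st.1, st.1 * e (r i) = st.1, e (r i) * st.2 = st.2 /\ st.2 * e i = st.2
    & st.1 * st.2 = e i /\ st.2 * st.1 = e (r i)].
  have /asboolP[x [[g xg] x0 ex xe]] := linked_r i.
  have [y [yg ey ye xy yx]] := peirce_inv xg x0 ex xe.
  by exists (x, y); do ?split=> //; [exists g|exists (g^-1)%g].
have [st stP] := choice linkE.
pose s i := (st i).1; pose t i := (st i).2.
have hs i : homog gA (s i) by have [[]] := stP i.
have ht i : homog gA (t i) by have [[]] := stP i.
have es i : e i * s i = s i by have [_ + _ _] := stP i.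
have sr i : s i * e (r i) = s i by have [_ _ + _] := stP i.
have rt i : e (r i) * t i = t i by have [_ _ _ []] := stP i.
have te i : t i * e i = t i by have [_ _ _ []] := stP i.
have s_t i : s i * t i = e i by have [_ _ _ _ []] := stP i.
have t_s i : t i * s i = e (r i) by have [_ _ _ _ []] := stP i.
pose C : finType := {i : 'I_n | r i == i}.
pose I (c : C) : finType := {i : 'I_n | r i == val c}.
pose i0 (c : C) : I c := exist _ (val c) (valP c).
pose T (c : C) := @Block K (I c) (i0 c) (cor_G (cor (val c))) (cor_f (cor (val c))).
pose v c (i j : bI (T c)) (g : bG (T c)) : A :=
  s (val i) * cor_u (c := cor (val c)) g * t (val j).
have rI c (i : I c) : r (val i) = val c by apply/eqP/(valP i).
have ts0 i j : i != j -> t i * s j = 0.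
  by move=> ij; rewrite -te -es -mulrA (mulrA (e i)) oe // mul0r mulr0.
have vM c (i j k : bI (T c)) g h : v c i j g * v c j k h = bf (T c) g h *: v c i k (g * h)%g.
  rewrite /v !mulrA -(mulrA (_ * _) (t _)) t_s rI.
  rewrite -(mulrA (s _)) cor_ue -(mulrA (s _)) cor_uM.
  by rewrite -fda_scalerAr -fda_scalerAl.
have blk_val c c' (j : bI (T c)) (k : bI (T c')) : rowidx j != rowidx k -> val j != val k.
  apply: contraNneq => jk; have cc : c = c' by apply: val_inj; rewrite -(rI c j) -(rI c' k) jk.
  case: _ / cc in k jk *; by rewrite rowidx_eq; apply/eqP/val_inj.
have vM0 c c' (i j : bI (T c)) g (k l : bI (T c')) h :
    rowidx j != rowidx k -> v c i j g * v c' k l h = 0.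
  move=> jk; rewrite /v !mulrA -(mulrA _ (t _) (s _)) ts0 ?blk_val //.
  by rewrite mulr0 !mul0r.
have vfree (k : tidx T -> K) : \sum_s0 k s0 *: tu_elt v s0 = 0 -> forall s0, k s0 = 0.
  move=> k0 s0; have [c [i [j [g ->]]]] := tidxP s0.
  have {k0} : \sum_h k (mkidx i j h) *: cor_u (c := cor (val c)) h = 0.
    have: t (val i) * (\sum_s0 k s0 *: tu_elt v s0) * s (val j) = 0.
      by rewrite k0 mulr0 mul0r.
    rewrite mulr_sumr mulr_suml (@big_tidx _ _ _ _ c i j) => [|c' i' j' h ij].
      move=> H; rewrite -[RHS]H; apply: eq_bigr => h _.
      rewrite -fda_scalerAr -fda_scalerAl /tu_elt /= /v !mulrA t_s -!mulrA t_s !rI.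
      by rewrite cor_ue cor_eu.
    rewrite -fda_scalerAr -fda_scalerAl /tu_elt /= /v !mulrA.
    have [ii|ii] := eqVneq (rowidx i) (rowidx i').
      have jj : rowidx j' != rowidx j by move: ij; rewrite ii eqxx /= => ->.
      have z : t (val j') * s (val j) = 0 by apply: ts0; apply: blk_val.
      by rewrite -(mulrA _ (t _)) z mulr0 scaler0.
    have z : t (val i) * s (val i') = 0 by apply: ts0; apply: blk_val.
    by rewrite z !mul0r scaler0.
  set kk := fun h => k (mkidx i j h); move=> k0.
  pose d := cor_deg (c := cor (val c)).
  pose y x := \sum_(h | d h == x) kk h *: cor_u (c := cor (val c)) h.
  have yd h : y (d h) = kk h *: cor_u (c := cor (val c)) h.
    by rewrite /y (big_pred1 h) // => h'; rewrite (inj_eq (@cor_deg_inj _ _ _ _ _ _)).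
  have ks : \sum_(x <- [seq d h | h <- enum (bG (T c))]) y x = 0.
    rewrite big_map big_enum /= -[RHS]k0; apply: eq_bigr => h _; exact: yd.
  have y0 : y (d g) = 0.
    apply: gcomp_free ks _ _.
    - by rewrite map_inj_uniq ?enum_uniq //; apply: cor_deg_inj.
    - by move=> x; apply: rpred_sum => h /eqP <-; apply/rpredZ/cor_uA.
    - by apply/map_f; rewrite mem_enum.
  move/eqP: y0; rewrite yd scaler_eq0 (negPf (cor_u0 _)) orbF => /eqP.
  by [].
have vspan a : in_span (tu_elt v) a.
  have -> : a = \sum_i e i * (a * \sum_j e j) by rewrite -mulr_suml se mulr1 mul1r.
  apply: in_span_sum => i _; rewrite !mulr_sumr; apply: in_span_sum => j _.
  have [rij|rij] := eqVneq (r i) (r j); last first.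
    have -> : e i * (a * e j) = 0; last exact: in_span0.
    have [u [x [_ xA _ ->]]] := gcomp_decomp gA a.
    rewrite mulr_suml mulr_sumr big1 // => h _; apply: contrapT => /eqP w0.
    case/eqP: rij; apply: r_eq; apply/asboolP; exists (e i * (x h * e j)); split=> //.
    - exists (1 * (h * 1))%g; do 2!apply: gcompM => //.
    - by rewrite mulrA ei.
    - by rewrite -!mulrA ei.
  have cP : r (r i) == r i.
    by apply/eqP/esym/r_eq/linked_r.
  pose c : C := exist _ (r i) cP.
  pose i' : bI (T c) := exist _ i (eqxx _).
  have jc : r j == val c by rewrite -rij.
  pose j' : bI (T c) := exist _ j jc.
  have [||k kE] := @cor_span _ _ _ _ _ (cor (r i)) (t i * a * s j).
  - by rewrite !mulrA rt.
  - by rewrite -!mulrA rij sr.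
  have -> : e i * (a * e j) = s i * (t i * a * s j) * t j.
    by rewrite !mulrA s_t -[RHS]mulrA s_t.
  rewrite kE mulr_sumr mulr_suml; apply: in_span_sum => g _.
  rewrite -fda_scalerAr -fda_scalerAl; apply: in_spanZ.
  exact: (in_span_basis (tu_elt v) (@mkidx _ _ T c i' j' g)).
exists C, T, v; split.
- by split.
- move=> c i j g; do ?apply: homogM => //.
  by exists (cor_deg g); apply: cor_uA.
- by exists (fun c => cor_deg (c := cor (val c))) => c; apply: cor_deg_inj.
Qed.

End Peirce.

Theorem homogeneous_units : exists (C : finType) (T : C -> block K)
    (v : unit_family A T),
  [/\ twisted_units v, forall c i j g, homog gA (@v c i j g)
    & exists iota : forall c, bG (T c) -> Gamma, forall c, injective (iota c)].
Proof.
have [es [esP orth sume]] := gprim_decomp spA (gcomp1 gA) (mulr1 1).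
apply: (@units_of_peirce (size es) (fun i => es`_i)).
- by move=> i; have [] := esP es`_i; rewrite ?mem_nth.
- move=> i j ij; wlog lt_ij : i j ij / (i < j)%N => [H|].
    have [lt|lt|/val_inj e] := ltngtP i j; first exact: H.
      have /(pairwiseP 0)/(_ j i) := orth; rewrite !inE !ltn_ord => /(_ isT isT lt).
      by case/andP=> _ /eqP.
    by rewrite e eqxx in ij.
  have /(pairwiseP 0)/(_ i j) := orth; rewrite !inE !ltn_ord => /(_ isT isT lt_ij).
  by case/andP=> /eqP.
- by rewrite -sume (big_nth 0) big_mkord.
Qed.

End Homogeneous.

(** * The universal group of a type *)

Section UniversalGroup.
Variables (K : fieldType) (C : finType) (T : C -> block K).
Local Notation S := (tidx T).
Local Open Scope group_scope.

(** The maps that may send units to their degrees in a grading by [H]. *)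
Definition degree_map (H : groupType) (d : S -> H) :=
  forall c (i j k : bI (T c)) g h,
    d (mkidx i j g) * d (mkidx j k h) = d (mkidx i k (g * h)).

Lemma degree_map1 (H : groupType) (d : S -> H) c (i : bI (T c)) :
  degree_map d -> d (mkidx i i 1) = 1.
Proof.
move=> dM; have := dM c i i i 1 1; rewrite mulg1 => /(congr1 (fun x => (d (mkidx i i 1))^-1 * x)).
by rewrite mulKg mulVg.
Qed.

Definition sinv (s : S) : S := mkidx (tagged s).1.2 (tagged s).1.1 (tagged s).2^-1.

Lemma degree_mapV (H : groupType) (d : S -> H) s : degree_map d -> d (sinv s) = (d s)^-1.
Proof.
move=> dM; have [c [i [j [g ->]]]] := tidxP s; rewrite /sinv /=.
apply: (mulgI (d (mkidx i j g))); by rewrite dM !mulgV degree_map1.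
Qed.

Definition word_eval (H : groupType) (d : S -> H) (w : seq S) : H := \prod_(s <- w) d s.

(** Two words in the units are equal in the universal group when all degree maps
identify them. Quantifying over all groups makes the congruence immediate; as
[sinv] inverts generators, words without formal inverses are enough. *)
Definition word_eq (w1 w2 : seq S) : bool :=
  `[< forall (H : groupType) (d : S -> H), degree_map d -> word_eval d w1 = word_eval d w2 >].

Lemma word_eq_refl : reflexive word_eq.
Proof. by move=> w; apply/asboolP. Qed.

Lemma word_eq_sym : symmetric word_eq.
Proof. by move=> w1 w2; apply/asboolP/asboolP => H G d dM; rewrite (H G d dM). Qed.

Lemma word_eq_trans : transitive word_eq.
Proof.
by move=> w2 w1 w3 /asboolP H1 /asboolP H2; apply/asboolP=> G d dM; rewrite (H1 G d dM) H2.
Qed.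

Canonical word_eq_equiv := EquivRel word_eq word_eq_refl word_eq_sym word_eq_trans.

Definition univ := {eq_quot word_eq}.
HB.instance Definition _ := Choice.on univ.
HB.instance Definition _ := EqQuotient.on univ.

Definition uhom (H : groupType) (d : S -> H) (x : univ) : H := word_eval d (repr x).

Lemma uhom_pi (H : groupType) (d : S -> H) w : degree_map d -> uhom d (\pi_univ w) = word_eval d w.
Proof.
move=> dM; have/eqmodP/asboolP := reprK (\pi_univ w); exact.
Qed.

Lemma univ_ext (x y : univ) :
  (forall (H : groupType) (d : S -> H), degree_map d -> uhom d x = uhom d y) -> x = y.
Proof.
move=> xy; rewrite -[x]reprK -[y]reprK; apply/eqmodP/asboolP=> H d dM.
exact: xy.
Qed.

Definition umul (x y : univ) : univ := \pi_univ (repr x ++ repr y).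
Definition uone : univ := \pi_univ [::].
Definition uinv (x : univ) : univ := \pi_univ (rev (map sinv (repr x))).

Lemma uhom_umul (H : groupType) (d : S -> H) x y : degree_map d ->
  uhom d (umul x y) = uhom d x * uhom d y.
Proof. by move=> dM; rewrite uhom_pi // /word_eval big_cat. Qed.

Lemma uhom_uone (H : groupType) (d : S -> H) : degree_map d -> uhom d uone = 1.
Proof. by move=> dM; rewrite uhom_pi // /word_eval big_nil. Qed.

Lemma uhom_uinv (H : groupType) (d : S -> H) x : degree_map d ->
  uhom d (uinv x) = (uhom d x)^-1.
Proof.
move=> dM; rewrite uhom_pi // /uhom /word_eval; elim: (repr x) => [|s w IHw].
  by rewrite !big_nil invg1.
by rewrite big_cons /= rev_cons -cats1 big_cat big_seq1 invgM IHw degree_mapV.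
Qed.

Lemma umulA : associative umul.
Proof. by move=> x y z; apply: univ_ext => H d dM; rewrite !uhom_umul // mulgA. Qed.
Lemma umul1 : left_id uone umul.
Proof. by move=> x; apply: univ_ext => H d dM; rewrite uhom_umul // uhom_uone // mul1g. Qed.
Lemma umulr1 : right_id uone umul.
Proof. by move=> x; apply: univ_ext => H d dM; rewrite uhom_umul // uhom_uone // mulg1. Qed.
Lemma umulV : left_inverse uone uinv umul.
Proof.
by move=> x; apply: univ_ext => H d dM; rewrite uhom_umul // uhom_uone // uhom_uinv // mulVg.
Qed.
Lemma umulrV : right_inverse uone uinv umul.
Proof.
by move=> x; apply: univ_ext => H d dM; rewrite uhom_umul // uhom_uone // uhom_uinv // mulgV.
Qed.

HB.instance Definition _ := isGroup.Build univ umulA umul1 umulr1 umulV umulrV.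

Lemma uhomM (H : groupType) (d : S -> H) : degree_map d -> {morph uhom d : x y / x * y}.
Proof. by move=> dM x y; apply: uhom_umul. Qed.

Definition udeg (s : S) : univ := \pi_univ [:: s].

Lemma uhom_udeg (H : groupType) (d : S -> H) s : degree_map d -> uhom d (udeg s) = d s.
Proof. by move=> dM; rewrite uhom_pi // /word_eval big_seq1. Qed.

Lemma udeg_map : degree_map udeg.
Proof.
move=> c i j k g h; apply: univ_ext => H d dM.
by rewrite uhomM // !uhom_udeg.
Qed.

Lemma univ_gen (x : univ) : x = \prod_(s <- repr x) udeg s.
Proof.
apply: univ_ext => H d dM; rewrite {1}/uhom /word_eval.
elim: (repr x) => [|s w IHw]; first by rewrite !big_nil uhom_uone.
by rewrite !big_cons uhomM // -IHw uhom_udeg.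
Qed.

Definition unit_idx (s : S) := ((tagged s).1.1 == (tagged s).1.2) && ((tagged s).2 == 1).

(** Degree maps of the form [x_i^-1 rho(g) x_j]; they realize enough quotients of
the universal group to tell its generators apart. *)
Section ConjModel.
Variables (H : groupType) (x : forall c, bI (T c) -> H) (rho : forall c, bG (T c) -> H).
Hypothesis rhoM : forall c, {morph @rho c : g h / g * h}.

Definition conj_map (s : S) : H :=
  (x (tagged s).1.1)^-1 * rho (tagged s).2 * x (tagged s).1.2.

Lemma conj_map_degree : degree_map conj_map.
Proof. by move=> c i j k g h; rewrite /conj_map /= rhoM !mulgA mulgK. Qed.

End ConjModel.

(** A morphism on the group of the block [c0], extended trivially to the others. *)
Section Concentrated.
Variables (H : groupType) (c0 : C) (rho0 : bG (T c0) -> H).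
Hypothesis rhoM : {morph rho0 : g h / g * h}.

Definition hom_at c : bG (T c) -> H :=
  match c =P c0 with
  | ReflectT e => fun g => rho0 (ecast c (bG (T c)) e g)
  | ReflectF _ => fun=> 1
  end.

Lemma hom_atE g : @hom_at c0 g = rho0 g.
Proof. by rewrite /hom_at; case: eqP => // e; rewrite eq_axiomK. Qed.

Lemma hom_at0 c g : c != c0 -> @hom_at c g = 1.
Proof. by rewrite /hom_at; case: eqP. Qed.

Lemma hom_atM c : {morph @hom_at c : g h / g * h}.
Proof.
have [cc g h|cc g h] := eqVneq c c0; last by rewrite !hom_at0 // mulg1.
by subst c; rewrite !hom_atE rhoM.
Qed.

End Concentrated.

(** Take [rho] trivial and for [x] a generator of a group of order 3 at one row
and 1 elsewhere: the degree of a unit tells whether the row or the column of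
the unit is the chosen one. *)
Lemma udeg_offdiag c c' (i j : bI (T c)) g (i' j' : bI (T c')) g' : i != j ->
  udeg (mkidx i j g) = udeg (mkidx i' j' g') -> rowidx i = rowidx i' /\ rowidx j = rowidx j'.
Proof.
move=> ij e.
pose z : 'I_3 := inord 1.
have zE : (nat_of_ord z = 1%N) by rewrite inordK.
pose x (b0 : {c : C & bI (T c)}) c (k : bI (T c)) : 'I_3 := if rowidx k == b0 then z else 1.
pose rho c (g : bG (T c)) : 'I_3 := 1.
have rhoM c0 : {morph @rho c0 : g h / g * h} by move=> *; rewrite mulg1.
have z1 : (z == 1) = false by apply/eqP=> /(congr1 (@nat_of_ord 3)); rewrite zE.
have zV1 : (z^-1 == 1) = false by rewrite invg_eq1.
have zVz : (z == z^-1) = false by apply/eqP => /(congr1 (@nat_of_ord 3)); rewrite /= zE.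
have E b0 := congr1 (uhom (conj_map (x b0) rho)) e.
have {}E b0 : (x b0 _ i)^-1 * x b0 _ j = (x b0 _ i')^-1 * x b0 _ j'.
  by have := E b0; rewrite !uhom_udeg; try exact: conj_map_degree; rewrite /conj_map /= !mulg1.
have/eqP jj : rowidx j == rowidx j'.
  have := E (rowidx j); rewrite /x eqxx rowidx_eq (negPf ij) invg1 mul1g ![_ == rowidx j]eq_sym.
  case: (rowidx j == rowidx j') => //; case: (rowidx j == rowidx i') => /eqP.
    by rewrite mulg1 zVz.
  by rewrite invg1 mulg1 z1.
have/eqP ii : rowidx i == rowidx i'.
  have := E (rowidx i); rewrite /x eqxx rowidx_eq (eq_sym j) (negPf ij) mulg1 ![_ == rowidx i]eq_sym.
  case: (rowidx i == rowidx i') => //; case: (rowidx i == rowidx j') => /eqP.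
    by rewrite invg1 mul1g eq_sym zVz.
  by rewrite invg1 mulg1 zV1.
by [].
Qed.

(** Let [G] act on one of two copies of itself and let [x] be the swap of the
copies at row [i'] and 1 elsewhere. The image of the first degree moves the
first copy as [g] does, that of the second degree fixes it. *)
Lemma udeg_diag c c' (i : bI (T c)) g (i' : bI (T c')) g' : rowidx i != rowidx i' ->
  udeg (mkidx i i g) = udeg (mkidx i' i' g') -> g = 1.
Proof.
move=> ii e; pose G := bG (T c); pose X : finType := (G * bool)%type.
(* [G] acts on its copy marked [true] only *)
pose act (g : G) (y : X) : X := if y.2 then (y.1 * g, true) else y.
have act_inj g0 : injective (act g0).
  by move=> [a x] [b y]; rewrite /act; case: x; case: y => //= -[/mulIg ->].
pose rho0 (g : G) : {perm X} := perm (act_inj g).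
have rho0M : {morph rho0 : g h / g * h}.
  move=> g0 h; apply/permP=> -[a b]; rewrite permM !permE /act /=.
  by case: b => //=; rewrite mulgA.
have swap_inj : injective (fun y : X => (y.1, ~~ y.2)).
  by move=> [a b] [a' b'] [-> /negb_inj ->].
pose sw : {perm X} := perm swap_inj.
pose x c (k : bI (T c)) : {perm X} := if rowidx k == rowidx i' then sw else 1.
have := congr1 (uhom (conj_map x (hom_at rho0))) e.
rewrite !uhom_udeg; try by apply: conj_map_degree; apply: hom_atM.
rewrite /conj_map /= /x (negPf ii) eqxx invg1 mul1g mulg1 hom_atE.
move/permP/(_ (1, true)); rewrite permE /act /= mul1g => E.
suff F : (sw^-1 * hom_at rho0 g' * sw) (1, true) = (1, true) by rewrite F in E; case: E.
have [cc|cc] := eqVneq c' c; last by rewrite hom_at0 // mulg1 mulVg perm1.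
have swV : sw^-1 (1, true) = (1, false).
  by apply: (@perm_inj _ sw); rewrite permKV permE.
rewrite !permM swV; case: _ / (esym cc) in g' {E i' ii e x} *.
by rewrite hom_atE [rho0 _ _]permE /act /= permE.
Qed.

(** The universal degrees of the units are distinct, except that all units
proportional to diagonal idempotents have degree 1. *)
Lemma udeg_sep s t : udeg s = udeg t -> s = t \/ unit_idx s && unit_idx t.
Proof.
have [c [i [j [g ->]]]] := tidxP s; have [c' [i' [j' [g' ->]]]] := tidxP t.
move=> e.
have same : rowidx i = rowidx i' -> rowidx j = rowidx j' -> mkidx i j g = mkidx i' j' g'.
  move=> ii jj; have cc : c = c' := congr1 (@tag _ _) ii.
  case: _ / cc in i' j' g' e ii jj *.
  move/rowidx_inj: ii => ii; move/rowidx_inj: jj => jj.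
  rewrite -ii -jj in e *; congr mkidx.
  have := congr1 (uhom (conj_map (fun c _ => 1) (hom_at (fun g : bG (T c) => g)))) e.
  rewrite !uhom_udeg; try by apply: conj_map_degree; apply: hom_atM.
  by rewrite /conj_map /= !hom_atE invg1 !mul1g !mulg1.
have [ij|ij] := eqVneq i j; last by have [ii jj] := udeg_offdiag ij e; left; apply: same.
have [ij'|ij'] := eqVneq i' j'; last first.
  by have [ii jj] := udeg_offdiag ij' (esym e); left; apply: same.
rewrite -ij -ij' in e same *.
have [ii|ii] := eqVneq (rowidx i) (rowidx i'); first by left; apply: same.
right; rewrite /unit_idx /= !eqxx /=.
rewrite (udeg_diag ii e) eqxx /=; apply/eqP.
by apply: (udeg_diag _ (esym e)); rewrite eq_sym.
Qed.

Lemma udeg_unit s : unit_idx s -> udeg s = 1.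
Proof.
have [c [i [j [g ->]]]] := tidxP s; case/andP=> /= /eqP -> /eqP ->.
exact: (degree_map1 _ udeg_map).
Qed.

Lemma udeg_eq1 s : udeg s = 1 -> unit_idx s.
Proof.
have [c [i [j [g ->]]]] := tidxP s; rewrite -(degree_map1 i udeg_map) => /udeg_sep[->|].
  by rewrite /unit_idx /= !eqxx.
by case/andP.
Qed.

End UniversalGroup.

(** * The universal grading of twisted units *)

Section LinearMaps.
Variables (K : fieldType) (U V : lmodType K) (f : U -> V).
Hypothesis lf : linear f.

Lemma lin0 : f 0 = 0.
Proof.
by have := lf (-1) 0 0; rewrite !scaler0 !addr0 => E; rewrite E scaleN1r addNr.
Qed.

Lemma linD x y : f (x + y) = f x + f y.
Proof. by have := lf 1 x y; rewrite !scale1r. Qed.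

Lemma linZ k x : f (k *: x) = k *: f x.
Proof. by have := lf k x 0; rewrite lin0 !addr0. Qed.

Lemma lin_sum I r (P : pred I) (F : I -> U) :
  f (\sum_(i <- r | P i) F i) = \sum_(i <- r | P i) f (F i).
Proof. by elim/big_rec2: _ => [|i y x _ <-]; [apply: lin0|apply: linD]. Qed.

End LinearMaps.

Section AlgIso.
Variables (K : fieldType) (A B : fdAlgebra K).

Lemma alg_hom_inv (f : A -> B) (g : B -> A) :
  alg_hom f -> cancel f g -> cancel g f -> alg_hom g.
Proof.
move=> [lf f1 fM] fK gK; split.
- by move=> k x y; apply: (can_inj fK); rewrite gK lf !gK.
- by apply: (can_inj fK); rewrite gK f1.
- by move=> x y; apply: (can_inj fK); rewrite gK fM !gK.
Qed.

Lemma iso_basis (S : finType) (b : S -> A) (f : A -> B) (g : B -> A) : linear f ->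
  cancel f g -> cancel g f -> is_basis b -> is_basis (f \o b).
Proof.
move=> lf fK gK [sb fb]; split=> [x|k].
  have [k kE] := sb (g x); exists k; rewrite -[LHS]gK kE (lin_sum lf).
  by apply: eq_bigr => s _; rewrite (linZ lf).
have -> : \sum_s k s *: (f \o b) s = f (\sum_s k s *: b s).
  by rewrite (lin_sum lf); apply: eq_bigr => s _; rewrite (linZ lf).
move=> E; apply: fb; apply: (can_inj fK); by rewrite E (lin0 lf).
Qed.

(** The inverse of a bijective graded morphism is graded: decompose [g y] and
compare the components of its image. *)
Lemma graded_inv (Gamma Delta : groupType) (gA : grading A Gamma) (gB : grading B Delta)
    (f : A -> B) (g : B -> A) (phi : Gamma -> Delta) :
    alg_hom f -> cancel f g -> cancel g f -> injective phi ->
    (forall h x, x \in gA h -> f x \in gB (phi h)) ->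
  forall h y, y \in gB (phi h) -> g y \in gA h.
Proof.
move=> [lf _ _] fK gK phi_inj fA h y yh.
have [s [x [us xA x0 gE]]] := gcomp_decomp gA (g y).
have yE : y = \sum_(k <- s) f (x k) by rewrite -(lin_sum lf) -gE gK.
pose z d := \sum_(k <- s | phi k == d) f (x k).
have zh : z (phi h) = y.
  apply: (@gcomp_comp_eq _ _ _ gB (undup (map phi s))) => //; first exact: undup_uniq.
  - by move=> d; apply: rpred_sum => k /eqP <-; apply: fA.
  - move=> d ds; rewrite /z big1_seq // => k /andP[/eqP kd ks].
    by rewrite mem_undup -kd map_f in ds.
  rewrite /z (exchange_big_dep xpredT) //= yE big_seq [RHS]big_seq.
  apply: eq_bigr => k ks; rewrite big_mkcond (bigD1_seq (phi k)) ?undup_uniq //=; last first.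
    by rewrite mem_undup map_f.
  by rewrite eqxx big1 ?addr0 // => d; rewrite eq_sym => /negPf ->.
have -> : g y = \sum_(k <- s | k == h) x k.
  apply: (can_inj fK); rewrite gK -zh (lin_sum lf); apply: eq_bigl => k.
  exact: inj_eq.
by apply: rpred_sum => k /eqP ->.
Qed.

End AlgIso.

Section UnitsTheory.
Variables (K : fieldType) (A : fdAlgebra K) (C : finType) (T : C -> block K).
Variable v : unit_family A T.
Hypothesis hv : twisted_units v.
Local Notation S := (tidx T).
Local Notation b := (tu_elt v).
Local Notation crd := (bcoord (tu_basis hv)).

Lemma tu_neq0 c (i j : bI (T c)) g : v i j g != 0.
Proof. exact: (basis_neq0 (tu_basis hv) (mkidx i j g)). Qed.

Lemma tu_mulP (s t : S) : b s * b t = 0 \/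
  exists c (i j k : bI (T c)) g h, [/\ s = mkidx i j g, t = mkidx j k h
    & b s * b t = bf (T c) g h *: b (mkidx i k (g * h)%g)].
Proof.
have [c [i [j [g ->]]]] := tidxP s; have [c' [j' [k [h ->]]]] := tidxP t.
have [jj|jj] := eqVneq (rowidx j) (rowidx j'); last by left; apply: tuM0.
right; have cc : c = c' := congr1 (@tag _ _) jj.
case: _ / cc in j' k h jj *; move/rowidx_inj: jj => <-.
exists c, i, j, k, g, h; split=> //; exact: tuM.
Qed.

Lemma degree_map_closed (Gamma : groupType) (d : S -> Gamma) : degree_map d ->
  forall s t u, crd (b s * b t) u != 0 -> d u = (d s * d t)%g.
Proof.
move=> dM s t u; have [->|[c [i [j [k [g [h [-> -> ->]]]]]]]] := tu_mulP s t.
  by rewrite bcoord0 eqxx.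
rewrite bcoordZ bcoord_basis dM; by have [<-|_] := eqVneq (mkidx i k (g * h)%g) u; rewrite ?mulr0 ?eqxx.
Qed.

Definition units_grading : grading A (univ T) :=
  basis_grading (degree_map_closed (@udeg_map K C T)).

Lemma units_compP g x : x \in units_grading g <-> forall s, crd x s != 0 -> udeg s = g.
Proof. exact: basis_compP. Qed.

Lemma units_comp_elt s : b s \in units_grading (udeg s).
Proof. exact: (basis_comp_elt (tu_basis hv) (@udeg K C T) s). Qed.

Lemma units_connected : is_connected units_grading.
Proof.
move=> H Hc Hs x; rewrite (univ_gen x); elim: (repr x) => [|s w IHw].
  by rewrite big_nil; case: Hc.
rewrite big_cons; apply: (group_closedM Hc) => //; apply: Hs => E.
have := units_comp_elt s; rewrite E memv0; apply/negP.
exact: basis_neq0 (tu_basis hv) s.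
Qed.

Definition units_cg : conn_grading A := ConnGrading units_connected.

Lemma homog_degree_map (Gamma : groupType) (gA : grading A Gamma) (d : S -> Gamma) :
  (forall s, b s \in gA (d s)) -> degree_map d.
Proof.
move=> dA c i j k g h.
have E : b (mkidx i j g) * b (mkidx j k h) = bf (T c) g h *: b (mkidx i k (g * h)%g).
  exact: tuM.
apply: (gcomp_inj (gA := gA) (x := bf (T c) g h *: b (mkidx i k (g * h)%g))).
- by rewrite -E; apply: gcompM.
- exact: rpredZ.
by rewrite scaler_eq0 negb_or cocycle_neq0 basis_neq0 //; apply: tu_basis.
Qed.

(** The degrees in [Y] form a degree map, so they extend to the universal group;
the extension is onto because its image contains the support of [Y]. *)
Lemma universal_quotient (Y : conn_grading A) :
    (forall s, homog (cg_grading Y) (b s)) ->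
  exists phi, quotient_morphism units_grading (cg_grading Y) id phi.
Proof.
move=> /choice[d dA]; have dM := homog_degree_map dA.
have phiM := uhomM dM.
have phi1 : uhom d 1%g = 1%g by apply: uhom_uone.
have phiV x : uhom d (x^-1)%g = ((uhom d x)^-1)%g by apply: uhom_uinv.
exists (uhom d); split.
- split=> // g x /units_compP xg; apply/(gcomp_basisP (tu_basis hv) dA) => s.
  by move=> /xg <-; rewrite uhom_udeg.
- by exists id.
- move=> g0; pose H : {pred cg_group Y} := fun g => `[< exists x, uhom d x = g >].
  apply/asboolP; apply: (@cg_connected _ _ Y H).
    split; first by apply/asboolP; exists 1%g.
    move=> x y /asboolP[x' <-] /asboolP[y' <-]; apply/asboolP.
    by exists (x' * y'^-1)%g; rewrite phiM phiV.
  move=> g gs; apply/asboolP; apply: contrapT => nex; apply: gs.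
  apply/eqP; rewrite -subv0; apply/subvP => x xg; rewrite memv0.
  apply/eqP/(bcoord_inj (hb := tu_basis hv)) => s; rewrite bcoord0.
  apply/eqP; apply: contraT => xs; case: nex; exists (udeg s).
  by rewrite uhom_udeg //; apply: (iffLR (gcomp_basisP (tu_basis hv) dA g x)).
Qed.

End UnitsTheory.

(** * Diagonal idempotents and the component of degree 1 *)

Section Cocycle1.
Variables (K : fieldType) (G : finGroupType) (f : cocycle2 K G).

Lemma cocycle1g g : f 1%g g = f 1%g 1%g.
Proof.
have := cocycleP f 1 1 g; rewrite !mul1g => /(mulIf (cocycle_neq0 f _ _)).
by [].
Qed.

Lemma cocycleg1 g : f g 1%g = f 1%g 1%g.
Proof. by have := cocycleP f g 1 1; rewrite !mulg1 => /(mulIf (cocycle_neq0 f _ _)). Qed.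

End Cocycle1.

Section UnitIdempotents.
Variables (K : fieldType) (A : fdAlgebra K) (C : finType) (T : C -> block K).
Variable v : unit_family A T.
Hypothesis hv : twisted_units v.
Local Notation S := (tidx T).
Local Notation b := (tu_elt v).
Local Notation crd := (bcoord (tu_basis hv)).
Local Notation X := (units_grading hv).
Local Notation E := {c : C & bI (T c)}.

(** The cocycles are not normalized, whence the scalar. *)
Definition diag_idem (x : E) : A :=
  (bf (T (tag x)) 1%g 1%g)^-1 *: v (tagged x) (tagged x) 1%g.

Definition diag_idx (x : E) : S := mkidx (tagged x) (tagged x) 1%g.

Lemma diag_idx_inj : injective diag_idx.
Proof. by case=> [c i] [c' i'] /mkidx_eqP[]. Qed.

Lemma unit_diag_idx s : unit_idx s -> exists x, s = diag_idx x.
Proof.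
have [c [i [j [g ->]]]] := tidxP s; case/andP=> /= /eqP-> /eqP->.
by exists (rowidx j).
Qed.

Lemma diag_idem_l x c (i j : bI (T c)) g :
  diag_idem x * v i j g = if x == rowidx i then v i j g else 0.
Proof.
rewrite /diag_idem -fda_scalerAl; case: x => c' k /=.
have [e|ki] := eqVneq (@rowidx _ _ T _ k) (rowidx i); last by rewrite (tuM0 hv) // scaler0.
have cc : c' = c := congr1 (@tag _ _) e; case: _ / cc in i j g e *.
move/rowidx_inj: e => ->; rewrite (tuM hv) mul1g cocycle1g scalerA.
by rewrite mulVf ?cocycle_neq0 // scale1r.
Qed.

Lemma diag_idem_r x c (i j : bI (T c)) g :
  v i j g * diag_idem x = if rowidx j == x then v i j g else 0.
Proof.
rewrite /diag_idem -fda_scalerAr; case: x => c' k /=.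
have [e|ki] := eqVneq (rowidx j) (@rowidx _ _ T _ k); last by rewrite (tuM0 hv) // scaler0.
have cc : c' = c := esym (congr1 (@tag _ _) e); case: _ / cc in i j g e *.
move/rowidx_inj: e => ->; rewrite (tuM hv) mulg1 cocycleg1 scalerA.
by rewrite mulVf ?cocycle_neq0 // scale1r.
Qed.

Lemma diag_idemM x y : diag_idem x * diag_idem y = if x == y then diag_idem y else 0.
Proof.
rewrite {2}/diag_idem -fda_scalerAr diag_idem_l; case: y => c i /=.
by case: eqP => // _; rewrite scaler0.
Qed.

Lemma diag_idem_neq0 x : diag_idem x != 0.
Proof. by rewrite scaler_eq0 negb_or invr_eq0 cocycle_neq0 tu_neq0. Qed.

Lemma diag_idemE x : diag_idem x = (bf (T (tag x)) 1%g 1%g)^-1 *: b (diag_idx x).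
Proof. by []. Qed.

Lemma diag_idem_sum1 : \sum_x diag_idem x = 1.
Proof.
rewrite -[LHS]mulr1 [X in _ * X](bcoordE (tu_basis hv)) mulr_sumr.
rewrite [RHS](bcoordE (tu_basis hv)); apply: eq_bigr => s _.
rewrite -fda_scalerAr mulr_suml; congr (_ *: _); have [c [i [j [g ->]]]] := tidxP s.
rewrite (bigD1 (rowidx i)) //= diag_idem_l eqxx big1 ?addr0 // => x /negPf xi.
by rewrite diag_idem_l xi.
Qed.

Lemma diag_idem_comp1 x : diag_idem x \in X 1%g.
Proof.
rewrite diag_idemE; apply: rpredZ; rewrite -[1%g](udeg_unit (s := diag_idx x)) ?units_comp_elt //.
by rewrite /unit_idx !eqxx.
Qed.

Definition diag_coef (x : E) (a : A) : K := crd a (diag_idx x) * bf (T (tag x)) 1%g 1%g.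

(** Only diagonal units have degree 1, so the component of degree 1 is a product
of copies of the field, with coordinates [diag_coef]. *)
Lemma comp1E a : a \in X 1%g -> a = \sum_x diag_coef x a *: diag_idem x.
Proof.
move=> a1; rewrite {1}(bcoordE (tu_basis hv) a).
rewrite (bigID (fun s => s \in [seq diag_idx x | x : E])) /= [X in _ + X]big1 ?addr0.
  rewrite -big_uniq; last by rewrite map_inj_uniq ?enum_uniq //; apply: diag_idx_inj.
  rewrite big_map big_enum /=; apply: eq_bigr => x _.
  by rewrite /diag_coef diag_idemE scalerA -mulrA mulfV ?cocycle_neq0 // mulr1.
move=> s sN; have [->|cs] := eqVneq (crd a s) 0; first by rewrite scale0r.
have /(_ s cs)/udeg_eq1/unit_diag_idx[x sx] := iffLR (units_compP hv 1%g a) a1.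
by rewrite sx map_f ?mem_enum in sN.
Qed.

Lemma comp1_diag_idem a x : a \in X 1%g -> a * diag_idem x = diag_coef x a *: diag_idem x.
Proof.
move=> /comp1E; set u := diag_coef => {1}->; rewrite mulr_suml (bigD1 x) //= -fda_scalerAl diag_idemM eqxx.
by rewrite big1 ?addr0 // => y /negPf yx; rewrite -fda_scalerAl diag_idemM yx scaler0.
Qed.

Lemma diag_idem_mul_comp1 a x : a \in X 1%g -> diag_idem x * a = diag_coef x a *: diag_idem x.
Proof.
move=> /comp1E; set u := diag_coef => {1}->; rewrite mulr_sumr (bigD1 x) //= -fda_scalerAr diag_idemM eqxx.
by rewrite big1 ?addr0 // => y /negPf yx; rewrite -fda_scalerAr diag_idemM eq_sym yx scaler0.
Qed.

Lemma diag_coef_neq0 a : a \in X 1%g -> a != 0 -> exists x, diag_coef x a != 0.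
Proof.
move=> a1 a0; apply: contrapT => nex; case/negP: a0; rewrite (comp1E a1) big1 // => x _.
have [->|ax] := eqVneq (diag_coef x a) 0; first by rewrite scale0r.
by case: nex; exists x.
Qed.

Lemma comp1_reduced a : a \in X 1%g -> a * a = 0 -> a = 0.
Proof.
move=> a1 aa; apply/eqP; apply: contraT => /(diag_coef_neq0 a1)[x ax].
have : a * a * diag_idem x = 0 by rewrite aa mul0r.
rewrite -mulrA (comp1_diag_idem _ a1) -fda_scalerAr (comp1_diag_idem _ a1) scalerA => /eqP.
by rewrite scaler_eq0 mulf_eq0 (negPf ax) (negPf (diag_idem_neq0 x)).
Qed.

(** By [udeg_sep] a single unit has degree [g]. *)
Lemma comp_line g a : g != 1%g -> a \in X g -> a != 0 ->
  exists s k, [/\ k != 0, a = k *: b s & udeg s = g].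
Proof.
move=> g1 ag /(bcoord_neq0 (tu_basis hv))[s as0].
have aP := iffLR (units_compP hv g a) ag.
exists s, (crd a s); split=> //; last exact: aP.
rewrite {1}(bcoordE (tu_basis hv) a) (bigD1 s) //= big1 ?addr0 // => t ts.
have [->|at0] := eqVneq (crd a t) 0; first by rewrite scale0r.
case/eqP: ts; have [//|/andP[/udeg_unit t1 _]] := udeg_sep (etrans (aP t at0) (esym (aP s as0))).
by rewrite -(aP t at0) t1 eqxx in g1.
Qed.

Lemma scaled_elt_eq s t k l : k != 0 -> k *: b s = l *: b t -> s = t.
Proof.
move=> k0 /(congr1 (fun a => crd a s)); rewrite !bcoordZ !bcoord_basis eqxx mulr1.
by have [->//|_] := eqVneq t s; rewrite mulr0 => /eqP; rewrite (negPf k0).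
Qed.

End UnitIdempotents.

Definition trivial_block (K : fieldType) (B : block K) := #|bI B| = 1%N /\ #|bG B| = 1%N.

(** * Quotients between universal gradings *)

Section Maximality.
Variables (K : fieldType) (A B : fdAlgebra K).
Variables (C : finType) (T : C -> block K).
Variable v : unit_family A T.
Hypothesis hv : twisted_units v.
Variables (C' : finType) (T' : C' -> block K).
Variable v' : unit_family B T'.
Hypothesis hv' : twisted_units v'.
Hypothesis trivial_uniq : forall c d, trivial_block (T' c) -> trivial_block (T' d) -> c = d.
Variables (f : A -> B) (f' : B -> A) (phi : univ T -> univ T').
Hypothesis fhom : alg_hom f.
Hypotheses (fK : cancel f f') (f'K : cancel f' f).
Hypothesis phiM : {morph phi : x y / (x * y)%g}.
Hypothesis fX : forall g x, x \in units_grading hv g -> f x \in units_grading hv' (phi g).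
Local Notation b := (tu_elt v).
Local Notation b' := (tu_elt v').
Local Notation X := (units_grading hv).
Local Notation X' := (units_grading hv').

Let flin : linear f. Proof. by case: fhom. Qed.
Let fM : {morph f : x y / x * y}. Proof. by case: fhom. Qed.
Let f0 : f 0 = 0. Proof. exact: lin0. Qed.
Let fZ k x : f (k *: x) = k *: f x. Proof. exact: linZ. Qed.

Let f_neq0 x : x != 0 -> f x != 0.
Proof. by apply: contra_neq => fx; apply: (can_inj fK); rewrite fx f0. Qed.

Let fb_neq0 s : f (b s) != 0.
Proof. exact/f_neq0/(basis_neq0 (tu_basis hv)). Qed.

Let fbX s : f (b s) \in X' (phi (udeg s)).
Proof. exact/fX/units_comp_elt. Qed.

Let offdiag_neq1 c (i j : bI (T c)) g : i != j -> phi (udeg (mkidx i j g)) <> 1%g.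
Proof.
move=> ij p1; have := fbX (mkidx i j g); rewrite p1 => /comp1_reduced.
rewrite -fM; have -> : b (mkidx i j g) * b (mkidx i j g) = 0.
  by apply: (tuM0 hv); rewrite rowidx_eq eq_sym.
rewrite f0 => /(_ erefl)/eqP; by rewrite (negPf (fb_neq0 _)).
Qed.

Let line s t : phi (udeg s) <> 1%g -> phi (udeg s) = phi (udeg t) -> s = t.
Proof.
move=> /eqP p1 st.
have [u [k [k0 sE us]]] := comp_line p1 (fbX s) (fb_neq0 s).
rewrite st in p1 us; have [w [l [l0 tE wt]]] := comp_line p1 (fbX t) (fb_neq0 t).
have uw : u = w.
  have [//|/andP[/udeg_unit u1 _]] := udeg_sep (etrans us (esym wt)).
  by rewrite -us u1 eqxx in p1.
apply: (scaled_elt_eq hv l0 (l := k)); apply: (can_inj fK).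
by rewrite !fZ sE tE uw !scalerA mulrC.
Qed.

(** Let [phi] kill the degree of [s]. Off-diagonal units are nilpotent, while the
component of degree 1 of [B] is reduced, so [s] is diagonal, say [v i i g] with
[g <> 1]. Multiplying by [v i i g] does not change images of degrees, so no
unit of the block of [s] has an image spanning a line, and the whole block
lands in degree 1. Hence its index set is a point, and it maps onto an ideal of
[B] in degree 1. Such an ideal lives on trivial blocks of [B], of which there
is at most one; but the block has dimension at least 2. *)
Lemma support_kernel s : phi (udeg s) = 1%g -> unit_idx s.
Proof.
have [c [i [j [g ->]]]] := tidxP s => p1.
have [ij|ij] := eqVneq i j; last by case: (offdiag_neq1 ij p1).
rewrite /unit_idx /= ij eqxx /=; apply: contrapT => /negP g1; rewrite -{j}ij in p1.
have p1' k l h : phi (udeg (mkidx (c := c) k l h)) = 1%g.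
  have st : phi (udeg (mkidx k l h)) = phi (udeg (mkidx k l (h * g)%g)).
    have D := @udeg_map K C T.
    rewrite -[h in LHS]mulg1 -(D c k i l h 1%g) -[(h * g)%g]mulg1.
    rewrite -(D c k i l (h * g)%g 1%g) -(D c k i i h g) !phiM p1.
    by rewrite mulg1.
  apply: contrapT => /line/(_ st)/eqP; rewrite mkidx_eq !eqxx /=.
  by rewrite -[X in X == _]mulg1 (inj_eq (mulgI h)) eq_sym (negPf g1).
have allI k : k = i.
  by have [//|ki] := eqVneq k i; case: (offdiag_neq1 ki (p1' k i 1%g)).
(* the span of the [v i i h] is a left ideal, and its image stays in degree 1 *)
have leftX h y : y * f (v i i h) \in X' 1%g.
  rewrite -[y]f'K -fM; set a := f' y.
  have : in_span b a by have [H _] := tu_basis hv; apply: H.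
  case=> k ->; rewrite mulr_suml (lin_sum flin); apply: rpred_sum => s' _.
  rewrite -fda_scalerAl fZ; apply: rpredZ.
  have [->|[c' [i' [j' [k' [g' [h' [_ e ->]]]]]]]] := tu_mulP hv s' (mkidx i i h).
    by rewrite f0 mem0v.
  have [e1 _] := mkidx_eqP e; have cc : c = c' := congr1 (@tag _ _) e1.
  case: _ / cc in i' j' k' g' h' e e1 *.
  rewrite fZ; apply: rpredZ; rewrite -(p1' i' k' (g' * h')%g); exact: fbX.
have fX1 h : f (v i i h) \in X' 1%g by have := leftX h 1; rewrite mul1r.
(* the ideal meets only trivial blocks: multiply by the units of column [p] *)
have triv h x : diag_coef hv' x (f (v i i h)) != 0 -> trivial_block (T' (tag x)).
  case: x => d p /= px.
  have pu q h' : unit_idx (mkidx (c := d) q p h').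
    apply: udeg_eq1; have := leftX h (v' q p h').
    have := diag_idem_r hv' (rowidx p) q p h'; rewrite eqxx => <-.
    rewrite -mulrA (diag_idem_mul_comp1 _ (fX1 h)) -fda_scalerAr (diag_idem_r hv') eqxx.
    move=> /(units_compP hv' 1%g)/(_ (mkidx q p h')); apply.
    rewrite bcoordZ (bcoord_basis (tu_basis hv') (mkidx q p h')) eqxx mulr1.
    exact: px.
  split; apply/eqP/fintype1P.
    by exists p => q; have /andP[/= /eqP] := pu q 1%g.
  by exists 1%g => h'; have /andP[/= _ /eqP] := pu p h'.
have f0' h : f (v i i h) != 0 by apply/f_neq0/tu_neq0.
have [x x0] := diag_coef_neq0 (fX1 1%g) (f0' 1%g).
have other h y : y != x -> diag_coef hv' y (f (v i i h)) = 0.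
  move=> yx; apply/eqP; apply: contraNT yx => y0; apply/eqP.
  case: x y x0 y0 => d p [d' p'] x0 y0.
  have T1 := triv _ _ x0; have T2 := triv _ _ y0.
  have dd : d = d' by apply: trivial_uniq.
  case: _ / dd in p' y0 T2 *; congr Tagged.
  by have [/eqP/fintype1P[q qP] _] := T1; rewrite (qP p) (qP p').
pose a h := diag_coef hv' x (f (v i i h)).
have fE h : f (b (mkidx i i h)) = a h *: diag_idem v' x.
  rewrite [LHS](comp1E (fX1 h)) (bigD1 x) //= big1 ?addr0 // => y yx.
  by rewrite other // scale0r.
have : mkidx i i 1%g = mkidx i i g.
  apply: (scaled_elt_eq hv (k := a g) (l := a 1%g)).
    by apply: contraNneq (f0' g) => ag; rewrite [f _]fE ag scale0r.
  by apply: (can_inj fK); rewrite !fZ !fE !scalerA (mulrC (a g)).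
by move/eqP; rewrite mkidx_eq !eqxx /= eq_sym (negPf g1).
Qed.

Lemma phi_inj_support s t : phi (udeg s) = phi (udeg t) -> udeg s = udeg t.
Proof.
have [p1|/eqP p1] := eqVneq (phi (udeg s)) 1%g; last by move/(line p1) ->.
rewrite p1 => /esym/support_kernel/udeg_unit ->.
exact: udeg_unit (support_kernel p1).
Qed.

(** As [phi] is injective on the support, each unit of [B] comes from a component
of [A]. The degrees of these components form a degree map on the units of [B],
and the morphism it induces inverts [phi]. *)
Lemma phi_injective : injective phi.
Proof.
have hfb : is_basis (f \o b) := iso_basis flin fK f'K (tu_basis hv).
have exs s' : exists s, phi (udeg s) = udeg s' /\ f' (b' s') \in X (udeg s).
  have [s s0] := bcoord_neq0 (hfb) (basis_neq0 (tu_basis hv') s').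
  have sP := iffLR (gcomp_basisP hfb (gA := X') fbX _ _) (units_comp_elt hv' s').
  exists s; split; first exact: sP.
  rewrite (bcoordE hfb (b' s')) (lin_sum (f := f')); last by case: (alg_hom_inv fhom fK f'K).
  apply: rpred_sum => t _.
  rewrite (linZ (f := f')); last by case: (alg_hom_inv fhom fK f'K).
  have [->|t0] := eqVneq (bcoord hfb (b' s') t) 0; first by rewrite scale0r mem0v.
  apply: rpredZ; rewrite /= fK.
  rewrite (@phi_inj_support s t); first exact: units_comp_elt.
  by rewrite (sP _ s0) (sP _ t0).
have [r rP] := choice exs.
(* the degree from which the unit [s'] of [B] comes *)
pose theta s' := udeg (r s').
have thM : degree_map theta.
  have hb'' := alg_hom_inv fhom fK f'K.
  move=> c i j k g h; have [lf' _ mf'] := hb''.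
  have E : f' (b' (mkidx i j g)) * f' (b' (mkidx j k h)) =
     bf (T' c) g h *: f' (b' (mkidx i k (g * h)%g)).
    by rewrite -mf' -(linZ lf'); congr (f' _); apply: (tuM hv').
  apply: (gcomp_inj (gA := X) (x := bf (T' c) g h *: f' (b' (mkidx i k (g * h)%g)))).
  - have [_ h1] := rP (mkidx i j g); have [_ h2] := rP (mkidx j k h).
    by rewrite -E; apply: gcompM.
  - by apply: rpredZ; have [] := rP (mkidx i k (g * h)%g).
  rewrite scaler_eq0 negb_or cocycle_neq0 /=.
  apply: contraNneq (basis_neq0 (tu_basis hv') (mkidx i k (g * h)%g)) => e.
  by rewrite -[b' _]f'K e f0.
have thphi s : uhom theta (phi (udeg s)) = udeg s.
  have [s' s'0] := bcoord_neq0 (tu_basis hv') (fb_neq0 s).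
  have s's := iffLR (units_compP hv' _ _) (fbX s) s' s'0.
  rewrite -s's uhom_udeg //; apply: phi_inj_support.
  by have [-> _] := rP s'.
apply: (can_inj (g := uhom theta)) => x; rewrite [in LHS](univ_gen x) [RHS]univ_gen.
elim: (repr x) => [|s w IHw].
  rewrite !big_nil; have phi1 : phi 1%g = 1%g.
    by apply: (mulgI (phi 1%g)); rewrite -phiM !mulg1.
  by rewrite phi1 uhom_uone.
by rewrite !big_cons phiM uhomM // IHw thphi.
Qed.

End Maximality.

(** * The type of a universal grading *)

(** The two blocks define isomorphic graded algebras: [l] rescales the basis and
[pi] relabels it, so the cocycles correspond up to a coboundary. *)
Definition block_iso (K : fieldType) (B B' : block K) :=
  #|bI B| = #|bI B'| /\
  exists (pi : bG B -> bG B') (l : bG B -> K),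
    [/\ bijective pi, {morph pi : g h / (g * h)%g}, forall g, l g != 0
      & forall g h, bf B g h * l (g * h)%g = l g * l h * bf B' (pi g) (pi h)].

Section GradedIso.
Variables (K : fieldType) (A B : fdAlgebra K).
Variables (C : finType) (T : C -> block K).
Variable v : unit_family A T.
Hypothesis hv : twisted_units v.
Variables (C' : finType) (T' : C' -> block K).
Variable v' : unit_family B T'.
Hypothesis hv' : twisted_units v'.
Variables (f : A -> B) (f' : B -> A).
Variables (phi : univ T -> univ T') (phi' : univ T' -> univ T).
Hypotheses (fhom : alg_hom f) (f'hom : alg_hom f').
Hypotheses (fK : cancel f f') (f'K : cancel f' f).
Hypotheses (phi1 : phi 1%g = 1%g) (phi'1 : phi' 1%g = 1%g).
Hypotheses (phiK : cancel phi phi').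
Hypothesis fX : forall g x, x \in units_grading hv g -> f x \in units_grading hv' (phi g).
Hypothesis f'X : forall g x, x \in units_grading hv' g -> f' x \in units_grading hv (phi' g).
Local Notation X := (units_grading hv).
Local Notation X' := (units_grading hv').

Let flin : linear f. Proof. by case: fhom. Qed.
Let fM : {morph f : x y / x * y}. Proof. by case: fhom. Qed.
Let f'M : {morph f' : x y / x * y}. Proof. by case: f'hom. Qed.

Lemma iso_neq0 x : x != 0 -> f x != 0.
Proof. by apply: contra_neq => fx; apply: (can_inj fK); rewrite fx (lin0 flin). Qed.

(** The diagonal idempotents are the minimal idempotents of the component of
degree 1, which the isomorphism preserves in both directions. *)
Lemma match_idem x : exists x', f (diag_idem v x) = diag_idem v' x'.
Proof.
have fe1 : f (diag_idem v x) \in X' 1%g by rewrite -phi1; apply/fX/diag_idem_comp1.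
have [x' c0] := diag_coef_neq0 fe1 (iso_neq0 (diag_idem_neq0 hv x)).
exists x'; set e' := diag_idem v' x'.
have ee : f (diag_idem v x) * f (diag_idem v x) = f (diag_idem v x).
  by rewrite -fM (diag_idemM hv) eqxx.
have c1 : diag_coef hv' x' (f (diag_idem v x)) = 1.
  have : f (diag_idem v x) * f (diag_idem v x) * e' = f (diag_idem v x) * e' by rewrite ee.
  rewrite -mulrA (comp1_diag_idem _ fe1) -fda_scalerAr (comp1_diag_idem _ fe1) scalerA.
  move/eqP; rewrite -subr_eq0 -scalerBl scaler_eq0 (negPf (diag_idem_neq0 hv' x')) orbF subr_eq0.
  by move/eqP/(canRL (mulfK c0)); rewrite mulfV.
have fe' : f (diag_idem v x) * e' = e' by rewrite (comp1_diag_idem _ fe1) c1 scale1r.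
pose w := f' e'.
have w1 : w \in X 1%g by rewrite -phi'1; apply/f'X/diag_idem_comp1.
have ew : diag_idem v x * w = w by apply: (can_inj fK); rewrite fM f'K.
have wE := diag_idem_mul_comp1 x w1; rewrite ew in wE.
have w0 : w != 0.
  by apply: contraNneq (diag_idem_neq0 hv' x') => w0; rewrite -[diag_idem v' x']f'K -/e' -/w w0 (lin0 flin).
have ww : w * w = w by rewrite -f'M (diag_idemM hv') eqxx.
have m0 : diag_coef hv x w != 0 by apply: contraNneq w0 => m0; rewrite wE m0 scale0r.
have m1 : diag_coef hv x w = 1.
  have := ww; rewrite {2}wE -fda_scalerAr (comp1_diag_idem _ w1) scalerA {3}wE.
  move/eqP; rewrite -subr_eq0 -scalerBl scaler_eq0 (negPf (diag_idem_neq0 hv x)) orbF subr_eq0.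
  by move/eqP/(canRL (mulfK m0)); rewrite mulfV.
by rewrite /e' -[diag_idem v' x']f'K -/e' -/w wE m1 scale1r.
Qed.

Lemma match_diag c (i : bI (T c)) g x' : f (diag_idem v (rowidx i)) = diag_idem v' x' ->
  exists h k, k != 0 /\ f (v i i g) = k *: v' (tagged x') (tagged x') h.
Proof.
move=> fe.
have [->|g1] := eqVneq g 1%g.
  exists 1%g, (bf (T c) 1%g 1%g * (bf (T' (tag x')) 1%g 1%g)^-1); split.
    by rewrite mulf_neq0 ?invr_eq0 ?cocycle_neq0.
  have := congr1 (fun a => bf (T c) 1%g 1%g *: a) fe.
  rewrite -(linZ flin) /diag_idem !scalerA mulfV ?cocycle_neq0 // scale1r.
  by [].
have u1 : phi (udeg (mkidx i i g)) != 1%g.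
  apply/eqP => /(congr1 phi'); rewrite phiK phi'1 => /udeg_eq1.
  by rewrite /unit_idx /= (negPf g1) andbF.
have fX1 : f (v i i g) \in X' (phi (udeg (mkidx i i g))).
  by apply: fX; apply: (units_comp_elt hv (mkidx i i g)).
have [s [k [k0 fE _]]] := comp_line u1 fX1 (iso_neq0 (tu_neq0 hv i i g)).
have [d [p [q [h sE]]]] := tidxP s.
have {}fE : f (v i i g) = k *: v' p q h by rewrite fE sE.
have : diag_idem v' x' * f (v i i g) = f (v i i g).
  by rewrite -fe -fM (diag_idem_l hv) eqxx.
have : f (v i i g) * diag_idem v' x' = f (v i i g).
  by rewrite -fe -fM (diag_idem_r hv) eqxx.
rewrite fE -(fda_scalerAl k) -(fda_scalerAr k) (diag_idem_r hv') (diag_idem_l hv').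
have vne := tu_neq0 hv' p q h.
have [<-|_] := eqVneq (rowidx q) x'; last first.
  by rewrite scaler0 => /esym/eqP; rewrite scaler_eq0 (negPf k0) (negPf vne).
have [/eqP|_ _] := eqVneq (rowidx q) (rowidx p); last first.
  by rewrite scaler0 => /esym/eqP; rewrite scaler_eq0 (negPf k0) (negPf vne).
by rewrite rowidx_eq => /eqP <- _ _; exists h, k.
Qed.

(** Two diagonal idempotents [e], [e'] belong to one block if and only if
[e A e' <> 0]. *)
Lemma match_tag x y x' y' : f (diag_idem v x) = diag_idem v' x' -> f (diag_idem v y) = diag_idem v' y' ->
  tag x = tag y -> tag x' = tag y'.
Proof.
case: x y => c i [d j] /= fx fy cd; case: _ / cd in j fy *.
have : diag_idem v' x' * f (v i j 1%g) * diag_idem v' y' = f (v i j 1%g).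
  by rewrite -fx -fy -!fM (diag_idem_l hv) eqxx (diag_idem_r hv) eqxx.
apply: contraPeq => xy; rewrite (bcoordE (tu_basis hv') (f _)) mulr_sumr mulr_suml big1.
  by move/esym/eqP; rewrite -bcoordE (negPf (iso_neq0 (tu_neq0 hv _ _ _))).
move=> s _; set k := bcoord _ _ s; rewrite -(fda_scalerAr k) -(fda_scalerAl k).
have [e [p [q [h ->]]]] := tidxP s; rewrite -[tu_elt _ _]/(v' p q h).
rewrite (diag_idem_l hv'); case: eqP => [xp|_]; last by rewrite mul0r scaler0.
rewrite (diag_idem_r hv'); case: eqP => [qy|_]; last by rewrite scaler0.
by rewrite xp -qy eqxx in xy.
Qed.

End GradedIso.

Section Matching.
Variables (K : fieldType) (A B : fdAlgebra K).
Variables (C : finType) (T : C -> block K).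
Variable v : unit_family A T.
Hypothesis hv : twisted_units v.
Variables (C' : finType) (T' : C' -> block K).
Variable v' : unit_family B T'.
Hypothesis hv' : twisted_units v'.

(** The bijection between diagonal idempotents preserves blocks. Within a block
it identifies the corners [e A e]; as their components are lines, this is a
relabelling of the two bases up to scalars. *)
Theorem graded_equivalence_blocks f phi :
    graded_equivalence (units_grading hv) (units_grading hv') f phi ->
  exists2 gam : C -> C', bijective gam & forall c, block_iso (T c) (T' (gam c)).
Proof.
case=> [[fhom phiM fX]] [f' fK f'K] [phi' phiK phi'K].
have f'hom := alg_hom_inv fhom fK f'K.
have phi1 : phi 1%g = 1%g by apply: (mulgI (phi 1%g)); rewrite -phiM !mulg1.
have phi'1 : phi' 1%g = 1%g by rewrite -phi1 phiK.
have f'X g x : x \in units_grading hv' g -> f' x \in units_grading hv (phi' g).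
  move=> xg; apply: (graded_inv fhom fK f'K (can_inj phiK) fX).
  by rewrite phi'K.
(* the bijection between the diagonal idempotents, and its inverse *)
have [be beE] := choice (match_idem fhom f'hom fK f'K phi1 phi'1 fX f'X).
have [be' be'E] := choice (match_idem f'hom fhom f'K fK phi'1 phi1 f'X fX).
have fid_inj (D : fdAlgebra K) (E : finType) (U : E -> block K)
    (u : unit_family D U) :
    twisted_units u -> injective (diag_idem u).
  move=> hu x y xy; have := diag_idemM hu x y; case: eqP => // _ /eqP.
  by rewrite xy diag_idemM // eqxx (negPf (diag_idem_neq0 hu y)).
have beK : cancel be be'.
  by move=> x; apply: (fid_inj _ _ _ _ hv); rewrite -be'E -beE fK.
have be'K : cancel be' be.
  by move=> x; apply: (fid_inj _ _ _ _ hv'); rewrite -beE -be'E f'K.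
pose gam c := tag (be (rowidx (bi0 (T c)))).
pose gam' c := tag (be' (rowidx (bi0 (T' c)))).
have tagbe x : tag (be x) = gam (tag x).
  exact: (match_tag hv hv' fhom fK (beE _) (beE _)).
have tagbe' x : tag (be' x) = gam' (tag x).
  exact: (match_tag hv' hv f'hom f'K (be'E _) (be'E _)).
have gamK : cancel gam gam' by move=> c; rewrite -[c in RHS](erefl (tag (rowidx (bi0 (T c))))) -tagbe' beK.
have gam'K : cancel gam' gam by move=> c; rewrite -tagbe be'K.
exists gam; first by exists gam'.
move=> c; split.
  pose P := [seq @rowidx _ _ T c i | i : bI (T c)].
  pose P' := [seq @rowidx _ _ T' (gam c) i | i : bI (T' (gam c))].
  have memP x : (x \in P) = (tag x == c).
    apply/mapP/eqP => [[i _ ->]//|<-]; exists (tagged x); rewrite ?mem_enum //.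
    by case: x.
  have memP' x : (x \in P') = (tag x == gam c).
    apply/mapP/eqP => [[i _ ->]//|<-]; exists (tagged x); rewrite ?mem_enum //.
    by case: x.
  have -> : #|bI (T c)| = size P by rewrite size_map cardE.
  have -> : #|bI (T' (gam c))| = size P' by rewrite size_map cardE.
  rewrite -(size_map be); apply: perm_size; apply: uniq_perm.
  - rewrite map_inj_uniq; last exact: can_inj beK.
    rewrite map_inj_uniq -?enumT ?enum_uniq //.
    by move=> i j /eqP; rewrite rowidx_eq => /eqP.
  - rewrite map_inj_uniq -?enumT ?enum_uniq //.
    by move=> i j /eqP; rewrite rowidx_eq => /eqP.
  move=> x; rewrite memP'; apply/mapP/eqP => [[y yP ->]|xc].
    by rewrite tagbe; move: yP; rewrite memP => /eqP ->.
  by exists (be' x); rewrite ?be'K // memP tagbe' xc gamK.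
pose i := bi0 (T c); pose x' := be (rowidx i).
have fx : f (diag_idem v (rowidx i)) = diag_idem v' x' by apply: beE.
have f'x : f' (diag_idem v' (rowidx (tagged x'))) = diag_idem v (rowidx i).
  by rewrite -[diag_idem v _]fK fx; case: (x').
have exg g : exists hk : bG (T' (gam c)) * K, hk.2 != 0 /\
    f (v i i g) = hk.2 *: v' (tagged x') (tagged x') hk.1.
  by have [h [k H]] := match_diag fhom fK phi'1 phiK fX g fx; exists (h, k).
have [hk hkP] := choice exg.
pose pi g := (hk g).1; pose l g := (hk g).2.
have l0 g : l g != 0 by have [] := hkP g.
have fE g : f (v i i g) = l g *: v' (tagged x') (tagged x') (pi g) by have [] := hkP g.
have [flin _ fM] := fhom.
have key g h : pi (g * h)%g = (pi g * pi h)%g /\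
    bf (T c) g h * l (g * h)%g = l g * l h * bf (T' (gam c)) (pi g) (pi h).
  have := congr1 f (tuM hv i i i g h).
  rewrite fM (linZ flin) !fE -fda_scalerAl -fda_scalerAr (tuM hv') !scalerA => E.
  pose m h := mkidx (tagged x') (tagged x') h.
  have e : m (pi g * pi h)%g = m (pi (g * h)%g).
    apply: (scaled_elt_eq hv' (s := m (pi g * pi h)%g) (t := m (pi (g * h)%g)) _ E).
    by rewrite !mulf_neq0 ?cocycle_neq0.
  have/eqP := e; rewrite mkidx_eq !eqxx /= => /eqP e'; split=> //.
  move/eqP: E; rewrite e' -subr_eq0 -scalerBl scaler_eq0 (negPf (tu_neq0 hv' _ _ _)) orbF.
  by rewrite subr_eq0 => /eqP.
exists pi, l; split=> //; last first.
- by move=> g h; have [] := key g h.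
- by move=> g h; have [] := key g h.
have exh h : exists g, pi g = h.
  have [g [k [k0 f'E]]] := match_diag f'hom f'K phi1 phi'K f'X h f'x.
  exists g; have := congr1 f f'E; rewrite f'K (linZ flin) [f _]fE scalerA => E.
  have : mkidx (tagged x') (tagged x') h = mkidx (tagged x') (tagged x') (pi g).
    apply: (scaled_elt_eq hv' (oner_neq0 K)); rewrite scale1r; exact: E.
  by move/eqP; rewrite mkidx_eq !eqxx /= => /eqP.
have [pi' pi'K] := choice exh.
exists pi' => // g.
have E : pi (pi' (pi g)) = pi g by [].
have : mkidx i i (pi' (pi g)) = mkidx i i g.
  apply: (scaled_elt_eq hv (k := l g) (l := l (pi' (pi g)))); first exact: l0.
  apply: (can_inj fK); rewrite !(linZ flin) [f (tu_elt _ _)]fE [f (tu_elt _ (mkidx _ _ g))]fE E.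
  by rewrite !scalerA (mulrC (l g)).
by move/eqP; rewrite mkidx_eq !eqxx /= => /eqP.
Qed.

End Matching.

(** * Maximal connected grading classes *)

Section EqClass.
Variables (T : Type) (e : T -> T -> Prop).
Hypotheses (er : forall x, e x x) (es : forall x y, e x y -> e y x)
  (et : forall x y z, e x y -> e y z -> e x z).

Lemma eqclass_ofP x y : eqclass_of e x = eqclass_of e y <-> e x y.
Proof.
split=> [/(congr1 sval) /= exy|xy]; first by rewrite exy.
apply: eq_exist; apply/funext => z; apply/propext; split; first exact/et/es.
exact: et.
Qed.

Lemma eqclass_reprK (c : eqclass e) : eqclass_of e (eqclass_repr c) = c.
Proof.
by case: c => c cP; apply: eq_exist; rewrite /eqclass_repr; case: cid.
Qed.

Lemma eqclass_reprP x : e x (eqclass_repr (eqclass_of e x)).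
Proof. by apply/eqclass_ofP; rewrite eqclass_reprK. Qed.

End EqClass.

Section GradedEquiv.
Variables (K : fieldType) (A : fdAlgebra K).
Implicit Types X Y Z : conn_grading A.

Lemma graded_equiv_refl X : graded_equiv X X.
Proof. by exists id, id; split; [split; [split| |]|exists id|exists id]. Qed.

Lemma graded_equiv_sym X Y : graded_equiv X Y -> graded_equiv Y X.
Proof.
move=> [f [phi [[fh phiM fX] [f' fK f'K] [phi' phiK phi'K]]]].
exists f', phi'; split; [split|by exists f|by exists phi].
- exact: alg_hom_inv fK f'K.
- by move=> x y; apply: (can_inj phiK); rewrite phi'K phiM !phi'K.
move=> g x xg; apply: (graded_inv fh fK f'K (can_inj phiK) fX).
by rewrite phi'K.
Qed.

Lemma alg_hom_comp (B C D : fdAlgebra K) (f : B -> C) (g : C -> D) :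
  alg_hom f -> alg_hom g -> alg_hom (g \o f).
Proof.
move=> [fl f1 fM] [gl g1 gM]; split=> [k x y| |x y] /=.
- by rewrite fl gl.
- by rewrite f1 g1.
- by rewrite fM gM.
Qed.

Lemma graded_equiv_trans X Y Z :
  graded_equiv X Y -> graded_equiv Y Z -> graded_equiv X Z.
Proof.
move=> [f [phi [[fh phiM fX] bf bphi]]] [g [psi [[gh psiM gX] bg bpsi]]].
exists (g \o f), (psi \o phi); split; [split|exact: bij_comp|exact: bij_comp].
- exact: alg_hom_comp.
- by move=> x y /=; rewrite phiM psiM.
by move=> d x xd /=; apply/gX/fX.
Qed.

Definition gclass X : conn_grading_class A := eqclass_of (@graded_equiv K A) X.

Lemma gclassP X Y : gclass X = gclass Y <-> graded_equiv X Y.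
Proof.
apply: eqclass_ofP; [exact: graded_equiv_refl|exact: graded_equiv_sym|].
exact: graded_equiv_trans.
Qed.

Lemma quotient_gclass X Y f phi :
  quotient_morphism (cg_grading X) (cg_grading Y) f phi -> Defs.quotient_class (gclass X) (gclass Y).
Proof. by move=> q; exists X, Y; split=> //; exists f, phi. Qed.

Hypothesis closedK : alg_closed K.
Hypothesis spA : semiprime A.

(** If the universal grading is a quotient of [X], choose units [w] homogeneous in
[X]: the universal grading of [w] maps onto [X] and then onto the given one.
The composition is injective by [phi_injective], so both maps are. *)
Lemma maximal_units (C : finType) (T : C -> block K)
    (v : unit_family A T) (hv : twisted_units v) :
    (forall c d, trivial_block (T c) -> trivial_block (T d) -> c = d) ->
  maximal_class (gclass (units_cg hv)).
Proof.
move=> tU c [X [Y [<- /gclassP YU [f [phi [[fh phiM fX] [f' fK f'K] phiS]]]]]].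
have [g [psi [[gh psiM gX] [g' gK g'K] [psi' psiK psi'K]]]] := YU.
have [D [U [w [hw wX _]]]] := homogeneous_units (cg_grading X) closedK spA.
have wX' s : homog (cg_grading X) (tu_elt w s) by apply: wX.
have [th [[_ thM thX] _ thS]] := universal_quotient hw wX'.
apply/gclassP; exists (g \o f), (psi \o phi).
have inj : injective (psi \o phi \o th).
  apply: (phi_injective (hv := hw) (hv' := hv) tU (f := g \o f) (f' := f' \o g')).
  - exact: alg_hom_comp.
  - exact: can_comp gK fK.
  - exact: can_comp f'K g'K.
  - by move=> x y /=; rewrite thM phiM psiM.
  - by move=> d x xd /=; apply/gX/fX/thX.
split.
- split; first exact: alg_hom_comp.
    by move=> x y /=; rewrite phiM psiM.
  by move=> d x xd /=; apply/gX/fX.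
- by apply: bij_comp; [exists g'|exists f'].
have surj x : exists y, (psi \o phi) y = x.
  by have [y yE] := phiS (psi' x); exists y; rewrite /= yE psi'K.
have [r rE] := choice surj; exists r => // x.
have [y <-] := thS x; have [z zE] := thS (r ((psi \o phi) (th y))).
rewrite -zE; congr th; apply: inj; rewrite /= zE.
exact: rE.
Qed.

(** Two trivial blocks are replaced by the group algebra of the group of order 2,
with basis [e1 + e2], [e1 - e2]. This refines the grading by a factor of order
2 that distinguishes [e1 - e2]. *)
Section TwoTrivial.
Variables (C : finType) (T : C -> block K).
Variable v : unit_family A T.
Hypothesis hv : twisted_units v.
Hypothesis two0 : (2%:R : K) != 0.
Variables (c1 c2 : C).
Hypotheses (c12 : c1 != c2) (tc1 : trivial_block (T c1)) (tc2 : trivial_block (T c2)).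
Local Notation S := (tidx T).
Local Notation b := (tu_elt v).
Local Notation crd := (bcoord (tu_basis hv)).

Let x1 := rowidx (bi0 (T c1)).
Let x2 := rowidx (bi0 (T c2)).
Let s1 : S := diag_idx x1.
Let s2 : S := diag_idx x2.
Let e1 := diag_idem v x1.
Let e2 := diag_idem v x2.

Let x12 : x1 != x2.
Proof. by apply: contraNneq c12 => /(congr1 (@tag _ _)) /= ->. Qed.

Let s12 : s1 != s2.
Proof. by rewrite (inj_eq (@diag_idx_inj _ _ _)). Qed.

Let trivial_idx c (s : S) : trivial_block (T c) -> tag s = c -> s = diag_idx (rowidx (bi0 (T c))).
Proof.
have [d [i [j [g ->]]]] := tidxP s => -[/eqP/fintype1P[p pP] /eqP/fintype1P[h hP]] /= dc.
case: _ / (esym dc) in i j g *.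
by rewrite (pP i) (pP j) (hP g) /diag_idx /= (pP (bi0 _)) (hP 1%g).
Qed.

Definition split_basis (s : S) : A :=
  if s == s1 then e1 + e2 else if s == s2 then e1 - e2 else b s.

Let b2s1 : split_basis s1 = e1 + e2. Proof. by rewrite /split_basis eqxx. Qed.
Let b2s2 : split_basis s2 = e1 - e2.
Proof. by rewrite /split_basis eq_sym (negPf s12) eqxx. Qed.
Let b2s s : s != s1 -> s != s2 -> split_basis s = b s.
Proof. by rewrite /split_basis => /negPf-> /negPf->. Qed.

Let diag_coefe x y : diag_coef hv x (diag_idem v y) = (y == x)%:R.
Proof.
rewrite /diag_coef diag_idemE bcoordZ bcoord_basis (inj_eq (@diag_idx_inj _ _ _)).
have [->|_] := eqVneq y x; last by rewrite mulr0 mul0r.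
by rewrite mulr1 mulVf ?cocycle_neq0.
Qed.

Let diag_coefD x a a' : diag_coef hv x (a + a') = diag_coef hv x a + diag_coef hv x a'.
Proof. by rewrite /diag_coef bcoordD mulrDl. Qed.

Let diag_coefZ x k a : diag_coef hv x (k *: a) = k * diag_coef hv x a.
Proof. by rewrite /diag_coef bcoordZ mulrA. Qed.

Let diag_coefN x a : diag_coef hv x (- a) = - diag_coef hv x a.
Proof. by rewrite -scaleN1r diag_coefZ mulN1r. Qed.

Let diag_coef0 x : diag_coef hv x 0 = 0.
Proof. by rewrite /diag_coef bcoord0 mul0r. Qed.

Let diag_coef_b x s : s != diag_idx x -> diag_coef hv x (b s) = 0.
Proof. by move=> /negPf sx; rewrite /diag_coef bcoord_basis sx mul0r. Qed.

Lemma split_is_basis : is_basis split_basis.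
Proof.
have e1E : e1 = 2%:R^-1 *: (split_basis s1 + split_basis s2).
  rewrite b2s1 b2s2 addrACA subrr addr0 -mulr2n -scaler_nat scalerA mulVf //.
  by rewrite scale1r.
have e2E : e2 = 2%:R^-1 *: (split_basis s1 + (-1) *: split_basis s2).
  rewrite b2s1 b2s2 scaleN1r opprB addrC addrA subrK -mulr2n -scaler_nat scalerA.
  by rewrite mulVf // scale1r.
split=> [a|k k0].
  rewrite (bcoordE (tu_basis hv) a); apply: in_span_sum => s _; apply: in_spanZ.
  have fE x : b (diag_idx x) = bf (T (tag x)) 1%g 1%g *: diag_idem v x.
    by rewrite diag_idemE scalerA mulfV ?cocycle_neq0 // scale1r.
  have [->|n1] := eqVneq s s1.
    rewrite fE -/e1 e1E; do 2!apply: in_spanZ.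
    by apply: in_spanD; apply: in_span_basis.
  have [->|n2] := eqVneq s s2.
    rewrite fE -/e2 e2E; do 2!apply: in_spanZ.
    by apply: in_spanD; [|apply: in_spanZ]; apply: in_span_basis.
  by rewrite -b2s //; apply: in_span_basis.
have kt t : t != s1 -> t != s2 -> k t = 0.
  move=> n1 n2; have := congr1 (fun a => crd a t) k0; rewrite bcoord0 bcoord_sum => <-.
  rewrite (bigD1 t) //= bcoordZ b2s // bcoord_basis eqxx mulr1.
  rewrite big1 ?addr0 // => s st.
  rewrite bcoordZ; suff -> : crd (split_basis s) t = 0 by rewrite mulr0.
  have ce x : t != diag_idx x -> crd (diag_idem v x) t = 0.
    by move=> tx; rewrite diag_idemE bcoordZ bcoord_basis eq_sym (negPf tx) mulr0.
  rewrite /split_basis; case: ifP => _.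
    by rewrite bcoordD /e1 /e2 !ce ?addr0.
  case: ifP => _; last by rewrite bcoord_basis (negPf st).
  by rewrite -scaleN1r bcoordD (bcoordZ _ (-1)) /e1 /e2 !ce // mulr0 addr0.
have k12 : k s1 *: (e1 + e2) + (k s2 *: (e1 - e2) + 0) = 0.
  rewrite -b2s1 -b2s2 -[RHS]k0 (bigD1 s1) //= (bigD1 s2) 1?eq_sym //=.
  congr (_ + (_ + _)); rewrite big1 // => s /andP[n1 n2]; by rewrite kt ?scale0r.
have E x : k s1 * ((x1 == x)%:R + (x2 == x)%:R) + k s2 * ((x1 == x)%:R - (x2 == x)%:R) = 0.
  have := congr1 (diag_coef hv x) k12.
  have D1 : diag_coef hv x (e1 + e2) = (x1 == x)%:R + (x2 == x)%:R.
    by rewrite diag_coefD /e1 /e2 !diag_coefe.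
  have D2 : diag_coef hv x (e1 - e2) = (x1 == x)%:R - (x2 == x)%:R.
    by rewrite diag_coefD diag_coefN /e1 /e2 !diag_coefe.
  by rewrite diag_coefD (diag_coefZ _ (k s1)) D1 diag_coefD (diag_coefZ _ (k s2)) diag_coef0 D2 addr0.
have := E x1; have := E x2; rewrite !eqxx (negPf x12) eq_sym (negPf x12) add0r sub0r addr0 subr0.
rewrite !mulr1 mulrN1 => /subr0_eq k12E; rewrite k12E -mulr2n -mulr_natl => /eqP.
rewrite mulf_eq0 (negPf two0) /= => /eqP k20 s.
have [->|n1] := eqVneq s s1; first by rewrite k12E.
by have [->|n2] := eqVneq s s2; [|apply: kt].
Qed.

Local Notation crd2 := (bcoord split_is_basis).
Let z : 'I_2 := inord 1.
Let zz : (z * z)%g = 1%g.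
Proof. by apply/val_inj; rewrite /= inordK. Qed.
Let z1 : z != 1%g.
Proof. by apply/eqP=> /(congr1 (@nat_of_ord 2)); rewrite inordK. Qed.

Local Notation U := (univ T * 'I_2)%type.
Definition split_deg (s : S) : U := (udeg s, if s == s2 then z else 1%g).

Let udeg_s1 : udeg s1 = 1%g.
Proof. by apply: udeg_unit; rewrite /unit_idx !eqxx. Qed.
Let udeg_s2 : udeg s2 = 1%g.
Proof. by apply: udeg_unit; rewrite /unit_idx !eqxx. Qed.

Let split_degM s t k u : split_basis s * split_basis t = k *: split_basis u ->
  split_deg u = (split_deg s * split_deg t)%g ->
  forall w, crd2 (split_basis s * split_basis t) w != 0 -> split_deg w = (split_deg s * split_deg t)%g.
Proof.
move=> -> uE w; rewrite bcoordZ bcoord_basis; have [<-//|_] := eqVneq u w.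
by rewrite mulr0 eqxx.
Qed.

Let other_tag s : s != s1 -> s != s2 -> (tag s != c1) && (tag s != c2).
Proof.
move=> n1 n2; apply/andP; split; first by apply: contraNneq n1 => /(trivial_idx tc1) ->.
by apply: contraNneq n2 => /(trivial_idx tc2) ->.
Qed.

Let ebl x s : tag s != tag x -> diag_idem v x * b s = 0.
Proof.
have [c [i [j [g ->]]]] := tidxP s => /= cx.
rewrite -[tu_elt _ _]/(v i j g) (diag_idem_l hv); case: eqP => // xi; by rewrite xi eqxx in cx.
Qed.

Let ebr x s : tag s != tag x -> b s * diag_idem v x = 0.
Proof.
have [c [i [j [g ->]]]] := tidxP s => /= cx.
rewrite -[tu_elt _ _]/(v i j g) (diag_idem_r hv); case: eqP => // xi; by rewrite -xi eqxx in cx.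
Qed.

Lemma split_closed s t w : crd2 (split_basis s * split_basis t) w != 0 ->
  split_deg w = (split_deg s * split_deg t)%g.
Proof.
have ee : [/\ e1 * e1 = e1, e1 * e2 = 0, e2 * e1 = 0 & e2 * e2 = e2].
  by rewrite /e1 /e2 !(diag_idemM hv) !eqxx (eq_sym x2) (negPf x12).
case: ee => e11 e12 e21 e22.
have d1 : split_deg s1 = 1%g by rewrite /split_deg udeg_s1 (negPf s12).
have d2 : split_deg s2 = (1%g, z) by rewrite /split_deg udeg_s2 eqxx.
have d22 : (split_deg s2 * split_deg s2)%g = 1%g by rewrite d2; congr (_, _); rewrite ?mulg1 ?zz.
have [->|s_1] := eqVneq s s1; last have [->|s_2] := eqVneq s s2;
  (have [->|t_1] := eqVneq t s1; last have [->|t_2] := eqVneq t s2).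
- apply: (@split_degM _ _ 1 s1); last by rewrite d1 mulg1.
  by rewrite scale1r b2s1 mulrDl !mulrDr e11 e12 e21 e22 addr0 add0r.
- apply: (@split_degM _ _ 1 s2); last by rewrite d1 mul1g.
  by rewrite scale1r b2s1 b2s2 mulrDl !mulrBr e11 e12 e21 e22 subr0 sub0r.
- have /andP[h1 h2] := other_tag t_1 t_2.
  by rewrite b2s1 b2s // mulrDl /e1 /e2 !ebl // addr0 bcoord0 eqxx.
- apply: (@split_degM _ _ 1 s2); last by rewrite d1 mulg1.
  by rewrite scale1r b2s1 b2s2 mulrBl !mulrDr e11 e12 e21 e22 addr0 add0r.
- apply: (@split_degM _ _ 1 s1); last by rewrite d22 d1.
  by rewrite scale1r b2s1 b2s2 mulrBl !mulrBr e11 e12 e21 e22 subr0 sub0r opprK.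
- have /andP[h1 h2] := other_tag t_1 t_2.
  by rewrite b2s2 b2s // mulrBl /e1 /e2 !ebl // subr0 bcoord0 eqxx.
- have /andP[h1 h2] := other_tag s_1 s_2.
  by rewrite b2s1 b2s // mulrDr /e1 /e2 !ebr // addr0 bcoord0 eqxx.
- have /andP[h1 h2] := other_tag s_1 s_2.
  by rewrite b2s2 b2s // mulrBr /e1 /e2 !ebr // subr0 bcoord0 eqxx.
have := @split_degM s t; rewrite !b2s //.
have [->|[c [i [j [k [g [h [sE tE ->]]]]]]]] := tu_mulP hv s t; first by rewrite bcoord0 eqxx.
have /andP[h1 h2] := other_tag s_1 s_2; rewrite sE /= in h1 h2.
set u := mkidx i k (g * h)%g.
have u1 : u != s1 by apply: contraNneq h1 => /(congr1 (@tag _ _)) /= ->.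
have u2 : u != s2 by apply: contraNneq h2 => /(congr1 (@tag _ _)) /= ->.
move/(_ (bf (T c) g h) u); rewrite b2s // => H; apply: H => //.
rewrite /split_deg (negPf u2) (negPf s_2) (negPf t_2) sE tE.
by congr (_, _); rewrite ?mulg1 // (@udeg_map K C T).
Qed.

Definition split_grading : grading A U := basis_grading split_closed.

Let split_compP d a : a \in split_grading d <-> forall s, crd2 a s != 0 -> split_deg s = d.
Proof. exact: basis_compP. Qed.

Let split_comp_elt s : split_basis s \in split_grading (split_deg s).
Proof. exact: (basis_comp_elt split_is_basis split_deg s). Qed.

Lemma split_connected : is_connected split_grading.
Proof.
move=> H Hc Hs.
have HD s : split_deg s \in H.
  apply: Hs => E; have := split_comp_elt s; rewrite E memv0; apply/negP.
  exact: basis_neq0 split_is_basis s.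
have Hz : ((1%g, z) : U) \in H by have := HD s2; rewrite /split_deg udeg_s2 eqxx.
have Hu s : ((udeg s, 1%g) : U) \in H.
  have := HD s; rewrite /split_deg; case: eqP => // -> _; rewrite udeg_s2.
  by case: Hc.
have HM := group_closedM Hc.
have Hx x : ((x, 1%g) : U) \in H.
  rewrite (univ_gen x); elim: (repr x) => [|s w IHw]; first by rewrite big_nil; case: Hc.
  rewrite big_cons; have -> : ((udeg s * \prod_(t <- w) udeg t)%g, 1%g) =
    ((udeg s, 1%g) * ((\prod_(t <- w) udeg t)%g, 1%g))%g :> U by congr (_, _); rewrite mulg1.
  exact: HM.
move=> [x y]; have [->//|y1] := eqVneq y 1%g.
have -> : y = z.
  apply/val_inj; rewrite /= inordK //; move: y1; rewrite -val_eqE /=; case: y => [[|[|n]] yn] //=.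
have -> : ((x, z) : U) = ((x, 1%g) * (1%g, z))%g by congr (_, _); rewrite ?mulg1 ?mul1g.
exact: HM.
Qed.

Definition split_cg : conn_grading A := ConnGrading split_connected.

Lemma split_sub x y a : a \in split_grading (x, y) -> a \in units_grading hv x.
Proof.
move/split_compP => aP; rewrite (bcoordE split_is_basis a); apply: rpred_sum => s _.
have [->|/aP[<- _]] := eqVneq (crd2 a s) 0; first by rewrite scale0r mem0v.
apply: rpredZ; rewrite /split_basis; case: eqP => [->|_].
  by rewrite udeg_s1; apply: rpredD; apply: diag_idem_comp1.
case: eqP => [->|_]; last exact: units_comp_elt.
by rewrite udeg_s2; apply: rpredB; apply: diag_idem_comp1.
Qed.

Lemma split_quotient : Defs.quotient_class (gclass split_cg) (gclass (units_cg hv)).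
Proof.
apply: (@quotient_gclass split_cg (units_cg hv) id fst); split.
- by split=> // -[x y] a; apply: split_sub.
- by exists id.
by move=> d; exists (d, 1%g).
Qed.

Lemma split_comp1 a : a \in split_grading 1%g -> diag_coef hv x1 a = diag_coef hv x2 a.
Proof.
move/split_compP => aP; rewrite (bcoordE split_is_basis a).
suff H s : diag_coef hv x1 (crd2 a s *: split_basis s) = diag_coef hv x2 (crd2 a s *: split_basis s).
  rewrite /diag_coef !bcoord_sum !mulr_suml; apply: eq_bigr => s _; exact: H.
have [->|/aP[_]] := eqVneq (crd2 a s) 0; first by rewrite scale0r !diag_coef0.
case: ifP => [_ /eqP|/negbT n2 _]; first by rewrite (negPf z1).
rewrite !diag_coefZ; congr (_ * _); rewrite /split_basis (negPf n2); case: ifP => [_|/negbT n1].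
  by rewrite /e1 /e2 !diag_coefD !diag_coefe !eqxx (eq_sym x2) (negPf x12) addr0 add0r.
by rewrite !diag_coef_b.
Qed.

(** In an equivalence, the images of the diagonal idempotents would be orthogonal
idempotents of the component of degree 1, as many as its dimension, hence its
minimal idempotents; but in the refined grading no element of degree 1
separates [e1] from [e2]. *)
Lemma two_trivial_not_maximal : ~ maximal_class (gclass (units_cg hv)).
Proof.
move=> /(_ _ split_quotient)/gclassP/graded_equiv_sym[f [phi [[fh phiM fX] bf _]]].
have [flin _ fM] := fh; have [f' fK f'K] := bf.
have phi1 : phi 1%g = 1%g by apply: (mulgI (phi 1%g)); rewrite -phiM !mulg1.
have fY x : f (diag_idem v x) \in split_grading 1%g by rewrite -phi1; apply/fX/diag_idem_comp1.
have fX1 x : f (diag_idem v x) \in units_grading hv 1%g by apply: split_sub (fY x).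
have exm x : exists y, diag_coef hv y (f (diag_idem v x)) != 0.
  apply: diag_coef_neq0 => //; apply: contra_neq (diag_idem_neq0 hv x) => fx.
  by apply: (can_inj fK); rewrite fx (lin0 flin).
have [m mP] := choice exm.
have m_sep x y p : diag_coef hv p (f (diag_idem v x)) != 0 -> diag_coef hv p (f (diag_idem v y)) != 0 -> x = y.
  move=> px py; apply/eqP; apply: contraT => xy.
  have : f (diag_idem v x) * f (diag_idem v y) * diag_idem v p = 0.
    by rewrite -fM (diag_idemM hv) (negPf xy) (lin0 flin) mul0r.
  rewrite -mulrA (comp1_diag_idem _ (fX1 y)) -fda_scalerAr (comp1_diag_idem _ (fX1 x)) scalerA => /eqP.
  by rewrite scaler_eq0 mulf_eq0 (negPf px) (negPf py) (negPf (diag_idem_neq0 hv p)).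
have m_inj : injective m.
  by move=> x y mxy; apply: (m_sep x y (m x)); rewrite ?mP // mxy.
have [m' mK m'K] := injF_bij m_inj.
have H1 := mP (m' x1); have H2 := mP (m' x2); rewrite m'K in H1; rewrite m'K in H2.
have E : m' x1 = m' x2.
  by apply: (m_sep _ _ x2) => //; rewrite -split_comp1.
by case/eqP: x12; rewrite -[x1]m'K E m'K.
Qed.

End TwoTrivial.

End GradedEquiv.

(** * Changing the type by block isomorphisms *)

Lemma inj_surj_bij (X Y : Type) (f : X -> Y) :
  injective f -> (forall y, exists x, f x = y) -> bijective f.
Proof.
by move=> fi fs; have [g gK] := choice fs; exists g => // x; apply: fi; rewrite gK.
Qed.

(** Stated for an arbitrary type, because terms are too large, in the sense of
universes, to form an [eqType]. *)
Lemma fibre_inj (C C' : finType) (X : Type) (f : C -> X) (g : C' -> X) :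
    (forall x, #|[pred c | `[< f c = x >]]| = #|[pred c | `[< g c = x >]]|) ->
  exists2 be : C -> C', injective be & forall c, g (be c) = f c.
Proof.
move=> fg.
have memc c : c \in [pred d | `[< f d = f c >]] by rewrite inE.
pose be0 x c (m : c \in [pred d | `[< f d = x >]]) := enum_val (cast_ord (fg x) (enum_rank_in m c)).
have be0_inj x c d mc md : @be0 x c mc = @be0 x d md -> c = d.
  by move=> /enum_val_inj/cast_ord_inj/(congr1 enum_val); rewrite !enum_rankK_in.
have be0P x c m : g (@be0 x c m) = x.
  by have := enum_valP (cast_ord (fg x) (enum_rank_in m c)); rewrite inE.
exists (fun c => be0 (f c) c (memc c)) => [c d cd|c]; last exact: be0P.
have fcd : f c = f d by rewrite -(be0P _ _ (memc c)) cd be0P.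
by move: cd; move: (memc d); rewrite -fcd => md; apply: be0_inj.
Qed.

Lemma fibre_bij (C C' : finType) (X : Type) (f : C -> X) (g : C' -> X) :
    (forall x, #|[pred c | `[< f c = x >]]| = #|[pred c | `[< g c = x >]]|) ->
  exists2 be : C -> C', bijective be & forall c, g (be c) = f c.
Proof.
move=> fg; have [be bei beP] := fibre_inj fg; exists be => //.
apply: inj_card_bij => //; have [be' bei' _] := fibre_inj (fun x => esym (fg x)).
exact: leq_card bei'.
Qed.

Lemma count_bij (C C' : finType) (X : eqType) (f : C -> X) (g : C' -> X) :
    (forall x, #|[pred c | f c == x]| = #|[pred c | g c == x]|) ->
  exists2 be : C -> C', bijective be & forall c, g (be c) = f c.
Proof.
move=> fg; apply: fibre_bij => x; transitivity #|[pred c | f c == x]|.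
  by apply: eq_card => c; rewrite !inE; apply/asboolP/eqP.
by rewrite fg; apply: eq_card => c; rewrite !inE; apply/eqP/asboolP.
Qed.

Lemma card_bij (I J : finType) : #|I| = #|J| -> exists a : I -> J, bijective a.
Proof.
move=> IJ; have [|a ba _] := @count_bij I J unit (fun=> tt) (fun=> tt); last by exists a.
by move=> [] /=; rewrite (eq_card (B := I)) // IJ; apply: eq_card.
Qed.

Lemma big_inj_support (R : nmodType) (I J : finType) (h : J -> I) (F : I -> R) :
    injective h -> (forall i, (forall j, i != h j) -> F i = 0) ->
  \sum_i F i = \sum_j F (h j).
Proof.
move=> hi F0; rewrite (bigID (mem (codom h))) /= [X in _ + X]big1 ?addr0 => [|i iN].
  rewrite -big_uniq; last by rewrite /codom /image_mem map_inj_uniq ?enum_uniq.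
  by rewrite /codom /image_mem big_map big_enum.
apply: F0 => j; apply: contraNneq iN => ->; exact: codom_f.
Qed.

Lemma basis_reindex (K : fieldType) (V : lmodType K) (S S' : finType) (b : S -> V)
    (si : S' -> S) (k : S' -> K) : bijective si -> (forall s, k s != 0) ->
  is_basis b -> is_basis (fun s => k s *: b (si s)).
Proof.
move=> [si' siK si'K] k0 [sb fb]; split=> [x|l].
  have [l ->] := sb x; exists (fun s => l (si s) / k s).
  rewrite (reindex si) /=; last by exists si' => *; rewrite ?siK ?si'K.
  by apply: eq_bigr => s _; rewrite scalerA mulfVK.
move=> E s; apply/eqP; rewrite -[_ == 0](mulIr_eq0 _ (mulIf (k0 s))) -[s]siK.
apply/eqP; apply: (fb (fun t => l (si' t) * k (si' t))).
rewrite -[RHS]E [RHS](reindex si'); last by exists si => *; rewrite ?siK ?si'K.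
by apply: eq_bigr => t _; rewrite scalerA si'K.
Qed.

Section Reindex.
Variables (K : fieldType) (A : fdAlgebra K).
Variables (C : finType) (T : C -> block K).
Variable v : unit_family A T.
Hypothesis hv : twisted_units v.
Variables (C' : finType) (T' : C' -> block K) (be : C' -> C).
Hypothesis be_bij : bijective be.
Hypothesis be_iso : forall c, block_iso (T' c) (T (be c)).

(** The new units are multiples of the old ones, so they stay homogeneous. *)
Lemma reindex_units : exists v' : unit_family A T',
  twisted_units v' /\
  forall c i j g, exists s k, v' c i j g = k *: tu_elt v s.
Proof.
have ex c : exists x : (bI (T' c) -> bI (T (be c))) * (bG (T' c) -> bG (T (be c))) * (bG (T' c) -> K),
    [/\ bijective x.1.1, bijective x.1.2, {morph x.1.2 : g h / (g * h)%g},
      forall g, x.2 g != 0 &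
      forall g h, bf (T' c) g h * x.2 (g * h)%g = x.2 g * x.2 h * bf (T (be c)) (x.1.2 g) (x.1.2 h)].
  have [cd [pi [l [pb piM l0 lP]]]] := be_iso c.
  by have [a ab] := card_bij cd; exists (a, pi, l).
pose x c := sval (cid (ex c)).
pose al c := (x c).1.1; pose pi c := (x c).1.2; pose l c := (x c).2.
have alb c : bijective (al c) by have [H _ _ _ _] := svalP (cid (ex c)); exact: H.
have pib c : bijective (pi c) by have [_ H _ _ _] := svalP (cid (ex c)); exact: H.
have piM c : {morph pi c : g h / (g * h)%g} by have [_ _ H _ _] := svalP (cid (ex c)); exact: H.
have l0 c g : l c g != 0 by have [_ _ _ H _] := svalP (cid (ex c)); exact: H.
have lP c g h : bf (T' c) g h * l c (g * h)%g = l c g * l c h * bf (T (be c)) (pi c g) (pi c h).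
  by have [_ _ _ _ H] := svalP (cid (ex c)); exact: H.
exists (fun c i j g => l c g *: v (al c i) (al c j) (pi c g)); split; last first.
  by move=> c i j g; exists (mkidx (al c i) (al c j) (pi c g)), (l c g).
split.
- pose si (s : tidx T') : tidx T := mkidx (al _ (tagged s).1.1) (al _ (tagged s).1.2) (pi _ (tagged s).2).
  apply: (@basis_reindex _ _ _ _ (tu_elt v) si (fun s => l (tag s) (tagged s).2)) => //; last exact: tu_basis.
  apply: inj_surj_bij.
    move=> s t; have [c [i [j [g ->]]]] := tidxP s; have [c' [i' [j' [g' ->]]]] := tidxP t.
    rewrite /si /= => e; have cc : c = c' by apply: (bij_inj be_bij); exact: (congr1 (@tag _ _) e).
    case: _ / cc in i' j' g' e *; move/eqP: e.
    rewrite mkidx_eq !(inj_eq (bij_inj (alb _))) (inj_eq (bij_inj (pib _))).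
    by case/and3P=> /eqP -> /eqP -> /eqP ->.
  move=> t; have [c [i [j [g ->]]]] := tidxP t; have [be' _ be'K] := be_bij.
  case: _ / (be'K c) in i j g *.
  have [a' _ aK] := alb (be' c); have [p' _ pK] := pib (be' c).
  by exists (mkidx (a' i) (a' j) (p' g)); rewrite /si /= !aK pK.
- move=> c i j k g h; rewrite -fda_scalerAl -fda_scalerAr (tuM hv) !scalerA lP.
  by rewrite piM.
move=> c c' i j g k m h jk; rewrite -fda_scalerAl -fda_scalerAr (tuM0 hv) ?scaler0 //.
apply: contraNneq jk => e; have cc : c = c' by apply: (bij_inj be_bij); exact: (congr1 (@tag _ _) e).
case: _ / cc in k m h e *; move/eqP: e.
by rewrite rowidx_eq (inj_eq (bij_inj (alb _))) => /eqP ->.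
Qed.

End Reindex.

Definition cocycle_one (K : fieldType) : cocycle2 K 'I_1.
Proof. by refine (@Cocycle2 K _ (fun _ _ => 1) _ _) => *; rewrite ?oner_neq0 ?mulr1. Defined.

(** Matrix units are the twisted units whose groups are all trivial. *)
Definition mat_block (K : fieldType) (I : finType) (i0 : I) : block K := Block i0 (cocycle_one K).

Section BlockIso.
Variable K : fieldType.
Implicit Types B : block K.

Lemma block_iso_refl B : block_iso B B.
Proof.
split=> //; exists id, (fun=> 1); split=> // [|g|g h]; first by exists id.
  exact: oner_neq0.
by rewrite !mulr1 mul1r.
Qed.

Lemma block_iso_sym B B' : block_iso B B' -> block_iso B' B.
Proof.
move=> [cd [pi [l [[pi' piK pi'K] piM l0 lP]]]]; split; first by rewrite cd.
exists pi', (fun g => (l (pi' g))^-1); split.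
- by exists pi.
- by move=> g h; apply: (can_inj piK); rewrite pi'K piM !pi'K.
- by move=> g; rewrite invr_eq0.
move=> g h; have := lP (pi' g) (pi' h); rewrite !pi'K.
have -> : (pi' g * pi' h)%g = pi' (g * h)%g.
  by apply: (can_inj piK); rewrite pi'K piM !pi'K.
move=> E; apply: (canLR (mulfK (l0 _))); rewrite -(mulrA _ (bf B _ _)) E.
by rewrite !mulrA (mulrAC (_^-1)) mulVf // mul1r mulVf // mul1r.
Qed.

Lemma block_iso_trans B1 B2 B3 : block_iso B1 B2 -> block_iso B2 B3 -> block_iso B1 B3.
Proof.
move=> [cd [pi [l [pb piM l0 lP]]]] [cd' [pi' [l' [pb' piM' l0' lP']]]].
split; first by rewrite cd.
exists (pi' \o pi), (fun g => l g * l' (pi g)); split=> [|g h|g|g h] /=.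
- exact: bij_comp.
- by rewrite piM piM'.
- by rewrite mulf_neq0.
rewrite mulrA lP piM -(mulrA (_ * _)) lP' !mulrA; congr (_ * _).
by rewrite -!mulrA; congr (_ * _); rewrite mulrCA.
Qed.

Lemma mat_block_iso B (I : finType) (i0 : I) : #|bG B| = 1%N -> #|bI B| = #|I| ->
  block_iso B (mat_block K i0).
Proof.
move=> /eqP/fintype1P[x xP] cI; split=> //.
have all1 g : g = 1%g :> bG B by rewrite (xP g) (xP 1%g).
exists (fun=> 1%g), (fun=> bf B 1%g 1%g); split.
- by exists (fun=> 1%g) => g; [rewrite (all1 g)|rewrite (ord1 g)].
- by move=> g h; rewrite mulg1.
- by move=> g; apply: cocycle_neq0.
by move=> g h; rewrite (all1 g) (all1 h) /= mulr1.
Qed.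

End BlockIso.

(** * Sizes of matrix units *)

Lemma dim_span_basis (K : fieldType) (V : vectType K) (S : finType) (b : S -> V) (P : pred S) :
  is_basis b -> \dim <<[seq b s | s <- enum P]>> = #|P|.
Proof.
move=> hb; have [_ fb] := hb.
suff fr : free [seq b s | s <- enum P] by move: fr; rewrite /free size_map -cardE => /eqP.
apply/(@freeP _ _ _ (in_tuple [seq b s | s <- enum P])) => k E i.
have sz : size [seq b s | s <- enum P] = #|P| by rewrite size_map -cardE.
pose e (i : 'I_(size [seq b s | s <- enum P])) : S := enum_val (cast_ord sz i).
have eE (j : 'I_(size [seq b s | s <- enum P])) : [seq b s | s <- enum P]`_j = b (e j).
  rewrite /e /enum_val (nth_map (enum_default (cast_ord sz j))) //.
  by rewrite -cardE; have := ltn_ord j; rewrite {2}sz.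
have e_inj : injective e by move=> x y /enum_val_inj/cast_ord_inj.
pose l s := \sum_(j | e j == s) k j.
have : l (e i) = 0.
  apply: fb; rewrite -[RHS]E; under eq_bigr do rewrite scaler_suml.
  rewrite (exchange_big_dep xpredT) //=; apply: eq_bigr => j _.
  by rewrite (big_pred1 (e j)) ?eE // => s; rewrite eq_sym.
by rewrite /l (big_pred1 i) // => j; rewrite (inj_eq e_inj).
Qed.

Section Center.
Variables (K : fieldType) (A : fdAlgebra K).
Variables (C : finType) (T : C -> block K).
Variable v : unit_family A T.
Hypothesis hv : twisted_units v.
Local Notation b := (tu_elt v).
Local Notation crd := (bcoord (tu_basis hv)).

Definition block_idem c : A := \sum_(i : bI (T c)) diag_idem v (rowidx i).

Lemma block_idem_l c s : block_idem c * b s = if tag s == c then b s else 0.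
Proof.
rewrite /block_idem mulr_suml; have [d [i [j [g ->]]]] := tidxP s.
rewrite -[tu_elt _ _]/(v i j g) [tag _]/=; case: eqP => [dc|dc].
  case: _ / dc; rewrite (bigD1 i) //= (diag_idem_l hv) eqxx big1 ?addr0 // => k ki.
  by rewrite (diag_idem_l hv) rowidx_eq (negPf ki).
rewrite big1 // => k _; rewrite (diag_idem_l hv); case: eqP => // /(congr1 (@tag _ _)) /= cd.
by case: dc.
Qed.

Lemma block_idem_r c s : b s * block_idem c = if tag s == c then b s else 0.
Proof.
rewrite /block_idem mulr_sumr; have [d [i [j [g ->]]]] := tidxP s.
rewrite -[tu_elt _ _]/(v i j g) [tag _]/=; case: eqP => [dc|dc].
  case: _ / dc; rewrite (bigD1 j) //= (diag_idem_r hv) eqxx big1 ?addr0 // => k ki.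
  by rewrite (diag_idem_r hv) rowidx_eq eq_sym (negPf ki).
rewrite big1 // => k _; rewrite (diag_idem_r hv); case: eqP => // /(congr1 (@tag _ _)) /= cd.
by case: dc.
Qed.

Lemma block_idem_central c a : block_idem c * a = a * block_idem c.
Proof.
rewrite (bcoordE (tu_basis hv) a) mulr_sumr mulr_suml; apply: eq_bigr => s _.
by rewrite -fda_scalerAr -fda_scalerAl block_idem_l block_idem_r.
Qed.

Lemma block_idemM c d : block_idem c * block_idem d = if c == d then block_idem c else 0.
Proof.
rewrite {1}/block_idem mulr_suml (eq_bigr (fun i => if c == d then diag_idem v (rowidx i) else 0)) => [|i _].
  by case: eqP => // _; rewrite big1.
by rewrite diag_idemE -fda_scalerAl block_idem_r /=; case: eqP => // _; rewrite scaler0.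
Qed.

Lemma block_idem_sum1 : \sum_c block_idem c = 1.
Proof.
rewrite -(diag_idem_sum1 hv) sig_big_dep /=; apply: eq_bigr => -[c i] _; by [].
Qed.

Lemma block_idem_neq0 c : block_idem c != 0.
Proof.
apply: contraNneq (diag_idem_neq0 hv (rowidx (bi0 (T c)))) => z0.
have := block_idem_l c (diag_idx (rowidx (bi0 (T c)))); rewrite z0 mul0r eqxx => E.
by have := basis_neq0 (tu_basis hv) (diag_idx (rowidx (bi0 (T c)))); rewrite -E eqxx.
Qed.

Hypothesis matrixT : forall c, #|bG (T c)| = 1%N.

Let all1 c (g : bG (T c)) : g = 1%g.
Proof. by have /eqP/fintype1P[x xP] := matrixT c; rewrite (xP g) (xP 1%g). Qed.

(** A central element has no off-diagonal coordinates, and commuting with the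
units of a block makes its diagonal coordinates equal on that block. *)
Lemma central_block_idem z c : (forall a, z * a = a * z) -> exists l, z * block_idem c = l *: block_idem c.
Proof.
move=> zC.
have z1 : z \in units_grading hv 1%g.
  apply/units_compP => s; have [d [i [j [g ->]]]] := tidxP s => zs.
  apply: udeg_unit; rewrite /unit_idx /= (all1 g) eqxx andbT.
  apply: contraNT zs => ij; apply/eqP.
  have E : diag_idem v (rowidx i) * z * diag_idem v (rowidx j) = 0.
    by rewrite -zC -mulrA (diag_idemM hv) rowidx_eq (negPf ij) mulr0.
  have := congr1 (fun a => crd a (mkidx i j g)) E; rewrite bcoord0 => <-.
  rewrite {2}(bcoordE (tu_basis hv) z) mulr_sumr mulr_suml bcoord_sum.
  rewrite (bigD1 (mkidx i j g)) //= [X in _ + X]big1 ?addr0 => [|t tn].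
    set k := crd z _; rewrite -(fda_scalerAr k) -(fda_scalerAl k) bcoordZ.
    rewrite -[tu_elt _ _]/(v i j g) (diag_idem_l hv) eqxx (diag_idem_r hv) eqxx.
    by rewrite (bcoord_basis (tu_basis hv) (mkidx i j g)) eqxx mulr1.
  set k := crd z _; rewrite -(fda_scalerAr k) -(fda_scalerAl k) bcoordZ.
  have [d' [i' [j' [g' tE]]]] := tidxP t; rewrite tE in tn *.
  rewrite -[tu_elt _ _]/(v i' j' g') (diag_idem_l hv); case: eqP => [_|_]; last first.
    by rewrite mul0r bcoord0 mulr0.
  rewrite (diag_idem_r hv); case: eqP => [_|_]; last by rewrite bcoord0 mulr0.
  by rewrite (bcoord_basis (tu_basis hv) (mkidx i' j' g')) (negPf tn) mulr0.
exists (diag_coef hv (rowidx (bi0 (T c))) z).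
rewrite /block_idem mulr_sumr scaler_sumr; apply: eq_bigr => i _.
rewrite (comp1_diag_idem _ z1); congr (_ *: _); set j := bi0 _.
pose w := v i j 1%g; have w0 : w != 0 by apply: (tu_neq0 hv).
have ew : diag_idem v (rowidx i) * w = w by rewrite (diag_idem_l hv) eqxx.
have we : w * diag_idem v (rowidx j) = w by rewrite (diag_idem_r hv) eqxx.
have zw : z * w = diag_coef hv (rowidx i) z *: w.
  by rewrite -{1}ew mulrA (comp1_diag_idem _ z1); set k := diag_coef _ _ _; rewrite -(fda_scalerAl k) ew.
have wz : w * z = diag_coef hv (rowidx j) z *: w.
  by rewrite -{1}we -mulrA (diag_idem_mul_comp1 _ z1); set k := diag_coef _ _ _; rewrite -(fda_scalerAr k) we.
have := zC w; rewrite zw wz => /eqP; rewrite -subr_eq0 -scalerBl scaler_eq0 (negPf w0) orbF.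
by rewrite subr_eq0 => /eqP.
Qed.

(** Recovers the size of a block from its central idempotent alone. *)
Lemma dim_block_idem c : \dim (principal (block_idem c)) = (#|bI (T c)| * #|bI (T c)|)%N.
Proof.
have -> : principal (block_idem c) = <<[seq b s | s <- enum [pred s : tidx T | tag s == c]]>>%VS.
  apply/vspaceP => a; apply/principalP/idP => [[y ->]|].
    rewrite (bcoordE (tu_basis hv) y) mulr_suml; apply: rpred_sum => s _.
    rewrite -fda_scalerAl block_idem_r; case: ifP => [sc|_]; last by rewrite scaler0 mem0v.
    by apply/rpredZ/memv_span/map_f; rewrite mem_enum.
  move=> aS; exists a; suff: (<<[seq b s | s <- enum [pred s : tidx T | tag s == c]]>> <= principal (block_idem c))%VS.
    move/subvP/(_ a aS)/principalP => [y ->].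
    by rewrite -mulrA block_idemM eqxx.
  apply/span_subvP => _ /mapP[s + ->]; rewrite mem_enum inE => sc.
  by apply/principalP; exists (b s); rewrite block_idem_r sc.
rewrite (dim_span_basis _ (tu_basis hv)).
rewrite -card_prod -(card_image (f := fun p => mkidx (c := c) p.1 p.2 1%g)); last first.
  by move=> [i j] [i' j'] /eqP; rewrite mkidx_eq /= => /and3P[/eqP-> /eqP->].
apply: eq_card => s; rewrite [LHS]inE; apply/idP/idP => [/eqP sc|H].
  have [d [i [j [g sE]]]] := tidxP s; rewrite sE /= in sc *; case: _ / sc.
  by apply/fintype.imageP; exists (i, j); rewrite // (all1 g).
by move/fintype.imageP: H => [[i j] _ ->] /=.
Qed.

End Center.

Section TwoFamilies.
Variables (K : fieldType) (A : fdAlgebra K).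

(** Two families of matrix units have the same block idempotents, the minimal
central idempotents of the algebra. *)
Lemma matrix_units_count_le (C : finType) (T : C -> block K) (v : unit_family A T)
    (C' : finType) (T' : C' -> block K) (v' : unit_family A T') :
    twisted_units v -> twisted_units v' -> (forall c, #|bG (T c)| = 1%N) ->
    (forall c, #|bG (T' c)| = 1%N) ->
  forall n, (#|[pred c | #|bI (T c)| == n]| <= #|[pred c | #|bI (T' c)| == n]|)%N.
Proof.
move=> hv hv' mT mT' n.
have ex c : exists d, block_idem v c = block_idem v' d.
  have [d zd] : exists d, block_idem v c * block_idem v' d != 0.
    apply: contrapT => nex; have := block_idem_neq0 hv c.
    rewrite -[block_idem v c]mulr1 -(block_idem_sum1 hv') mulr_sumr big1 ?eqxx // => d _.
    by apply: contrapT => /eqP z; apply: nex; exists d.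
  exists d.
  have [l lE] := central_block_idem hv mT c (block_idem_central hv' d).
  have [k kE] := central_block_idem hv' mT' d (block_idem_central hv c).
  have zc : block_idem v' d * block_idem v c = block_idem v c * block_idem v' d by apply: block_idem_central.
  have ee : (block_idem v c * block_idem v' d) * (block_idem v c * block_idem v' d) = block_idem v c * block_idem v' d.
    rewrite mulrA -(mulrA _ (block_idem v' d)) zc mulrA (block_idemM hv) eqxx -mulrA (block_idemM hv').
    by rewrite eqxx.
  have one (w : A) m : w != 0 -> w * w = w -> m *: w != 0 -> (m *: w) * (m *: w) = m *: w -> m *: w = w.
    move=> w0 ww mw; rewrite -fda_scalerAl -fda_scalerAr ww scalerA => /eqP.
    rewrite -subr_eq0 -scalerBl scaler_eq0 (negPf w0) orbF subr_eq0 => /eqP mm.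
    have m0 : m != 0 by apply: contraNneq mw => ->; rewrite scale0r.
    have m1 : m = 1 by apply: (mulfI m0); rewrite mulr1.
    by rewrite m1 scale1r.
  have E1 : block_idem v c * block_idem v' d = block_idem v c.
    rewrite -zc lE; apply: one; rewrite -?lE ?zc //; first exact: block_idem_neq0.
    by rewrite (block_idemM hv) eqxx.
  rewrite -{1}E1 kE; apply: one; rewrite -?kE //; first exact: block_idem_neq0.
  by rewrite (block_idemM hv') eqxx.
have [ga gaE] := choice ex.
have ga_inj : injective ga.
  move=> c d cd; have := block_idemM hv c d; rewrite {1}gaE cd -gaE (block_idemM hv) eqxx.
  case: eqP => // _ /eqP; by rewrite (negPf (block_idem_neq0 hv d)).
have gaI c : #|bI (T' (ga c))| = #|bI (T c)|.
  have := dim_block_idem hv' mT' (ga c); rewrite -gaE (dim_block_idem hv mT) => /eqP.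
  by rewrite !mulnn eqn_exp2r // => /eqP.
rewrite -(card_image ga_inj); apply: subset_leq_card; apply/fintype.subsetP => _ /fintype.imageP[c + ->].
by rewrite !inE gaI.
Qed.

Variables (C : finType) (T : C -> block K) (v : unit_family A T).
Variables (C' : finType) (T' : C' -> block K) (v' : unit_family A T').

Theorem matrix_units_count : twisted_units v -> twisted_units v' ->
    (forall c, #|bG (T c)| = 1%N) -> (forall c, #|bG (T' c)| = 1%N) ->
  forall n, #|[pred c | #|bI (T c)| == n]| = #|[pred c | #|bI (T' c)| == n]|.
Proof.
by move=> hv hv' mT mT' n; apply/eqP; rewrite eqn_leq !(matrix_units_count_le (v := v) (v' := v'))
  ?(matrix_units_count_le (v := v') (v' := v)).
Qed.

End TwoFamilies.

(** * Matrix units and matrix decompositions *)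

(** Matrix units whose blocks are numbered by pairs of a size [n < N] and an index
below [m n]. Bounding [n] makes the set of blocks finite, and with this choice
the sizes agree by computation, so that no casts are needed. *)
Section Normalized.
Variables (K : fieldType) (A : fdAlgebra K) (m : nat -> nat) (N : nat).
Hypothesis mN : forall n, (N <= n)%N -> m n = 0%N.

Local Notation C := {n : 'I_N & 'I_(m n)}.
Variable base : forall c : C, 'I_(tag c).

Definition norm_block (c : C) : block K := mat_block K (base c).
Local Notation T := norm_block.

Lemma m_bound n (i : 'I_(m n)) : (n < N)%N.
Proof. by rewrite ltnNge; apply/negP => /mN mn; case: i; rewrite mn. Qed.

Definition norm_comp n (i : 'I_(m n)) : C :=
  Tagged (fun n : 'I_N => 'I_(m n)) (i : 'I_(m (Ordinal (m_bound i)))).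

Definition norm_idx n (i : 'I_(m n)) (x y : 'I_n) : tidx T :=
  @mkidx K _ T (norm_comp i) x y 1%g.

Lemma norm_compP (c : C) : exists n (i : 'I_(m n)), c = norm_comp i.
Proof.
case: c => -[n nN] i; exists n, i; rewrite /norm_comp.
by have -> : m_bound i = nN by apply: bool_irrelevance.
Qed.

Lemma norm_idxP (s : tidx T) : exists n (i : 'I_(m n)) x y, s = norm_idx i x y.
Proof.
case: s => c; have [n [i ->]] := norm_compP c; case=> -[x y] g.
by exists n, i, x, y; rewrite /norm_idx /mkidx /= [g]ord1.
Qed.

Lemma norm_idx_eq n (i : 'I_(m n)) (x y : 'I_n) n' (i' : 'I_(m n')) (x' y' : 'I_n') :
  n = n' -> i = i' :> nat -> x = x' :> nat -> y = y' :> nat -> norm_idx i x y = norm_idx i' x' y'.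
Proof.
move=> nn; case: _ / nn in i' x' y' *.
by move=> /val_inj -> /val_inj -> /val_inj ->.
Qed.

Lemma card_norm x : #|[pred c : C | val (tag c) == x]| = m x.
Proof.
have [xN|Nx] := ltnP x N; last first.
  rewrite mN //; apply: eq_card0 => c; rewrite !inE; apply/eqP => cx.
  by have := ltn_ord (tag c); rewrite cx ltnNge Nx.
rewrite -[RHS]card_ord; pose f (i : 'I_(m x)) := norm_comp i.
have fi : injective f.
  by move=> i j /eqP; rewrite /f /norm_comp (bool_irrelevance (m_bound i) (m_bound j)) eq_Tagged => /eqP.
rewrite -(card_codom fi); apply: eq_card => c; rewrite !inE; apply/eqP/codomP => [|[i ->//]].
have [n [i ->]] := norm_compP c => /= nx; case: _ / nx in f fi xN *.
by exists i.
Qed.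

Lemma norm_rowidx_eq (c c' : C) (y : 'I_(tag c)) (y' : 'I_(tag c')) :
  tag c = tag c' :> nat -> tagged c = tagged c' :> nat -> y = y' :> nat ->
  @rowidx K _ T c y = @rowidx K _ T c' y'.
Proof.
have [n [i ec]] := norm_compP c; have [n' [i' ec']] := norm_compP c'.
case: _ / (esym ec) in y *; case: _ / (esym ec') in y' * => /= nn.
by case: _ / nn in i' y' ec' * => /val_inj -> /val_inj ->.
Qed.

Section ToDecomposition.
Variable v : unit_family A T.
Hypothesis hv : twisted_units v.
Local Notation crd := (bcoord (tu_basis hv)).

Definition norm_map n (i : 'I_(m n)) (a : A) : matrix_fda K n :=
  \matrix_(x, y) crd a (norm_idx i x y).

Lemma norm_map_hom n (i : 'I_(m n)) : alg_hom (norm_map i).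
Proof.
split.
- by move=> k a a'; apply/matrixP => x y; rewrite !mxE bcoordP.
- apply/matrixP => x y; rewrite !mxE -(diag_idem_sum1 hv) bcoord_sum.
  have [<-|xy] := eqVneq x y.
    rewrite (bigD1 (@rowidx _ _ T (norm_comp i) x)) //= big1 ?addr0 => [|z zx].
      by rewrite diag_idemE bcoordZ bcoord_basis eqxx mulr1 /= invr1.
    rewrite diag_idemE bcoordZ bcoord_basis; case: eqP => [|_]; last by rewrite mulr0.
    move=> E; case/eqP: zx; apply: (@diag_idx_inj _ _ T); exact: E.
  rewrite big1 // => z _; rewrite diag_idemE bcoordZ bcoord_basis; case: eqP => [|_]; last by rewrite mulr0.
  case: z => c z /mkidx_eqP[/eqP zx /eqP zy]; case/eqP: xy; apply/eqP.
  rewrite -(rowidx_eq (T := T) (c := norm_comp i)); rewrite -(eqP zx); exact: zy.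
move=> a a'; apply/matrixP => x y; rewrite !mxE.
under eq_bigr do rewrite !mxE.
rewrite {1}(bcoordE (tu_basis hv) a) mulr_suml bcoord_sum.
have hi : injective (fun z : 'I_n => norm_idx i x z).
  by move=> z z' /eqP; rewrite (mkidx_eq (T := T)) => /and3P[_ /eqP].
rewrite (big_inj_support hi) => [|s sN].
  apply: eq_bigr => z _; rewrite -fda_scalerAl bcoordZ; congr (_ * _).
  rewrite [in LHS](bcoordE (tu_basis hv) a') mulr_sumr bcoord_sum.
  rewrite (bigD1 (norm_idx i z y)) //= big1 ?addr0 => [|t tN].
    set k := crd a' _; rewrite -(fda_scalerAr k) bcoordZ.
    rewrite -[tu_elt _ _ * _]/(@v (norm_comp i) x z 1%g * @v (norm_comp i) z y 1%g) (tuM hv) bcoordZ.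
    rewrite (bcoord_basis (tu_basis hv) (@mkidx _ _ T (norm_comp i) x y (1 * 1)%g)) mulg1 eqxx /=.
    by rewrite !mulr1.
  set k := crd a' t; rewrite -(fda_scalerAr k) bcoordZ.
  have [->|[c [p [q [r [g [h [e1 e2 ->]]]]]]]] := tu_mulP hv (norm_idx i x z) t.
    by rewrite bcoord0 mulr0.
  rewrite bcoordZ bcoord_basis; case: eqP => [e3|_]; last by rewrite !mulr0.
  case/eqP: tN; rewrite e2.
  have [_ zq] := mkidx_eqP e1.
  have [_ ry] := @mkidx_eqP _ _ T c (norm_comp i) p r x y _ 1%g e3.
  have cc := congr1 (@tag _ _) zq; rewrite /= in cc.
  case: _ / cc in p q r g h e1 e2 e3 zq ry *.
  move/rowidx_inj: zq => <-; move/rowidx_inj: ry => ->.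
  by rewrite [h]ord1.
have [c [p [q [g sE]]]] := tidxP s.
rewrite -fda_scalerAl bcoordZ (bcoordE (tu_basis hv) a') mulr_sumr bcoord_sum big1 ?mulr0 // => t _.
set k := crd a' t; rewrite -(fda_scalerAr k) bcoordZ.
have [->|[c' [p' [q' [r [g' [h [e1 e2 ->]]]]]]]] := tu_mulP hv s t.
  by rewrite bcoord0 mulr0.
rewrite bcoordZ bcoord_basis; case: eqP => [e3|_]; last by rewrite !mulr0.
exfalso; have [xp _] := @mkidx_eqP _ _ T c' (norm_comp i) p' r x y _ 1%g e3.
have cc := esym (congr1 (@tag _ _) xp); rewrite /= in cc.
case: _ / cc in p' q' r g' h e1 e2 e3 xp *.
move: (sN q'); rewrite e1; move/rowidx_inj: xp => ->.
by rewrite [g']ord1 eqxx.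
Qed.

Lemma norm_map_bij :
  bijective (fun a => (fun n i => @norm_map n i a) : forall n : nat, 'I_(m n) -> matrix_fda K n).
Proof.
apply: inj_surj_bij.
  move=> a a' E; apply: (bcoord_inj (hb := tu_basis hv)) => s.
  have [n [i [x [y ->]]]] := norm_idxP s.
  have : norm_map i a = norm_map i a' by exact: (congr1 (fun F : forall n : nat, 'I_(m n) -> matrix_fda K n => F n i) E).
  by move/matrixP/(_ x y); rewrite !mxE.
move=> X; exists (\sum_(s : tidx T) X (tag (tag s)) (tagged (tag s)) (tagged s).1.1 (tagged s).1.2 *: tu_elt v s).
apply: functional_extensionality_dep => n; apply/funext => i; apply/matrixP => x y.
rewrite mxE; set k := fun s : tidx T => X (tag (tag s)) (tagged (tag s)) (tagged s).1.1 (tagged s).1.2.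
by rewrite (@bcoord_uniq _ _ _ _ (tu_basis hv) k).
Qed.

End ToDecomposition.

Section FromDecomposition.
Variable p : forall n : nat, 'I_(m n) -> A -> matrix_fda K n.
Hypothesis phom : forall n i, alg_hom (@p n i).
Variable q : (forall n : nat, 'I_(m n) -> matrix_fda K n) -> A.
Hypothesis pK : forall a, q (fun n i => p i a) = a.
Hypothesis qK : forall X n i, p i (q X) = X n i.

Lemma decomp_inj a a' : (forall n (i : 'I_(m n)) x y, p i a x y = p i a' x y) -> a = a'.
Proof.
move=> E; rewrite -(pK a) -(pK a'); congr q.
apply: functional_extensionality_dep => n; apply/funext => i; apply/matrixP => x y; exact: E.
Qed.

(** The family with one elementary matrix. Comparing indices as natural numbers
gives a meaning to the definition in all sizes at once. *)
Definition delta_fam (c : C) (x y : 'I_(tag c)) (n : nat) (i : 'I_(m n)) : matrix_fda K n :=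
  \matrix_(x', y') [&& n == tag c :> nat, i == tagged c :> nat, x' == x :> nat & y' == y :> nat]%:R.

Definition decomp_units (c : C) (x y : bI (T c)) (_ : bG (T c)) : A := q (delta_fam (c := c) x y).

Lemma decomp_coord (k : tidx T -> K) n (i : 'I_(m n)) x y :
  p i (\sum_s k s *: tu_elt decomp_units s) x y = k (norm_idx i x y).
Proof.
have [lp _ _] := phom i.
rewrite (lin_sum lp) summxE (bigD1 (norm_idx i x y)) //= big1 ?addr0 => [|s sN].
  by rewrite (linZ lp) mxE qK mxE !eqxx mulr1.
rewrite (linZ lp) mxE qK mxE; have [n' [i' [x' [y' sE]]]] := norm_idxP s.
rewrite sE in sN *; case: and4P => [[/eqP /= e1 /eqP /= e2 /eqP e3 /eqP e4]|_]; last by rewrite mulr0.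
by case/eqP: sN; apply: norm_idx_eq.
Qed.

Lemma decomp_units_twisted : twisted_units decomp_units.
Proof.
split.
- split=> [a|k k0 s].
    exists (fun s => p (tagged (tag s)) a (tagged s).1.1 (tagged s).1.2).
    by apply: decomp_inj => n i x y; rewrite decomp_coord.
  have [n [i [x [y ->]]]] := norm_idxP s; rewrite -(decomp_coord k) k0.
  by have [lp _ _] := phom i; rewrite (lin0 lp) mxE.
- move=> c x y z g h; rewrite scale1r; apply: decomp_inj => n i u w.
  have [_ _ mp] := phom i; rewrite mp !qK !mxE.
  under eq_bigr do rewrite !mxE.
  have [nc|nc] := eqVneq n (tag c : nat); last by rewrite big1 // => j _; rewrite mul0r.
  case: _ / (esym nc) in i u w mp *.
  rewrite (bigD1 y) //= big1 ?addr0 => [|j jy].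
    by rewrite !eqxx /= andbT -natrM mulnb; congr (nat_of_bool _)%:R; rewrite andbACA andbb.
  by rewrite (_ : (j == y :> nat) = false) ?andbF ?mul0r //; apply/negP; rewrite val_eqE; apply/negP.
move=> c c' x y g y' z h yy; apply: decomp_inj => n i u w.
have [lp _ mp] := phom i; rewrite mp !qK (lin0 lp) !mxE big1 // => j _; rewrite !mxE.
case: and4P => [[/eqP e1 /eqP e2 _ /eqP e3]|_]; last by rewrite mul0r.
case: and4P => [[/eqP e4 /eqP e5 /eqP e6 _]|_]; last by rewrite mulr0.
by case/eqP: yy; apply: norm_rowidx_eq; congruence.
Qed.

End FromDecomposition.

End Normalized.

Section BlockMult.
Variables (K : fieldType) (A : fdAlgebra K).
Variables (C : finType) (T : C -> block K).
Variable v : unit_family A T.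
Hypothesis hv : twisted_units v.
Hypothesis matrixT : forall c, #|bG (T c)| = 1%N.

Lemma bI_gt0 c : (0 < #|bI (T c)|)%N.
Proof. by apply/card_gt0P; exists (bi0 (T c)). Qed.

Lemma exists_decomposition : exists b, matrix_decomposition A b.
Proof.
have [N Nmax] : exists N, forall c, (#|bI (T c)| < N)%N.
  by exists (\max_c #|bI (T c)|).+1 => c; rewrite ltnS (leq_bigmax (F := fun c => #|bI (T c)|)).
pose b : {fsfun nat -> nat with 0%N} :=
  [fsfun n in [fset n | n in iota 0 N]%fset => #|[pred c | #|bI (T c)| == n]|].
have bE n : b n = #|[pred c | #|bI (T c)| == n]|.
  rewrite fsfunE !inE mem_iota /= add0n; case: ltnP => // Nn.
  apply/esym/eq_card0 => c; rewrite !inE; apply/negP => /eqP cn.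
  by have := Nmax c; rewrite cn ltnNge Nn.
have bN n : (N <= n)%N -> b n = 0%N.
  by move=> Nn; rewrite fsfunE !inE mem_iota /= add0n ltnNge Nn.
have [be bb beP] : exists2 be : {n : 'I_N & 'I_(b n)} -> C, bijective be & forall c, #|bI (T (be c))| = val (tag c).
  apply: (@count_bij _ C nat (fun c : {n : 'I_N & 'I_(b n)} => val (tag c)) (fun c => #|bI (T c)|)) => x.
  by rewrite card_norm // bE.
pose base (c : {n : 'I_N & 'I_(b n)}) : 'I_(tag c) :=
  cast_ord (beP c) (enum_rank (bi0 (T (be c)))).
have [|v' [hv' _]] := @reindex_units _ _ _ _ v hv _ (norm_block K base) be bb.
  by move=> c; apply/block_iso_sym/mat_block_iso; rewrite ?card_ord.
exists b; split.
  by rewrite bE; apply: eq_card0 => c; rewrite !inE eqn0Ngt bI_gt0.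
exists (norm_map bN hv'); split; first exact: norm_map_hom.
exact: norm_map_bij.
Qed.

(** Matrix units give a decomposition, so [block_mult] is one; it gives matrix
units in turn, whose sizes are the same by [matrix_units_count]. *)
Lemma block_mult_count n : block_mult A n = #|[pred c | #|bI (T c)| == n]|.
Proof.
(* the choice made in [block_mult] is a decomposition, as one exists *)
have [b0 [p [phom [q pK qK]]]] : matrix_decomposition A (block_mult A).
  by have [b bP] := exists_decomposition; apply: (xgetPex [fsfun] (ex_intro _ b bP)).
set b := block_mult A in b0 p phom q pK qK *.
pose N := (\max_(n <- finsupp b) n).+1.
have bN k : (N <= k)%N -> b k = 0%N.
  move=> Nk; apply/eqP; rewrite -memNfinsupp; apply: contraTN Nk => kb.
  by rewrite -ltnNge ltnS leq_bigmax_seq.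
have base (c : {n : 'I_N & 'I_(b n)}) : 'I_(tag c).
  case: c => -[[|k] kN] i /=; last exact: ord0.
  by exfalso; case: i => /= i; rewrite b0.
have qK' X k (i : 'I_(b k)) : p k i (q X) = X k i.
  exact: (congr1 (fun F : forall n : nat, 'I_(b n) -> matrix_fda K n => F k i) (qK X)).
have hw := decomp_units_twisted bN base phom pK qK'.
rewrite (matrix_units_count hv hw matrixT); last by move=> c; rewrite card_ord.
by rewrite -(card_norm bN n); apply: eq_card => c; rewrite !inE card_ord.
Qed.

End BlockMult.

(** * Matrix units of twisted group algebras and of their matrix algebras *)

(** Write [M = L Q] with [L] of full column rank and [Q] of full row rank: then
[Q L = 0] and [tr (L Q) = tr (Q L)]. *)
Lemma mxtrace_sqr0 (K : fieldType) n (M : 'M[K]_n) : M *m M = 0 -> \tr M = 0.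
Proof.
move=> MM.
suff H r (L : 'M[K]_(n, r)) (Q : 'M[K]_(r, n)) : M = L *m Q -> row_full L -> row_free Q -> \tr M = 0.
  by apply: (H _ (col_base M) (row_base M)); rewrite ?mulmx_base ?col_base_full ?row_base_free.
move=> ME /row_fullP[L' LL] /row_freeP[Q' QQ]; rewrite ME mxtrace_mulC.
suff -> : Q *m L = 0 by rewrite mxtrace0.
have -> : Q *m L = (L' *m L) *m (Q *m L) *m (Q *m Q') by rewrite LL QQ mul1mx mulmx1.
by rewrite !mulmxA -(mulmxA L' L Q) -ME -(mulmxA (L' *m M)) -ME -(mulmxA L') MM mulmx0 mul0mx.
Qed.

Lemma basis_mulE (K : fieldType) (B : fdAlgebra K) (S : finType) (b : S -> B)
    (hb : is_basis b) (x y : B) :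
  x * y = \sum_s \sum_t (bcoord hb x s * bcoord hb y t) *: (b s * b t).
Proof.
rewrite {1}(bcoordE hb x) mulr_suml; apply: eq_bigr => s _.
rewrite {1}(bcoordE hb y) mulr_sumr; apply: eq_bigr => t _.
by rewrite -fda_scalerAl -fda_scalerAr scalerA.
Qed.

Section TwistedGroupAlgebra.
Variables (K : fieldType) (G : finGroupType) (f : cocycle2 K G).
Local Notation B := (twisted_group_algebra f).

Definition tw_unit (g : G) : B := tw_basis K g.

Lemma tw_unit_basis : is_basis tw_unit.
Proof.
have sumE (k : G -> K) h : (\sum_g k g *: tw_basis K g) h = k h.
  rewrite sum_ffunE (bigD1 h) //= big1 ?addr0 => [|g gh].
    by rewrite !ffunE eqxx -[LHS]/(_ * _) mulr1.
  by rewrite !ffunE eq_sym (negPf gh) scaler0.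
split=> [x|k k0 g].
  by exists (fun g => (x : {ffun G -> K^o}) g); apply/ffunP => h; rewrite -[RHS]/((\sum_g _ *: tw_basis K g) h) sumE.
by have k0' : \sum_g k g *: tw_basis K g = 0 := k0; rewrite -(sumE k) k0' ffunE.
Qed.

Lemma tw_unitM g h : tw_unit g * tw_unit h = f g h *: tw_unit (g * h)%g.
Proof. exact: tw_basisM. Qed.

Local Notation crd := (bcoord tw_unit_basis).

Hypothesis char0 : (#|G|%:R : K) != 0.

(** The trace of the multiplication by [y] is a nonzero multiple of the coordinate
of [y] at 1. If [x B x = 0], then [u_h x] squares to zero for all [h], so its
coordinate at 1 vanishes, and this is a multiple of the coordinate of [x] at
[h^-1]. *)
Lemma twisted_semiprime : semiprime B.
Proof.
pose n := #|G|.
pose M (y : B) : 'M[K]_n := \matrix_(i, j) crd (y * tw_unit (enum_val i)) (enum_val j).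
have MM y y' : M y *m M y' = M (y' * y).
  apply/matrixP => i j; rewrite !mxE -mulrA [in RHS](bcoordE tw_unit_basis (y * _)) mulr_sumr bcoord_sum.
  rewrite [RHS](reindex (enum_val : 'I_n -> G)) /=; last first.
    by exists enum_rank => ? _; rewrite ?enum_valK ?enum_rankK.
  by apply: eq_bigr => k _; rewrite !mxE -fda_scalerAr bcoordZ.
have trM y : \tr (M y) = #|G|%:R * f 1%g 1%g * crd y 1%g.
  transitivity (\sum_g crd (y * tw_unit g) g).
    rewrite [RHS](reindex (enum_val : 'I_n -> G)) /=; last first.
      by exists enum_rank => ? _; rewrite ?enum_valK ?enum_rankK.
    by apply: eq_bigr => i _; rewrite mxE.
  rewrite (eq_bigr (fun=> f 1%g 1%g * crd y 1%g)); first by rewrite sumr_const -[RHS]mulrA mulr_natl.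
  move=> g _; rewrite {1}(bcoordE tw_unit_basis y) mulr_suml bcoord_sum (bigD1 1%g) //= big1 ?addr0 => [|h h1].
    rewrite -fda_scalerAl tw_unitM !bcoordZ bcoord_basis mul1g eqxx mulr1 cocycle1g.
    by rewrite mulrC.
  rewrite -fda_scalerAl tw_unitM !bcoordZ bcoord_basis; case: eqP => [|_]; last by rewrite !mulr0.
  by move/eqP; rewrite -[X in _ == X]mul1g (inj_eq (mulIg g)) (negPf h1).
move=> x xBx; apply: (bcoord_inj (hb := tw_unit_basis)) => g; rewrite bcoord0.
pose y := tw_unit g^-1%g * x.
have yy : y * y = 0 by rewrite /y -mulrA (mulrA x) xBx mulr0.
have : \tr (M y) = 0.
  apply: mxtrace_sqr0; rewrite MM yy; apply/matrixP => i j; by rewrite !mxE mul0r bcoord0.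
suff yE : crd y 1%g = crd x g * f g^-1%g g.
  rewrite trM yE => /eqP; rewrite !mulf_eq0 (negPf char0) !(negPf (cocycle_neq0 _ _ _)) /=.
  by rewrite orbF => /eqP.
rewrite /y [in LHS](bcoordE tw_unit_basis x) mulr_sumr bcoord_sum (bigD1 g) //= big1 ?addr0 => [|h hg].
  by rewrite -fda_scalerAr tw_unitM !bcoordZ bcoord_basis mulVg eqxx mulr1.
rewrite -fda_scalerAr tw_unitM !bcoordZ bcoord_basis; case: eqP => [|_]; last by rewrite !mulr0.
by move/eqP; rewrite -eq_mulVg1 eq_sym (negPf hg).
Qed.

End TwistedGroupAlgebra.

(** Units [w] of the twisted group algebras of the blocks refine twisted units of
[A] to units of type [fine_block], indexed by pairs of indices; conversely
units of the refined type assemble to units of type [T]. *)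
Section Composition.
Variables (K : fieldType) (A : fdAlgebra K) (C : finType) (T : C -> block K).
Variables (D : C -> finType) (U : forall c, D c -> block K).
Local Notation Bc c := (twisted_group_algebra (bf (T c))).
Variable w : forall c (d : D c), bI (U d) -> bI (U d) -> bG (U d) -> Bc c.
Hypothesis hw : forall c, twisted_units (@w c).

Definition fine_block (cd : {c : C & D c}) : block K :=
  @Block K (bI (T (tag cd)) * bI (U (tagged cd)))%type (bi0 _, bi0 _) _ (bf (U (tagged cd))).

Local Notation CD := {c : C & D c}.
Local Notation twb c := (tw_unit_basis (bf (T c))).

Definition fine_idx c (i j : bI (T c)) (t : tidx (@U c)) : tidx fine_block :=
  @mkidx _ _ fine_block (Tagged D (tag t)) (i, (tagged t).1.1) (j, (tagged t).1.2) (tagged t).2.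

Lemma fine_idxP (s : tidx fine_block) : exists c (i j : bI (T c)) t, s = fine_idx i j t.
Proof.
case: s => -[c d] [[[i p] [j q]] h]; exists c, i, j, (@mkidx _ _ (@U c) d p q h).
by [].
Qed.

Lemma fine_idx_tblk c c' (i j : bI (T c)) (i' j' : bI (T c')) t t' : fine_idx i j t = fine_idx i' j' t' ->
  @rowidx _ _ T c i = rowidx i' /\ @rowidx _ _ T c j = rowidx j'.
Proof.
move=> e; have [e1 e2] := mkidx_eqP e.
have H k k' (x : bI (T k)) (x' : bI (T k')) d d' (y : bI (U d)) (y' : bI (U d')) :
    @rowidx _ _ fine_block (Tagged D d) (x, y) = @rowidx _ _ fine_block (Tagged D d') (x', y') ->
    @rowidx _ _ T k x = rowidx x'.
  move/(congr1 (fun z : {cd : CD & bI (fine_block cd)} => @rowidx _ _ T (tag (tag z)) (tagged z).1)).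
  by [].
by split; [apply: H e1 | apply: H e2].
Qed.

Lemma fine_idx_inj c (i j : bI (T c)) : injective (fine_idx i j).
Proof.
case=> d [[p q] h] [d' [[p' q'] h']] /eqP e.
have /eqP := e; move/(congr1 (@tag _ _)) => /= /eqP; rewrite eq_Tagged => /eqP /= dd.
case: _ / dd in p' q' h' e *.
by move: e; rewrite mkidx_eq !xpair_eqE !eqxx /= => /and3P[/eqP-> /eqP-> /eqP->].
Qed.

Section Compose.
Variable v : unit_family A T.
Hypothesis hv : twisted_units v.

(** The identification of the twisted group algebra of the block [c] with the
corner at the rows [i] and [j]. *)
Definition corner_map c (i j : bI (T c)) (x : Bc c) : A := \sum_g bcoord (twb c) x g *: v i j g.

Lemma corner_map_linear c (i j : bI (T c)) : linear (corner_map i j).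
Proof.
move=> k x y; rewrite /corner_map scaler_sumr -big_split; apply: eq_bigr => g _ /=.
by rewrite bcoordP scalerDl scalerA.
Qed.

Lemma corner_map_unit c (i j : bI (T c)) g : corner_map i j (tw_unit (bf (T c)) g) = v i j g.
Proof.
rewrite /corner_map (bigD1 g) //= big1 ?addr0 ?bcoord_basis ?eqxx ?scale1r // => h hg.
by rewrite bcoord_basis eq_sym (negPf hg) scale0r.
Qed.

Lemma corner_mapM c (i j k : bI (T c)) x y : corner_map i j x * corner_map j k y = corner_map i k (x * y).
Proof.
rewrite (basis_mulE (twb c)) (lin_sum (corner_map_linear i k)).
rewrite [corner_map i j x]/corner_map mulr_suml; apply: eq_bigr => g _.
rewrite (lin_sum (corner_map_linear i k)) [corner_map j k y]/corner_map mulr_sumr; apply: eq_bigr => h _.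
rewrite -fda_scalerAl -fda_scalerAr scalerA (linZ (corner_map_linear i k)) tw_unitM.
by rewrite (linZ (corner_map_linear i k)) corner_map_unit (tuM hv).
Qed.

Lemma corner_mapM0 c c' (i j : bI (T c)) x (k l : bI (T c')) y :
  @rowidx _ _ T c j != rowidx k -> corner_map i j x * corner_map k l y = 0.
Proof.
move=> jk; rewrite /corner_map mulr_suml big1 // => g _; rewrite mulr_sumr big1 // => h _.
by rewrite -fda_scalerAl -fda_scalerAr (tuM0 hv) // !scaler0.
Qed.

Definition fine_units (cd : CD) (ip jq : bI (fine_block cd)) (h : bG (fine_block cd)) : A :=
  corner_map ip.1 jq.1 (w ip.2 jq.2 h).

Lemma fine_units_emb c (i j : bI (T c)) t :
  tu_elt fine_units (fine_idx i j t) = corner_map i j (tu_elt (@w c) t).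
Proof. by []. Qed.

Lemma fine_units_twisted : twisted_units fine_units.
Proof.
split.
- split=> [a|k k0 s].
    have [l ->] := proj1 (tu_basis hv) a; apply: in_span_sum => s _; apply: in_spanZ.
    have [c [i [j [g ->]]]] := tidxP s; rewrite -[tu_elt _ _]/(v i j g) -corner_map_unit.
    have [l' ->] := proj1 (tu_basis (@hw c)) (tw_unit (bf (T c)) g).
    rewrite (lin_sum (corner_map_linear i j)); apply: in_span_sum => t _.
    rewrite (linZ (corner_map_linear i j)) -fine_units_emb; apply/in_spanZ/in_span_basis.
  have [c [i [j [t ->]]]] := fine_idxP s.
  suff y0 : \sum_t k (fine_idx i j t) *: tu_elt (@w c) t = 0.
    exact: (proj2 (tu_basis (@hw c)) _ y0).
  apply: (bcoord_inj (hb := twb c)) => g; rewrite bcoord0 bcoord_sum.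
  have := congr1 (fun a => bcoord (tu_basis hv) a (mkidx i j g)) k0; rewrite bcoord0 => E; rewrite -[RHS]E {E}.
  have cb c' (i' j' : bI (T c')) x : @rowidx _ _ T c' i' = rowidx i /\ @rowidx _ _ T c' j' = rowidx j ->
      exists e : c' = c, bcoord (tu_basis hv) (corner_map i' j' x) (mkidx i j g) =
        bcoord (twb c) (ecast c (Bc c) e x) g.
    case=> ii jj; have cc := congr1 (@tag _ _) ii; rewrite /= in cc; exists cc.
    case: _ / cc in i j g ii jj k0 *.
    move/rowidx_inj: ii => ii; move/rowidx_inj: jj => jj.
    rewrite ii jj /corner_map bcoord_sum (bigD1 g) //= big1 ?addr0 => [|h hg].
      by rewrite bcoordZ (bcoord_basis (tu_basis hv) (mkidx i j g)) eqxx mulr1.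
    by rewrite bcoordZ (bcoord_basis (tu_basis hv) (mkidx i j h)) mkidx_eq !eqxx (negPf hg) mulr0.
  have cb0 c' (i' j' : bI (T c')) x : ~ (@rowidx _ _ T c' i' = rowidx i /\ @rowidx _ _ T c' j' = rowidx j) ->
      bcoord (tu_basis hv) (corner_map i' j' x) (mkidx i j g) = 0.
    move=> ne; rewrite /corner_map bcoord_sum big1 // => h _; rewrite bcoordZ.
    rewrite (bcoord_basis (tu_basis hv) (mkidx i' j' h)); case: eqP => [e|_]; last by rewrite mulr0.
    by case: ne; have [-> ->] := mkidx_eqP e.
  rewrite bcoord_sum (big_inj_support (@fine_idx_inj c i j)) => [|s' s'N].
    apply: eq_bigr => t' _; rewrite !bcoordZ fine_units_emb.
    have [//|e ->] := cb c i j (tu_elt (@w c) t'); by rewrite eq_axiomK.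
  rewrite bcoordZ; have [c' [i' [j' [t' sE]]]] := fine_idxP s'; rewrite sE in s'N *.
  rewrite fine_units_emb cb0 ?mulr0 // => -[ii jj].
  have cc := congr1 (@tag _ _) ii; rewrite /= in cc; case: _ / cc in i j g s t k0 s'N ii jj cb cb0 *.
  move/rowidx_inj: ii => ii; move/rowidx_inj: jj => jj.
  by have := s'N t'; rewrite ii jj eqxx.
- move=> cd ip jq kr g h; rewrite /fine_units corner_mapM (tuM (@hw _)).
  by rewrite (linZ (corner_map_linear _ _)).
move=> cd cd' ip jq g kr ls h; rewrite /fine_units.
case: cd ip jq g => c d [i p] [j q] g; case: cd' kr ls h => c' d' [k r] [l s] h /= ne.
have [jk|jk] := eqVneq (@rowidx _ _ T c j) (rowidx k); last exact: corner_mapM0.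
have cc := congr1 (@tag _ _) jk; rewrite /= in cc.
move: d' k r l s h ne jk; case: _ / cc => d' k r l s h ne jk.
move/rowidx_inj: jk => jk; rewrite -jk in ne *.
rewrite corner_mapM (tuM0 (@hw c)) ?(lin0 (corner_map_linear _ _)) //.
apply: contraNneq ne => qr; have dd := congr1 (@tag _ _) qr; rewrite /= in dd.
case: _ / dd in r s h qr *; move/rowidx_inj: qr => ->.
by [].
Qed.

End Compose.

Section Decompose.
Variable u : forall cd, bI (fine_block cd) -> bI (fine_block cd) -> bG (fine_block cd) -> A.
Hypothesis hu : twisted_units u.
Local Notation crdw c := (bcoord (tu_basis (@hw c))).

(** The same identification, expressed in the refined units. *)
Definition fine_map c (i j : bI (T c)) (x : Bc c) : A :=
  \sum_t crdw c x t *: tu_elt u (fine_idx i j t).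

Lemma fine_map_linear c (i j : bI (T c)) : linear (fine_map i j).
Proof.
move=> k x y; rewrite /fine_map scaler_sumr -big_split; apply: eq_bigr => t _ /=.
by rewrite bcoordP scalerDl scalerA.
Qed.

Lemma fine_map_unit c (i j : bI (T c)) t : fine_map i j (tu_elt (@w c) t) = tu_elt u (fine_idx i j t).
Proof.
rewrite /fine_map (bigD1 t) //= big1 ?addr0 ?bcoord_basis ?eqxx ?scale1r // => h hg.
by rewrite bcoord_basis eq_sym (negPf hg) scale0r.
Qed.

Lemma fine_mapM c (i j k : bI (T c)) x y : fine_map i j x * fine_map j k y = fine_map i k (x * y).
Proof.
rewrite (basis_mulE (tu_basis (@hw c))) (lin_sum (fine_map_linear i k)).
rewrite [fine_map i j x]/fine_map mulr_suml; apply: eq_bigr => s _.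
rewrite (lin_sum (fine_map_linear i k)) [fine_map j k y]/fine_map mulr_sumr; apply: eq_bigr => t _.
rewrite -fda_scalerAl -fda_scalerAr scalerA (linZ (fine_map_linear i k)); congr (_ *: _).
have [d [p [q [g ->]]]] := tidxP s; have [d' [q' [r [h ->]]]] := tidxP t.
rewrite -[tu_elt _ (fine_idx i j _)]/(u (cd := Tagged D d) (i, p) (j, q) g).
rewrite -[tu_elt _ (fine_idx j k _)]/(u (cd := Tagged D d') (j, q') (k, r) h).
rewrite -[tu_elt _ (mkidx p q g)]/(w p q g) -[tu_elt _ (mkidx q' r h)]/(w q' r h).
have [qq|qq] := eqVneq (@rowidx _ _ (@U c) d q) (rowidx q').
  have dd := congr1 (@tag _ _) qq; rewrite /= in dd; case: _ / dd in q' r h qq *.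
  move/rowidx_inj: qq => <-.
  rewrite (tuM hu) (tuM (@hw c)) (linZ (fine_map_linear i k)).
  by rewrite -[w p r _]/(tu_elt (@w c) (mkidx p r (g * h)%g)) fine_map_unit.
rewrite (tuM0 (@hw c)) // (lin0 (fine_map_linear _ _)) (tuM0 hu) //.
apply: contraNneq qq => e; have dd := congr1 (@tag _ _) e.
move/eqP: dd; rewrite /= eq_Tagged => /eqP /= dd; case: _ / dd in q' r h e *.
move/eqP: e; rewrite (rowidx_eq (T := fine_block)) xpair_eqE eqxx /= => /eqP ->.
by [].
Qed.

Lemma fine_mapM0 c c' (i j : bI (T c)) x (k l : bI (T c')) y :
  @rowidx _ _ T c j != rowidx k -> fine_map i j x * fine_map k l y = 0.
Proof.
move=> jk; rewrite /fine_map mulr_suml big1 // => s _; rewrite mulr_sumr big1 // => t _.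
rewrite -fda_scalerAl -fda_scalerAr /tu_elt (tuM0 hu) ?scaler0 //=.
apply: contraNneq jk.
move/(congr1 (fun z : {cd : CD & bI (fine_block cd)} => @rowidx _ _ T (tag (tag z)) (tagged z).1)).
by move=> ->.
Qed.

Definition coarse_units (c : C) (i j : bI (T c)) (g : bG (T c)) : A :=
  fine_map i j (tw_unit (bf (T c)) g).

Lemma coarse_units_twisted : twisted_units coarse_units.
Proof.
split.
- split=> [a|k k0 s].
    have [l ->] := proj1 (tu_basis hu) a; apply: in_span_sum => s _; apply: in_spanZ.
    have [c [i [j [t ->]]]] := fine_idxP s; rewrite -fine_map_unit.
    have [l' ->] := proj1 (twb c) (tu_elt (@w c) t).
    rewrite (lin_sum (fine_map_linear i j)); apply: in_span_sum => g _.
    rewrite (linZ (fine_map_linear i j)); apply: in_spanZ.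
    exact: (in_span_basis (tu_elt coarse_units) (mkidx i j g)).
  have [c [i [j [g ->]]]] := tidxP s.
  suff y0 : \sum_h k (mkidx i j h) *: tw_unit (bf (T c)) h = 0.
    exact: (proj2 (twb c) _ y0).
  apply: (bcoord_inj (hb := tu_basis (@hw c))) => t; rewrite bcoord0 bcoord_sum.
  have := congr1 (fun a => bcoord (tu_basis hu) a (fine_idx i j t)) k0; rewrite bcoord0 => E; rewrite -[RHS]E {E}.
  have cb x : bcoord (tu_basis hu) (fine_map i j x) (fine_idx i j t) = crdw c x t.
    rewrite /fine_map bcoord_sum (bigD1 t) //= big1 ?addr0 => [|h ht].
      by rewrite bcoordZ bcoord_basis eqxx mulr1.
    by rewrite bcoordZ bcoord_basis (inj_eq (@fine_idx_inj _ _ _)) (negPf ht) mulr0.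
  have cb0 c' (i' j' : bI (T c')) x : ~ (@rowidx _ _ T c' i' = rowidx i /\ @rowidx _ _ T c' j' = rowidx j) ->
      bcoord (tu_basis hu) (fine_map i' j' x) (fine_idx i j t) = 0.
    move=> ne; rewrite /fine_map bcoord_sum big1 // => h _; rewrite bcoordZ bcoord_basis.
    by case: eqP => [e|_]; [case: ne; apply: fine_idx_tblk e|rewrite mulr0].
  rewrite bcoord_sum (@big_tidx _ _ _ _ c i j) => [|c' i' j' h ij].
    by apply: eq_bigr => h _; rewrite !bcoordZ -[tu_elt coarse_units _]/(fine_map i j (tw_unit _ h)) cb.
  rewrite bcoordZ -[tu_elt coarse_units _]/(fine_map i' j' (tw_unit _ h)) cb0 ?mulr0 //.
  by case=> e1 e2; rewrite e1 e2 !eqxx in ij.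
- move=> c i j k g h; rewrite /coarse_units fine_mapM tw_unitM.
  by rewrite (linZ (fine_map_linear _ _)).
by move=> c c' i j g k l h; apply: fine_mapM0.
Qed.

End Decompose.
End Composition.

(** * The zeta function determines the sizes *)

(** The equality extends to sums of values of a polynomial, and a polynomial that
vanishes at all the values but [n] counts the occurrences of [n]. *)
Lemma power_sums_count (K : numFieldType) (C C' : finType) (x : C -> nat) (y : C' -> nat) :
    (forall k, \sum_c (x c)%:R ^+ k = \sum_c (y c)%:R ^+ k :> K) ->
  forall n, #|[pred c | x c == n]| = #|[pred c | y c == n]|.
Proof.
move=> xy n.
have hp (p : {poly K}) : \sum_c p.[(x c)%:R] = \sum_c p.[(y c)%:R].
  under eq_bigr do rewrite horner_coef; under [RHS]eq_bigr do rewrite horner_coef.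
  rewrite exchange_big [RHS]exchange_big /=; apply: eq_bigr => i _.
  by rewrite -!mulr_sumr xy.
pose N := maxn n (maxn (\max_c x c) (\max_c y c)).
(* vanishes at all naturals up to [N] except [n] *)
pose p : {poly K} := \prod_(m < N.+1 | m != n :> nat) ('X - m%:R%:P).
have pE k : (k <= N)%N -> p.[k%:R] = (k == n)%:R * p.[n%:R].
  move=> kN; have [->|kn] := eqVneq k n; first by rewrite mul1r.
  rewrite mul0r /p horner_prod (bigD1 (inord k)) /=; last by rewrite inordK ?ltnS.
  by rewrite hornerXsubC inordK ?ltnS // subrr mul0r.
have p0 : p.[n%:R] != 0.
  rewrite /p horner_prod; apply/prodf_neq0 => m mn.
  by rewrite hornerXsubC subr_eq0 eqr_nat eq_sym.
have sumE (D : finType) (u : D -> nat) : (forall c, u c <= N)%N ->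
    \sum_c p.[(u c)%:R] = #|[pred c | u c == n]|%:R * p.[n%:R].
  move=> uN; under eq_bigr do rewrite pE //.
  rewrite -mulr_suml; congr (_ * _); rewrite -sumr_const [RHS]big_mkcond /=.
  by apply: eq_bigr => c _; rewrite inE; case: eqP.
have := hp p; rewrite !sumE.
- by move/(mulIf p0)/eqP; rewrite eqr_nat => /eqP.
- by move=> c; rewrite /N !leq_max (leq_bigmax (F := y)) !orbT.
- by move=> c; rewrite /N !leq_max (leq_bigmax (F := x)) !orbT.
Qed.

Section NatCpow.
Variable R : realType.
Local Open Scope complex_scope.

Lemma nat_cpowM m n (s : R[i]) : (0 < m)%N -> (0 < n)%N ->
  nat_cpow (m * n) s = nat_cpow m s * nat_cpow n s.
Proof.
move=> m0 n0; case: s => x y; rewrite /nat_cpow natrM powRM ?ler0n //.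
rewrite lnM ?posrE ?ltr0n // mulrDr cosD sinD.
set a := _ `^ x; set b := _ `^ x.
set c1 := cos _; set c2 := cos _; set s1 := sin _; set s2 := sin _.
apply/eqP; rewrite eq_complex /=; apply/andP; split; apply/eqP.
  by rewrite mulrBr -!mulrA (mulrCA b c1) (mulrCA b s1).
rewrite mulrDr addrC -!mulrA; congr (_ + _); last first.
  by rewrite (mulrCA b s1).
by rewrite (mulrCA b c1).
Qed.

Lemma nat_cpow_nat n k : nat_cpow n (k%:R : R[i]) = n%:R ^+ k.
Proof.
have kE j : (j%:R : R[i]) = (j%:R : R) +i* 0.
  by rewrite -[RHS]/(real_complex R j%:R) rmorph_nat.
rewrite kE /nat_cpow mul0r cos0 sin0 mulr1 mulr0 powR_mulrn ?ler0n //.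
by rewrite -[LHS]/(real_complex R (n%:R ^+ k)) rmorphXn rmorph_nat.
Qed.

Lemma complex_alg_closed : alg_closed R[i].
Proof. by move=> p /closed_rootP. Qed.

End NatCpow.

Section TrivialGrading.
Variables (K : fieldType) (A : fdAlgebra K).

Lemma trivial_grading : grading A 'I_1.
Proof.
refine (@Grading K A 'I_1 (fun=> fullv) _ _ _).
- by move=> a; exists [:: 1%g], (fun=> a); split=> [g|]; rewrite ?memvf // big_seq1.
- move=> [|g [|h s]] x //=.
    by move=> _ _ + h; rewrite big_seq1 inE => xg /eqP ->.
  by rewrite !inE (ord1 g) (ord1 h).
by move=> *; apply: memvf.
Qed.

(** [homogeneous_units] for the grading by the trivial group: the theorem of
Wedderburn. *)
Lemma exists_matrix_units : alg_closed K -> semiprime A ->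
  exists (C : finType) (T : C -> block K) (v : unit_family A T),
    twisted_units v /\ forall c, #|bG (T c)| = 1%N.
Proof.
move=> cK sA; have [C [T [v [hv _ [io ioi]]]]] := homogeneous_units trivial_grading cK sA.
exists C, T, v; split=> // c; apply/eqP/fintype1P; exists 1%g => g.
by apply: ioi; rewrite [io c g]ord1 [io c 1%g]ord1.
Qed.

End TrivialGrading.

Section Chi.
Variables (R : realType).
Local Notation K := (complex R).

Lemma chi_matrix_units (A : fdAlgebra K) (C : finType) (T : C -> block K)
    (v : unit_family A T) :
    twisted_units v -> (forall c, #|bG (T c)| = 1%N) ->
  forall z, chi A z = \sum_c nat_cpow #|bI (T c)| (- z).
Proof.
move=> hv mT z; rewrite /chi; set b := block_mult A.
have bE n : b n = #|[pred c | #|bI (T c)| == n]| := block_mult_count hv mT n.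
have cb c : #|bI (T c)| \in finsupp b.
  by rewrite mem_finsupp bE -lt0n; apply/card_gt0P; exists c; rewrite inE.
transitivity (\sum_(n <- finsupp b) \sum_(c | #|bI (T c)| == n) nat_cpow #|bI (T c)| (- z)).
  apply: eq_bigr => n _; rewrite bE mulr_natl -sumr_const; apply: eq_big => [c|c /eqP <- //].
  by rewrite inE.
rewrite (exchange_big_dep xpredT) //=; apply: eq_bigr => c _.
rewrite big_mkcond (bigD1_seq #|bI (T c)|) ?fset_uniq //= eqxx big1 ?addr0 // => n.
by rewrite eq_sym => /negPf ->.
Qed.



Section Blocks.
Variables (A : fdAlgebra K) (C : finType) (T : C -> block K).
Local Notation Bc c := (twisted_group_algebra (bf (T c))).

Lemma exists_block_units : exists (D : C -> finType) (U : forall c, D c -> block K)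
    (w : forall c d, bI (U c d) -> bI (U c d) -> bG (U c d) -> Bc c),
  (forall c, twisted_units (w c)) /\ forall c d, #|bG (U c d)| = 1%N.
Proof.
have ex c : exists (D : finType) (U : D -> block K) (w : forall d, bI (U d) -> bI (U d) -> bG (U d) -> Bc c),
    twisted_units w /\ forall d, #|bG (U d)| = 1%N.
  apply: exists_matrix_units; first exact: complex_alg_closed.
  apply: twisted_semiprime; rewrite pnatr_eq0 -lt0n.
  by apply/card_gt0P; exists 1%g.
pose D c := sval (cid (ex c)); pose exU c := svalP (cid (ex c)).
pose U c := sval (cid (exU c)); pose exw c := svalP (cid (exU c)).
pose w c := sval (cid (exw c)); pose wP c := svalP (cid (exw c)).
exists D, U, w; split=> c; first by have [] := wP c.
by have [_ H] := wP c; apply: H.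
Qed.

(** The refined blocks have the products of sizes as sizes, and [n^s] is
multiplicative in [n]. *)
Lemma chi_composite (D : C -> finType) (U : forall c, D c -> block K)
    (w : forall c d, bI (U c d) -> bI (U c d) -> bG (U c d) -> Bc c) :
    (forall c, twisted_units (w c)) -> (forall c d, #|bG (U c d)| = 1%N) ->
  forall z, \sum_c nat_cpow #|bI (T c)| (- z) * zeta_cocycle (bf (T c)) z =
    \sum_(cd : {c : C & D c}) nat_cpow #|bI (@fine_block _ _ T D U cd)| (- z).
Proof.
move=> hw mU z.
transitivity (\sum_c \sum_(d : D c) nat_cpow (#|bI (T c)| * #|bI (U c d)|) (- z)).
  apply: eq_bigr => c _; rewrite /zeta_cocycle (chi_matrix_units (hw c) (mU c)) mulr_sumr.
  by apply: eq_bigr => d _; rewrite nat_cpowM ?bI_gt0.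
by rewrite sig_big_dep; apply: eq_bigr => -[c d] _; rewrite /= card_prod.
Qed.

Theorem chi_units (v : unit_family A T) :
    twisted_units v ->
  forall z, chi A z = \sum_c nat_cpow #|bI (T c)| (- z) * zeta_cocycle (bf (T c)) z.
Proof.
move=> hv z; have [D [U [w [hw mU]]]] := exists_block_units.
rewrite (chi_composite hw mU) (chi_matrix_units (fine_units_twisted hw hv)) //.
by move=> cd; apply: mU.
Qed.

(** At [z = -k] the two sides are the power sums of the sizes of matrix units of
[A] and of the sizes of the refined type. So the two families of sizes agree,
[A] has units of the refined type, and these assemble to units of type [T]. *)
Theorem units_of_chi : semiprime A ->
    (forall z, chi A z = \sum_c nat_cpow #|bI (T c)| (- z) * zeta_cocycle (bf (T c)) z) ->
  exists v : unit_family A T, twisted_units v.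
Proof.
move=> spA chiE; have [D [U [w [hw mU]]]] := exists_block_units.
have [C0 [T0 [v0 [hv0 mT0]]]] := exists_matrix_units (@complex_alg_closed R) spA.
have cnt n : #|[pred cd | #|bI (@fine_block _ _ T D U cd)| == n]| = #|[pred c | #|bI (T0 c)| == n]|.
  apply: (@power_sums_count K) => k.
  have := chiE (- k%:R); rewrite (chi_composite hw mU) (chi_matrix_units hv0 mT0) opprK.
  have powE (I : finType) (u : I -> nat) : \sum_i (u i)%:R ^+ k = \sum_i nat_cpow (u i) (k%:R : K).
    by apply: eq_bigr => i _; rewrite nat_cpow_nat.
  by rewrite !powE => ->.
have [be bb beP] := count_bij cnt.
have [|u [hu _]] := @reindex_units _ _ _ _ _ hv0 _ (@fine_block _ _ T D U) be bb.
  move=> cd; apply: (@block_iso_trans _ _ (mat_block K (bi0 (@fine_block _ _ T D U cd)))).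
    by apply: mat_block_iso; first exact: mU.
  by apply/block_iso_sym/mat_block_iso.
exists (coarse_units hw u); exact: coarse_units_twisted.
Qed.

End Blocks.
End Chi.

(** * Terms and blocks *)

Section Cohomology.
Variables (K : fieldType) (G : finGroupType).
Implicit Types f : cocycle2 K G.

Lemma cohomologous_refl f : cohomologous f f.
Proof.
exists (fun=> 1) => [g|g h]; first exact: oner_neq0.
by rewrite !mulr1 divr1 mulr1.
Qed.

Lemma cohomologous_sym f f' : cohomologous f f' -> cohomologous f' f.
Proof.
move=> [l l0 lP]; exists (fun g => (l g)^-1) => [g|g h]; first by rewrite invr_eq0.
rewrite lP -mulrA -[LHS]mulr1; congr (_ * _).
by rewrite -!invfM mulfV // !mulf_neq0 ?invr_eq0.
Qed.

Lemma cohomologous_trans f f' f'' :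
  cohomologous f f' -> cohomologous f' f'' -> cohomologous f f''.
Proof.
move=> [l l0 lP] [m m0 mP]; exists (fun g => l g * m g) => [g|g h]; first by rewrite mulf_neq0.
by rewrite mP lP -mulrA; congr (_ * _); rewrite invfM mulrACA; congr (_ * _); rewrite mulrACA.
Qed.

Definition hclass f : H2 K G := eqclass_of (@cohomologous K G) f.

Lemma hclassP f f' : hclass f = hclass f' <-> cohomologous f f'.
Proof.
by apply: eqclass_ofP; [apply: cohomologous_refl|apply: cohomologous_sym|apply: cohomologous_trans].
Qed.

Lemma cohomologous_ext f f' : (forall g h, f g h = f' g h) -> cohomologous f f'.
Proof.
move=> ff; have [l l0 lP] := cohomologous_refl f; exists l => // g h.
by rewrite -ff; apply: lP.
Qed.

Local Open Scope group_scope.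

Lemma aut_related_refl (c : H2 K G) : aut_related c c.
Proof.
have G1 : 1 \in Aut [set: G] by apply: group1.
exists 1, G1, (eqclass_repr c); rewrite eqclass_reprK; split=> //.
rewrite -{1}(eqclass_reprK c); apply/hclassP/cohomologous_ext => g h.
by rewrite /= /aut_fun invg1 !perm1.
Qed.

Lemma aut_cohomologous (phi : {perm G}) (Aphi : phi \in Aut [set: G]) f f' :
  cohomologous f f' -> cohomologous (aut_cocycle Aphi f) (aut_cocycle Aphi f').
Proof.
move=> [l l0 lP]; exists (fun g => l (phi^-1 g)) => [g|g h]; first exact: l0.
rewrite /= /aut_fun lP; congr (_ * (_ / l _))%R.
by have /Aut_morphic/morphicP -> := groupVr Aphi; rewrite ?inE.
Qed.

Lemma aut_related_sym (c d : H2 K G) : aut_related c d -> aut_related d c.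
Proof.
move=> [phi [Aphi [f [-> ->]]]]; exists phi^-1, (groupVr Aphi), (aut_cocycle Aphi f); split=> //.
apply/hclassP/cohomologous_ext => g h; by rewrite /= /aut_fun /= /aut_fun invgK !permK.
Qed.

Lemma aut_related_trans (c d e : H2 K G) : aut_related c d -> aut_related d e -> aut_related c e.
Proof.
move=> [phi [Aphi [f [-> ->]]]] [psi [Apsi [f' [/hclassP ff' ->]]]].
exists (phi * psi), (groupM Aphi Apsi), f; split=> //.
apply/hclassP; apply: (cohomologous_trans (f' := aut_cocycle Apsi (aut_cocycle Aphi f))).
  exact/aut_cohomologous/cohomologous_sym.
by apply: cohomologous_ext => g h; rewrite /= /aut_fun /= /aut_fun invMg !permM.
Qed.

Definition horbit (c : H2 K G) : H2_orbit K G := eqclass_of (@aut_related K G) c.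

Lemma horbitP c d : horbit c = horbit d <-> aut_related c d.
Proof.
by apply: eqclass_ofP; [apply: aut_related_refl|apply: aut_related_sym|apply: aut_related_trans].
Qed.

End Cohomology.

Section BlockIsoCases.
Variables (K : fieldType) (I : finType) (i0 : I).
Local Open Scope group_scope.

Lemma cohomologous_block_iso (G : finGroupType) (f f' : cocycle2 K G) :
  cohomologous f f' -> block_iso (Block i0 f) (Block i0 f').
Proof.
move=> [l l0 lP]; split=> //; exists id, (fun g => (l g)^-1%R); split=> //=; first by exists id.
- by move=> g; rewrite GRing.invr_eq0.
move=> g h; rewrite lP; field.
by rewrite !l0.
Qed.

Lemma aut_block_iso (G : finGroupType) (f : cocycle2 K G) (phi : {perm G})
    (Aphi : phi \in Aut [set: G]) :
  block_iso (Block i0 f) (Block i0 (aut_cocycle Aphi f)).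
Proof.
split=> //; exists phi, (fun=> 1%R); split=> [|g h|g|g h] /=.
- by exists phi^-1; [apply: permK|apply: permKV].
- by have /Aut_morphic/morphicP -> := Aphi; rewrite ?inE.
- exact: GRing.oner_neq0.
by rewrite /aut_fun !permK !GRing.mulr1 GRing.mul1r.
Qed.

(** Passing to the representatives of the cohomology class and of its orbit
changes the cocycle by an automorphism and coboundaries. *)
Lemma repr_block_iso (G : finGroupType) (f : cocycle2 K G) :
  block_iso (Block i0 f) (Block i0 (eqclass_repr (eqclass_repr (horbit (hclass f))))).
Proof.
set o := horbit _; have : aut_related (hclass f) (eqclass_repr o).
  by apply/horbitP; rewrite /horbit eqclass_reprK.
move=> [phi [Aphi [f' [/hclassP ff' oE]]]].
apply: block_iso_trans (cohomologous_block_iso ff') _.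
apply: block_iso_trans (aut_block_iso f' Aphi) _.
apply: cohomologous_block_iso; apply/hclassP.
by rewrite -[hclass _]/(eqclass_of _ _) -oE /hclass eqclass_reprK.
Qed.

Definition isog_rel (G H : finGroupType) : Prop := [set: G]%G \isog [set: H]%G.

Lemma isog_rel_bij (G H : finGroupType) : isog_rel G H ->
  exists2 pi : G -> H, bijective pi & {morph pi : g h / g * h}.
Proof.
move=> /isogP[pi inj im]; exists pi; last by move=> g h; rewrite morphM ?inE.
apply: inj_surj_bij => [g h|y].
  by move/injmP: inj => inj; apply: inj; rewrite inE.
have : y \in pi @* [set: G]%G by rewrite im inE.
by case/morphimP => x _ _ ->; exists x.
Qed.

Lemma bij_isog_rel (G H : finGroupType) (pi : G -> H) :
  bijective pi -> {morph pi : g h / g * h} -> isog_rel G H.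
Proof.
move=> [pi' piK pi'K] piM; pose m : {morphism [set: G] >-> H} := @Morphism _ _ [set: G] pi (in2W piM).
apply/isogP; exists m; first by apply/injmP => g h _ _ /(can_inj piK).
apply/setP => y; rewrite inE; apply/morphimP; exists (pi' y); rewrite ?inE //=.
Qed.

Lemma isog_block_iso (G H : finGroupType) (f : cocycle2 K G) (pi : G -> H) :
  bijective pi -> {morph pi : g h / g * h} ->
  exists f' : cocycle2 K H, block_iso (Block i0 f) (Block i0 f').
Proof.
move=> [pi' piK pi'K] piM.
have pi'M : {morph pi' : g h / g * h} by move=> g h; apply: (can_inj piK); rewrite piM !pi'K.
have f0 g h : f (pi' g) (pi' h) != 0%R by apply: cocycle_neq0.
have fC g h k : (f (pi' g) (pi' h) * f (pi' (g * h)%g) (pi' k) =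
    f (pi' h) (pi' k) * f (pi' g) (pi' (h * k)%g))%R by rewrite !pi'M cocycleP.
exists (Cocycle2 f0 fC); split=> //; exists pi, (fun=> 1%R); split=> //=.
- by exists pi'.
- by move=> g; apply: GRing.oner_neq0.
by move=> g h; rewrite !piK !GRing.mulr1 GRing.mul1r.
Qed.

End BlockIsoCases.

Section Terms.
Variable K : fieldType.

Lemma isog_rel_refl G : isog_rel G G. Proof. exact: isog_refl. Qed.
Lemma isog_rel_sym G H : isog_rel G H -> isog_rel H G.
Proof. by rewrite /isog_rel isog_sym. Qed.
Lemma isog_rel_trans G H J : isog_rel G H -> isog_rel H J -> isog_rel G J.
Proof. exact: isog_trans. Qed.

Definition term_block (t : term K) : block K :=
  @Block K 'I_(term_exp t) (Ordinal (term_exp_gt0 t)) (term_group t)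
    (eqclass_repr (eqclass_repr (term_orbit t))).

(** Every block is isomorphic to that of a term, made of representatives. *)
Lemma exists_term (B : block K) : exists t, block_iso (term_block t) B.
Proof.
have n0 : (0 < #|bI B|)%N by apply/card_gt0P; exists (bi0 B).
pose c : fingroup_class := eqclass_of isog_rel (bG B).
have GH : isog_rel (bG B) (eqclass_repr c).
  exact: (eqclass_reprP isog_rel_refl isog_rel_sym isog_rel_trans).
have [pi pib piM] := isog_rel_bij GH.
have [f' iso] := isog_block_iso (bi0 B) (bf B) pib piM.
exists (@Term K _ n0 c (horbit (hclass f'))); apply: block_iso_sym.
apply: (@block_iso_trans _ _ (Block (bi0 B) f')).
  by case: (B) f' iso => *.
have [_ iso'] := repr_block_iso (bi0 B) f'.
by split=> //; rewrite /= card_ord.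
Qed.

(** Isomorphic blocks have isomorphic groups, hence the same representative group,
and the isomorphism becomes an automorphism that relates the two classes. *)
Lemma term_block_inj t t' : block_iso (term_block t) (term_block t') -> t = t'.
Proof.
case: t => n n0 c o; case: t' => n' n0' c' o' [/= ].
rewrite !card_ord => nn; case: _ / nn in n0' *; rewrite (bool_irrelevance n0' n0).
move=> [pi [l [pib piM l0 lP]]].
have cc : c = c'.
  rewrite -(eqclass_reprK c) -(eqclass_reprK c').
  apply/(eqclass_ofP isog_rel_refl isog_rel_sym isog_rel_trans).
  exact: bij_isog_rel pib piM.
case: _ / cc in o' pi l pib piM l0 lP *; congr Term.
set G := eqclass_repr c in o o' pi l pib piM l0 lP *.
pose f := eqclass_repr (eqclass_repr o); pose f' := eqclass_repr (eqclass_repr o').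
have oE : o = horbit (hclass f) by rewrite /horbit /hclass !eqclass_reprK.
have o'E : o' = horbit (hclass f') by rewrite /horbit /hclass !eqclass_reprK.
rewrite oE o'E; apply/horbitP.
pose phi : {perm G} := perm (bij_inj pib).
have Aphi : phi \in Aut [set: G].
  rewrite inE; apply/andP; split; first by apply/fintype.subsetP => x _; rewrite inE.
  by apply/morphicP => x y _ _; rewrite !permE piM.
exists phi, Aphi, f; split=> //; apply/hclassP; apply: cohomologous_sym.
exists (fun g => (l (phi^-1%g g))^-1) => [g|g h]; first by rewrite invr_eq0.
have phiM x y : (phi^-1)%g (x * y)%g = ((phi^-1)%g x * (phi^-1)%g y)%g.
  by have /Aut_morphic/morphicP -> := groupVr Aphi; rewrite ?inE.
have piV x : pi ((phi^-1)%g x) = x by have := permKV phi x; rewrite [phi _]permE.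
have := lP ((phi^-1)%g g) ((phi^-1)%g h); rewrite !piV -phiM => E.
apply: (mulfI (mulf_neq0 (l0 ((phi^-1)%g g)) (l0 ((phi^-1)%g h)))).
rewrite /= /aut_fun -[LHS]E; field.
by rewrite !l0 oner_neq0.
Qed.

Lemma trivial_term_block t : trivial_term t <-> trivial_block (term_block t).
Proof. by rewrite /trivial_term /trivial_block /= card_ord. Qed.

Lemma trivial_block_uniq (B B' : block K) : trivial_block B -> trivial_block B' -> block_iso B B'.
Proof.
move=> [B1 B2] [B1' B2']; apply: block_iso_trans (mat_block_iso (bi0 B) B2 _) _; first by [].
by apply/block_iso_sym/mat_block_iso; rewrite // B1.
Qed.

End Terms.

(** * The correspondence *)

Section SameType.
Variables (K : fieldType) (A : fdAlgebra K) (C : finType) (T : C -> block K).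
Variables v v' : unit_family A T.
Hypotheses (hv : twisted_units v) (hv' : twisted_units v').

Definition transfer (a : A) : A := \sum_s bcoord (tu_basis hv) a s *: tu_elt v' s.

Lemma transfer_linear : linear transfer.
Proof.
move=> k x y; rewrite /transfer scaler_sumr -big_split; apply: eq_bigr => s _ /=.
by rewrite bcoordP scalerDl scalerA.
Qed.

Lemma transfer_elt s : transfer (tu_elt v s) = tu_elt v' s.
Proof.
rewrite /transfer (bigD1 s) //= big1 ?addr0 ?bcoord_basis ?eqxx ?scale1r // => t ts.
by rewrite bcoord_basis eq_sym (negPf ts) scale0r.
Qed.

Lemma transfer_coord a : bcoord (tu_basis hv') (transfer a) =1 bcoord (tu_basis hv) a.
Proof. exact: bcoord_uniq. Qed.

Lemma transfer_hom : alg_hom transfer.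
Proof.
split; first exact: transfer_linear.
- rewrite -{1}(diag_idem_sum1 hv) (lin_sum transfer_linear) -(diag_idem_sum1 hv').
  by apply: eq_bigr => x _; rewrite !diag_idemE (linZ transfer_linear) transfer_elt.
move=> x y; rewrite (basis_mulE (tu_basis hv) x y) (lin_sum transfer_linear).
rewrite [transfer x]/transfer mulr_suml; apply: eq_bigr => s _.
rewrite (lin_sum transfer_linear) [transfer y]/transfer mulr_sumr; apply: eq_bigr => t _.
rewrite -fda_scalerAl -fda_scalerAr scalerA (linZ transfer_linear); congr (_ *: _).
have [c [i [j [g ->]]]] := tidxP s; have [c' [j' [k [h ->]]]] := tidxP t.
rewrite -[tu_elt v' (mkidx i _ _)]/(v' i j g) -[tu_elt v' (mkidx j' _ _)]/(v' j' k h).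
rewrite -[tu_elt v (mkidx i _ _)]/(v i j g) -[tu_elt v (mkidx j' _ _)]/(v j' k h).
have [jj|jj] := eqVneq (rowidx j) (rowidx j'); last first.
  by rewrite (tuM0 hv) // (tuM0 hv') // (lin0 transfer_linear).
have cc := congr1 (@tag _ _) jj; rewrite /= in cc; case: _ / cc in j' k h jj *.
move/rowidx_inj: jj => <-; rewrite (tuM hv) (tuM hv') (linZ transfer_linear).
by rewrite -[v i k _]/(tu_elt v (mkidx i k (g * h)%g)) transfer_elt.
Qed.

End SameType.

Lemma transferK (K : fieldType) (A : fdAlgebra K) (C : finType) (T : C -> block K)
    (v v' : unit_family A T)
    (hv : twisted_units v) (hv' : twisted_units v') :
  cancel (transfer v' hv) (transfer v hv').
Proof.
move=> a; rewrite [LHS]/transfer [RHS](bcoordE (tu_basis hv)); apply: eq_bigr => s _.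
by rewrite transfer_coord.
Qed.

(** The universal group only depends on the type, so sending units to units is an
equivalence over the identity of that group. *)
Lemma same_type_equiv (K : fieldType) (A : fdAlgebra K) (C : finType) (T : C -> block K)
    (v v' : unit_family A T)
    (hv : twisted_units v) (hv' : twisted_units v') :
  graded_equiv (units_cg hv) (units_cg hv').
Proof.
exists (transfer v' hv), id; split; last by exists id.
  split=> //; first exact: transfer_hom.
  move=> g x /(units_compP hv) xg; apply/(units_compP hv') => s.
  by rewrite (transfer_coord hv hv'); apply: xg.
by exists (transfer v hv'); apply: transferK.
Qed.

Section FormalSums.
Variable X : Type.

Definition count_term (C : finType) (L : C -> X) (x : X) : nat := #|[pred c | `[< L c = x >]]|.

Lemma nodup_pick (V : nmodType) (s : seq X) (x : X) (F : X -> V) : List.NoDup s -> List.In x s ->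
  \sum_(t <- s | `[< x = t >]) F t = F x.
Proof.
elim: s => //= t s IHs /List.NoDup_cons_iff[ts ns] [<-|xs]; rewrite big_cons.
  rewrite asboolT // [X in _ + X](_ : _ = 0) ?addr0 //.
  elim: s ts {IHs ns} => [|u s IHs] /= ts; first by rewrite big_nil.
  rewrite big_cons asboolF ?IHs //; first by move=> ns; apply: ts; right.
  by move=> tu; apply: ts; left.
by rewrite asboolF ?IHs // => xt; apply: ts; rewrite -xt.
Qed.

Lemma sum_count (V : nmodType) (C : finType) (L : C -> X) (s : seq X) (F : X -> V) :
    List.NoDup s -> (forall c, List.In (L c) s) ->
  \sum_c F (L c) = \sum_(t <- s) F t *+ count_term L t.
Proof.
move=> ns Ls; transitivity (\sum_c \sum_(t <- s | `[< L c = t >]) F t).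
  by apply: eq_bigr => c _; rewrite nodup_pick.
elim: (s) => [|t r IHr]; first by rewrite big_nil big1 // => c _; rewrite big_nil.
rewrite big_cons -IHr -sumr_const [X in X + _]big_mkcond -big_split; apply: eq_bigr => c _ /=.
by rewrite big_cons inE; case: ifP; rewrite ?add0r.
Qed.

Lemma enum_values (C : finType) (L : C -> X) : exists s, List.NoDup s /\
  forall t, List.In t s <-> count_term L t <> 0%N.
Proof.
pose dec (x y : X) : {x = y} + {x <> y} := pselect (x = y).
exists (List.nodup dec [seq L c | c <- enum C]); split; first exact: List.NoDup_nodup.
move=> t; rewrite List.nodup_In; split.
  move=> Ht /eqP; apply/negP; rewrite -lt0n; apply/card_gt0P.
  suff [c _ ct] : exists2 c, c \in enum C & L c = t by exists c; rewrite inE.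
  elim: (enum C) Ht => //= c e IHe [ct|/IHe[d de dt]]; first by exists c; rewrite ?mem_head.
  by exists d; rewrite // inE de orbT.
move/eqP; rewrite -lt0n => /card_gt0P[c]; rewrite inE => <-.
have : c \in enum C by rewrite mem_enum.
elim: (enum C) => //= d e IHe; rewrite inE => /predU1P[->|/IHe]; first by left.
by right.
Qed.

(** A finite formal sum as a finite family in which terms are repeated according
to their coefficients. *)
Lemma list_of_count (a : X -> nat) (s : seq X) : List.NoDup s ->
    (forall t, List.In t s <-> a t <> 0%N) ->
  exists (C : finType) (L : C -> X), a = count_term L.
Proof.
elim: s a => [|x s IHs] a ns aP.
  exists void, (fun e : void => match e with end); apply/funext => t.
  transitivity 0%N; last by apply/esym/eq_card0; case.
  by apply: contrapT => /aP.
move/List.NoDup_cons_iff: ns => [xs ns].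
pose a' t := if `[< x = t >] then 0%N else a t.
have [|C [L aE]] := IHs a' ns.
  move=> t; rewrite /a'; have [xt|xt] := pselect (x = t).
    by rewrite asboolT //; split=> // ts; case: xs; rewrite xt.
  rewrite asboolF // -aP /=; split; first by right.
  by case.
exists ('I_(a x) + C)%type, (fun c => match c with inl _ => x | inr d => L d end).
apply/funext => t; rewrite /count_term.
transitivity (#|[pred c : 'I_(a x) | `[< x = t >]]| + count_term L t)%N.
  rewrite -aE /a'; have [xt|xt] := pselect (x = t).
    rewrite asboolT // addn0 -xt -[LHS]card_ord; apply: eq_card => i; by rewrite !inE.
  by rewrite asboolF // eq_card0 // => i; rewrite !inE asboolF.
rewrite /count_term -!sum1_card [RHS]big_sumType /=; by congr (_ + _)%N; apply: eq_bigl => c; rewrite !inE.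
Qed.

End FormalSums.

Section Correspondence.
Variable R : realType.
Local Notation K := (complex R).
Variable A : fdAlgebra K.
Hypothesis spA : semiprime A.

Let cK : alg_closed K. Proof. exact: complex_alg_closed. Qed.

(** The correspondence of the theorem, as a relation. *)
Definition realizes (a : term K -> nat) (d : conn_grading_class A) :=
  exists (C : finType) (L : C -> term K)
    (v : forall c, bI (term_block (L c)) -> bI (term_block (L c)) -> bG (term_block (L c)) -> A)
    (hv : twisted_units v), a = count_term L /\ d = gclass (units_cg hv).

Lemma term_sum (C : finType) (L : C -> term K) (s : seq (term K)) z :
    List.NoDup s -> (forall t, List.In t s <-> count_term L t <> 0%N) ->
  \sum_c nat_cpow #|bI (term_block (L c))| (- z) * zeta_cocycle (bf (term_block (L c))) z =
  \sum_(t <- s) (count_term L t)%:R * nat_cpow (term_exp t) (- z) * zeta (term_orbit t) z.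
Proof.
move=> ns sP; pose F t : K := nat_cpow (term_exp t) (- z) * zeta (term_orbit t) z.
rewrite (eq_bigr (fun c => F (L c))) => [|c _]; last by rewrite /= card_ord.
rewrite (sum_count F ns) => [|c].
  by apply: eq_bigr => t _; rewrite -[LHS]mulr_natl mulrA.
by apply/sP/eqP; rewrite -lt0n; apply/card_gt0P; exists c; rewrite inE.
Qed.

Lemma realizes_chi_sum a d : realizes a d -> chi_sum A a.
Proof.
move=> [C [L [v [hv [-> _]]]]]; have [s [ns sP]] := enum_values L.
by exists s; split=> // z; rewrite (chi_units hv) (term_sum z ns sP).
Qed.

Lemma exists_realization a : chi_sum A a -> exists d, realizes a d.
Proof.
move=> [s [ns sP chiE]]; have [C [L aE]] := list_of_count ns sP.
rewrite aE in sP chiE *.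
have [|v hv] := @units_of_chi _ A C (fun c => term_block (L c)) spA.
  by move=> z; rewrite chiE (term_sum z ns sP).
by exists (gclass (units_cg hv)), C, L, v, hv.
Qed.

Definition at_most_one_trivial (a : term K -> nat) := forall t, trivial_term t -> (a t <= 1)%N.

Lemma realizes_maximal a d : realizes a d -> at_most_one_trivial a -> maximal_class d.
Proof.
move=> [C [L [v [hv [-> ->]]]]] a1; apply: maximal_units => // c c' tc tc'.
have LL : L c = L c' by apply/term_block_inj/trivial_block_uniq.
have /card_le1_eqP := a1 (L c) (iffRL (trivial_term_block _) tc).
by apply; rewrite inE.
Qed.

Lemma realizes_trivial a d : realizes a d -> maximal_class d -> at_most_one_trivial a.
Proof.
move=> [C [L [v [hv [-> ->]]]]] dmax t tt; apply/card_le1_eqP => c c'.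
rewrite !inE => Lc Lc'; apply/eqP; apply: contraT => cc'.
have two0 : (2%:R : K) != 0 by rewrite pnatr_eq0.
case: (two_trivial_not_maximal (hv := hv) two0 cc' _ _ dmax).
- by rewrite Lc'; apply/trivial_term_block.
- by rewrite Lc; apply/trivial_term_block.
Qed.

Lemma realizes_inj a a' d : realizes a d -> realizes a' d -> a = a'.
Proof.
move=> [C [L [v [hv [-> ->]]]]] [C' [L' [v' [hv' [-> /gclassP[f [phi E]]]]]]].
have [ga [ga' gaK ga'K] gaI] := graded_equivalence_blocks E.
apply/funext => t; rewrite /count_term.
have LL c : L c = L' (ga c) by apply: term_block_inj.
rewrite -(card_image (can_inj gaK)); apply: eq_card => c'; rewrite [RHS]inE.
apply/fintype.imageP/asboolP => [[c + ->]|Lc]; first by rewrite inE LL.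
by exists (ga' c'); rewrite ?ga'K // inE LL ga'K.
Qed.

Lemma reindex_homogeneous (X : conn_grading A) (C C' : finType) (T : C -> block K) (T' : C' -> block K)
    (v : unit_family A T) (be : C' -> C) :
    twisted_units v -> (forall s, homog (cg_grading X) (tu_elt v s)) ->
    bijective be -> (forall c, block_iso (T' c) (T (be c))) ->
  exists v' : unit_family A T',
    twisted_units v' /\ forall s, homog (cg_grading X) (tu_elt v' s).
Proof.
move=> hv vX bb bI'; have [v' [hv' v'E]] := reindex_units hv bb bI'.
exists v'; split=> // s; have [s' [k E]] := v'E _ (tagged s).1.1 (tagged s).1.2 (tagged s).2.
rewrite /tu_elt E; have [g gX] := vX s'; exists g; exact: rpredZ.
Qed.

Lemma maximal_of_homogeneous (X : conn_grading A) (C : finType) (T : C -> block K)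
    (v : unit_family A T) (hv : twisted_units v) :
    maximal_class (gclass X) -> (forall s, homog (cg_grading X) (tu_elt v s)) ->
  gclass (units_cg hv) = gclass X.
Proof.
move=> Xmax vX; apply: Xmax; have [phi q] := universal_quotient hv vX.
exact: (@quotient_gclass _ _ (units_cg hv) X id phi q).
Qed.

(** If [X] is maximal and [v] are units homogeneous in [X], then [X] is equivalent
to the universal grading of [v]. Any other family of the same type can be
reindexed to have literally the type of [v]. *)
Lemma maximal_realizes d : maximal_class d -> exists a, realizes a d /\
  forall d', realizes a d' -> d' = d.
Proof.
move=> dmax; have dE := eqclass_reprK d; set X := eqclass_repr d in dE.
rewrite -dE in dmax *.
have [C [T [v [hv vX _]]]] := homogeneous_units (cg_grading X) cK spA.
have [L LT] := choice (fun c => exists_term (T c)).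
have [||v1 [hv1 v1X]] := @reindex_homogeneous X C C T (fun c => term_block (L c)) v id hv _ _ LT.
- by move=> s; apply: vX.
- by exists id.
exists (count_term L); split; first by exists C, L, v1, hv1; rewrite (maximal_of_homogeneous hv1 dmax v1X).
move=> d' [C' [L' [v' [hv' [cL ->]]]]].
have [be bb beL] : exists2 be : C' -> C, bijective be & forall c, L (be c) = L' c.
  by apply: fibre_bij => t; have := congr1 (fun F => F t) cL.
have [|v2 [hv2 v2X]] := @reindex_homogeneous X C C' (fun c => term_block (L c))
  (fun c => term_block (L' c)) v1 be hv1 v1X bb.
  by move=> c; rewrite beL; apply: block_iso_refl.
rewrite -[eqclass_of _ X]/(gclass X) -(maximal_of_homogeneous hv2 dmax v2X).
exact/gclassP/same_type_equiv.
Qed.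

End Correspondence.

Lemma sval_inj (X : Type) (P : X -> Prop) : injective (@proj1_sig X P).
Proof. by move=> [x px] [y py] /= xy; apply: eq_exist. Qed.

Lemma bijective_swap (X Y : Type) (f : X -> Y) : bijective f -> exists g : Y -> X, bijective g.
Proof. by case=> g fK gK; exists g, f. Qed.

Theorem theoremC (R : realType) (A : fdAlgebra (complex R))
    (ssA : semisimple_algebra A) :
  exists F : {c : conn_grading_class A | maximal_class c} ->
             {a : term (complex R) -> nat |
                chi_sum A a /\
                forall t, trivial_term t -> (a t <= 1)%N},
    bijective F.
Proof.
have spA := semisimple_semiprime ssA.
pose Y := {a : term (complex R) -> nat | chi_sum A a /\ at_most_one_trivial a}.
have exG (a : Y) : exists d : {c : conn_grading_class A | maximal_class c},
    realizes (sval a) (sval d).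
  case: a => a [ca a1]; have [d ad] := exists_realization spA ca.
  by exists (exist _ d (realizes_maximal spA ad a1)).
have [G GP] := choice exG.
suff : bijective G by exact: bijective_swap.
apply: inj_surj_bij => [a a' aa'|[d dmax]].
  by apply: sval_inj; apply: realizes_inj (GP a) _; rewrite aa'.
have [a [ad aU]] := maximal_realizes spA dmax.
exists (exist _ a (conj (realizes_chi_sum ad) (realizes_trivial ad dmax))).
by apply: sval_inj; apply: aU; exact: (GP (exist _ a _)).
Qed.
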